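(* Let $a_0, b_0$ be scalars with $0 < |b_0| \le |a_0|$, let $F$ be the operator on $H^2(\mathbb{D})$ with $F1 = ((a_0-1) + b_0 z)z$ and $Fz^m = 0$ for $m \ge 1$, and let $S_1 = M_z + F$. Let $\mathcal{M}\subseteq H^2(\mathbb{D})$ be a nonzero closed $S_1$-invariant subspace. Then $\mathcal{M} = [\mathcal{M}\ominus S_1\mathcal{M}]_{S_1}$ if and only if there exist an inner function $\theta\in H^\infty(\mathbb{D})$, an outer polynomial $p\in\mathbb{C}[z]$ and a vector $\varphi$ such that $\mathcal{M}\ominus S_1\mathcal{M} = \mathbb{C}\varphi$ and $S_1\varphi = zp\theta$.
   Context: $H^2(\mathbb{D})$ is the Hardy space on the open unit disc, $M_z$ the unilateral shift on it, and $H^\infty(\mathbb{D})$ the bounded analytic functions. For a bounded operator $T$ and a set $S$ of vectors, $[S]_T$ is the smallest closed $T$-invariant subspace containing $S$ (for $S=\{f\}$, the closure of $\{p(T)f: p\in\mathbb{C}[z]\}$). A polynomial $p$ is outer if $\overline{\{qp:q\in\mathbb{C}[z]\}}=H^2(\mathbb{D})$. *)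

(* Defs.v *)
(* mathcomp + mathcomp-analysis + real-closed complex numbers R[i]. *)
From mathcomp Require Import all_boot all_order all_algebra.
From mathcomp Require Import all_classical all_reals all_analysis.
From mathcomp Require Export complex.
Import Order.TTheory GRing.Theory Num.Theory.
Import numFieldNormedType.Exports.

Set Implicit Arguments.
Unset Strict Implicit.
Unset Printing Implicit Defensive.

Local Open Scope ring_scope.
Local Open Scope classical_set_scope.
Local Open Scope complex_scope.

Section Hardy.
Variable R : realType.
Local Notation C := R[i].

(* Elements of H^2(D) are represented by their Taylor coefficient sequences. *)
Definition cseq := nat -> C.

(* modulus of a complex number, as a real number *)
Definition cmod (x : C) : R := Num.sqrt (complex.Re x ^+ 2 + complex.Im x ^+ 2).

(* convergence / limits of complex sequences and functions, via real and
   imaginary parts *)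
Definition cvgC (u : nat -> C) (L : C) : Prop :=
  (fun n => complex.Re (u n)) @ \oo --> complex.Re L /\
  (fun n => complex.Im (u n)) @ \oo --> complex.Im L.

Definition limC (u : nat -> C) : C :=
  (limn (fun n => complex.Re (u n))) +i* (limn (fun n => complex.Im (u n))).

(* f(r) -> L as r -> 1^- (r real) *)
Definition cvg_left1 (f : R -> C) (L : C) : Prop :=
  (fun r => complex.Re (f r)) x @[x --> 1^'-] --> complex.Re L /\
  (fun r => complex.Im (f r)) x @[x --> 1^'-] --> complex.Im L.

(* H^2(D): square summable coefficient sequences *)
Definition H2 : set cseq :=
  [set f | cvgn (series (fun n => cmod (f n) ^+ 2))].

(* the H^2 norm *)
Definition norm2 (f : cseq) : R :=
  Num.sqrt (limn (series (fun n => cmod (f n) ^+ 2))).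

(* the H^2 inner product <f, g> = sum_n f_n conj(g_n) *)
Definition inner (f g : cseq) : C :=
  limC (fun N => \sum_(n < N) f n * (g n)^*).

Definition caddf (f g : cseq) : cseq := fun n => f n + g n.
Definition cscalef (c : C) (f : cseq) : cseq := fun n => c * f n.
Definition csubf (f g : cseq) : cseq := fun n => f n - g n.

(* linear subspace of H^2 *)
Definition subspace (M : set cseq) : Prop :=
  M `<=` H2 /\ M (fun _ => 0) /\
  (forall f g, M f -> M g -> M (caddf f g)) /\
  (forall c f, M f -> M (cscalef c f)).

(* closed in the H^2 norm topology *)
Definition closedH2 (M : set cseq) : Prop :=
  forall (u : nat -> cseq) (f : cseq), (forall k, M (u k)) -> H2 f ->
    (fun k => norm2 (csubf (u k) f)) @ \oo --> (0 : R) -> M f.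

Definition closed_subspace (M : set cseq) : Prop := subspace M /\ closedH2 M.

Definition T_invariant (T : cseq -> cseq) (M : set cseq) : Prop :=
  forall f, M f -> M (T f).

(* [S]_T : smallest closed T-T_invariant subspace containing S *)
Definition gen_inv (T : cseq -> cseq) (S : set cseq) : set cseq :=
  [set f | forall N, closed_subspace N -> T_invariant T N -> S `<=` N -> N f].

(* M minus T M : elements of M orthogonal to T M *)
Definition wandering (T : cseq -> cseq) (M : set cseq) : set cseq :=
  [set f | M f /\ forall g, M g -> inner f (T g) = 0].

(* the line C phi *)
Definition cline (phi : cseq) : set cseq := [set cscalef c phi | c in [set: C]].

(* the unilateral shift M_z *)
Definition Mz (f : cseq) : cseq := fun n => if n is k.+1 then f k else 0.

(* F f = <f,1> F1, where F1 = ((a0 - 1) + b0 z) z, and F z^m = 0 for m >= 1 *)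
Definition Fop (a0 b0 : C) (f : cseq) : cseq :=
  fun n => f 0%N * (if n == 1%N then a0 - 1 else if n == 2%N then b0 else 0).

Definition S1 (a0 b0 : C) (f : cseq) : cseq := caddf (Mz f) (Fop a0 b0 f).

(* power series evaluation inside the disc *)
Definition psum (f : cseq) (z : C) (N : nat) : C := \sum_(n < N) f n * z ^+ n.
Definition hval (f : cseq) (z : C) : C := limC (psum f z).

(* H^infinity(D): the power series converges on D to a bounded function *)
Definition Hinf : set cseq :=
  [set f | exists B : R, forall z : C, cmod z < 1 ->
     cvgC (psum f z) (hval f z) /\ cmod (hval f z) <= B].

Definition expi (t : R) : C := cos t +i* sin t.

(* inner function: in H^infinity with radial boundary values of modulus one
   almost everywhere on the circle *)
Definition inner_fun (theta : cseq) : Prop :=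
  Hinf theta /\
  {ae (@lebesgue_measure R), forall t : R, t \in `[0, 2 * pi] ->
     exists L : C, cmod L = 1 /\
       cvg_left1 (fun r => hval theta ((r +i* 0) * expi t)) L}.

(* coefficient sequence of a polynomial *)
Definition pcoef (p : {poly C}) : cseq := fun n => p`_n.

(* outer polynomial: closure of {q p : q polynomial} is H^2 *)
Definition outer_poly (p : {poly C}) : Prop :=
  forall f, H2 f -> forall eps : R, 0 < eps ->
    exists q : {poly C}, norm2 (csubf (pcoef (q * p)) f) < eps.

(* coefficients of the product of a polynomial P with f (Cauchy product) *)
Definition pmulf (P : {poly C}) (f : cseq) : cseq :=
  fun n => \sum_(k < n.+1) P`_k * f (n - k)%N.

End Hardy.

(* Main.v *)
Require Import Defs.
From mathcomp Require Import all_boot all_order all_algebra.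
From mathcomp Require Import all_classical all_reals all_analysis.
From mathcomp Require Import complex ring lra measurable_realfun.
Import Order.TTheory GRing.Theory Num.Theory.
Import numFieldNormedType.Exports.
Import ComplexField.Normc.
Local Open Scope ring_scope.
Local Open Scope classical_set_scope.
Local Open Scope complex_scope.

Set Implicit Arguments.
Unset Strict Implicit.

(* Put A f = f + f(0) ((a0 - 1) + b0 z).  Then S1 = Mz A = A S1, so
   that S1 is similar to the shift and, by Beurling's theorem, A M = theta H^2
   for an inner function theta, with S1 M = z theta H^2.  A vector phi of M is
   orthogonal to S1 M exactly when A phi is a multiple of theta h, where
   h = 1 + (b0 / a0) |theta(0)|^2 z.  Since |b0| <= |a0| and |theta(0)| <= 1, the
   polynomial h is outer, hence phi always generates M: both sides of the
   equivalence hold for every M.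

   That theta has unimodular radial limits almost everywhere is Fatou's theorem.
   A sparse subsequence of the partial sums of the Fourier series of theta
   converges almost everywhere and in L^2 to a function g.  By Lebesgue's
   differentiation theorem the symmetric means of g over [t - h, t + h] tend to
   g(t) for almost every t; their Fourier expansion has the factors
   sin(nh) / (nh), and r^n is the integral of these factors against a positive
   kernel concentrating at 0, so that theta(r e^{it}) tends to g(t).  Finally
   |g| <= 1 and Parseval's identity force |g| = 1. *)

(** Boundary values serve only the definition [inner_fun]. Elsewhere, that theta is inner means that
    the vectors z^k theta are orthonormal, which makes multiplication by theta isometric on
    coefficient sequences; that N minus zN is a line for N = A M then follows from the commutativity
    of the Cauchy product. In Fatou's theorem the obstacle is pointwise convergence of the Fourier
    series. Dividing its n-th term by n makes the series absolutely convergent, so that its sum can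
    be identified along a sparse subsequence; a kernel with coefficients k r^k, in essence the
    derivative of the Poisson kernel, undoes the division. Trigonometric polynomials are integrated
    through primitives; the Lebesgue integral enters only with the boundary function. The
    coefficient of z in h arises because the inverse of A subtracts (theta(0) / a0) ((a0 - 1) + b0
    z) from theta h. Elements of zN vanish at 0, so they see only the part in b0 z, and its pairing
    with z theta has to be compensated. *)

Section ComplexModulus.
Variable R : realType.
Local Notation C := R[i].
Local Notation Re := complex.Re.
Local Notation Im := complex.Im.
Implicit Types (x y : C).

Lemma ReD x y : Re (x + y) = Re x + Re y. Proof. by case: x; case: y. Qed.
Lemma ImD x y : Im (x + y) = Im x + Im y. Proof. by case: x; case: y. Qed.
Lemma ReN x : Re (- x) = - Re x. Proof. by case: x. Qed.
Lemma ImN x : Im (- x) = - Im x. Proof. by case: x. Qed.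
Lemma ReB x y : Re (x - y) = Re x - Re y. Proof. by rewrite ReD ReN. Qed.
Lemma ImB x y : Im (x - y) = Im x - Im y. Proof. by rewrite ImD ImN. Qed.
Lemma ReM x y : Re (x * y) = Re x * Re y - Im x * Im y.
Proof. by case: x; case: y. Qed.
Lemma ImM x y : Im (x * y) = Re x * Im y + Im x * Re y.
Proof. by case: x; case: y. Qed.
Lemma Re_conj x : Re (Num.conj x) = Re x. Proof. by case: x. Qed.
Lemma Im_conj x : Im (Num.conj x) = - Im x. Proof. by case: x. Qed.
Lemma complexP x y : Re x = Re y -> Im x = Im y -> x = y.
Proof. by case: x; case: y => a b c d /= -> ->. Qed.

Lemma Re_realM (r : R) x : Re (r%:C * x) = r * Re x.
Proof. by rewrite ReM /= mul0r subr0. Qed.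
Lemma Im_realM (r : R) x : Im (r%:C * x) = r * Im x.
Proof. by rewrite ImM /= mul0r addr0. Qed.

Lemma conjD x y : Num.conj (x + y) = Num.conj x + Num.conj y.
Proof. by apply: complexP; rewrite ?ReD ?ImD ?Re_conj ?Im_conj ?ReD ?ImD; ring. Qed.
Lemma conjM x y : Num.conj (x * y) = Num.conj x * Num.conj y.
Proof. by apply: complexP; rewrite ?ReM ?ImM ?Re_conj ?Im_conj ?ReM ?ImM; ring. Qed.
Lemma conjK x : Num.conj (Num.conj x) = x.
Proof. by apply: complexP; rewrite ?Re_conj ?Im_conj ?opprK. Qed.
Lemma conj_real (r : R) : Num.conj (r%:C) = r%:C :> C.
Proof. by apply: complexP; rewrite ?Re_conj ?Im_conj //= oppr0. Qed.
Lemma conj0 : Num.conj 0 = 0 :> C. Proof. exact: (conj_real 0). Qed.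
Lemma conj1 : Num.conj 1 = 1 :> C. Proof. exact: (conj_real 1). Qed.
Lemma conjN x : Num.conj (- x) = - Num.conj x.
Proof. by apply: complexP; rewrite ?ReN ?ImN ?Re_conj ?Im_conj ?ReN ?ImN. Qed.
Lemma conj_sum (I : Type) (r : seq I) (P : pred I) (F : I -> C) :
  Num.conj (\sum_(i <- r | P i) F i) = \sum_(i <- r | P i) Num.conj (F i).
Proof. by elim/big_rec2: _ => [|i a b _ <-]; rewrite ?conj0 ?conjD. Qed.

Lemma Re_sum (I : Type) (r : seq I) (P : pred I) (F : I -> C) :
  Re (\sum_(i <- r | P i) F i) = \sum_(i <- r | P i) Re (F i).
Proof. by elim/big_rec2: _ => // i a b _ <-; rewrite ReD. Qed.
Lemma Im_sum (I : Type) (r : seq I) (P : pred I) (F : I -> C) :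
  Im (\sum_(i <- r | P i) F i) = \sum_(i <- r | P i) Im (F i).
Proof. by elim/big_rec2: _ => // i a b _ <-; rewrite ImD. Qed.

Lemma cmod_sq x : cmod x ^+ 2 = Re x ^+ 2 + Im x ^+ 2.
Proof. by rewrite sqr_sqrtr // addr_ge0 ?sqr_ge0. Qed.

Lemma cmod_ge0 x : 0 <= cmod x. Proof. exact: sqrtr_ge0. Qed.

Lemma cmod_normc x : cmod x = normc x. Proof. by case: x. Qed.

Lemma cmodM x y : cmod (x * y) = cmod x * cmod y.
Proof. by rewrite !cmod_normc normcM. Qed.

Lemma cmodD x y : cmod (x + y) <= cmod x + cmod y.
Proof. by rewrite !cmod_normc le_normcD. Qed.

Lemma cmod0 : cmod (0 : C) = 0. Proof. by rewrite cmod_normc normc0. Qed.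
Lemma cmod1 : cmod (1 : C) = 1. Proof. by rewrite cmod_normc normc1. Qed.
Lemma cmodN x : cmod (- x) = cmod x. Proof. by rewrite !cmod_normc normcN. Qed.
Lemma cmodX x n : cmod (x ^+ n) = cmod x ^+ n.
Proof. by elim: n => [|n IH]; rewrite ?expr0 ?cmod1 // !exprS cmodM IH. Qed.
Lemma cmod_conj x : cmod (Num.conj x) = cmod x.
Proof. by rewrite /cmod Re_conj Im_conj sqrrN. Qed.
Lemma cmod_eq0 x : cmod x = 0 -> x = 0.
Proof. by rewrite cmod_normc => /eq0_normc. Qed.
Lemma cmodV x : cmod x^-1 = (cmod x)^-1.
Proof. by rewrite !cmod_normc normcV. Qed.
Lemma cmod_real (r : R) : cmod (r%:C) = `|r|.
Proof. by rewrite /cmod /= expr0n addr0 sqrtr_sqr. Qed.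

Lemma mul_conj x : x * Num.conj x = (cmod x ^+ 2)%:C.
Proof. by apply: complexP; rewrite ?ReM ?ImM Re_conj Im_conj /= ?cmod_sq; ring. Qed.

Lemma cmodD_sq x y : cmod (x + y) ^+ 2 <= 2 * cmod x ^+ 2 + 2 * cmod y ^+ 2.
Proof.
rewrite !cmod_sq ReD ImD.
have := sqr_ge0 (Re x - Re y); have := sqr_ge0 (Im x - Im y); nra.
Qed.

Lemma Re_le_cmod x : `|Re x| <= cmod x.
Proof. by rewrite -sqrtr_sqr; apply: ler_wsqrtr; rewrite lerDl sqr_ge0. Qed.
Lemma Im_le_cmod x : `|Im x| <= cmod x.
Proof. by rewrite -sqrtr_sqr; apply: ler_wsqrtr; rewrite lerDr sqr_ge0. Qed.

End ComplexModulus.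

(** * Convergence of complex sequences *)

Section ComplexLimits.
Variable R : realType.
Local Notation C := R[i].
Local Notation Re := complex.Re.
Local Notation Im := complex.Im.
Implicit Types (u v : nat -> C).

Lemma cvgC_lim u (L : C) : cvgC u L -> limC u = L.
Proof.
by case=> h1 h2; apply: complexP; rewrite /limC /=; apply: cvg_lim.
Qed.

Lemma cvgC_cst (L : C) : cvgC (fun=> L) L.
Proof. by split; apply: cvg_cst. Qed.

Lemma cvgCD u v (L K : C) : cvgC u L -> cvgC v K ->
  cvgC (fun n => u n + v n) (L + K).
Proof.
move=> [a b] [c d]; split; rewrite ?ReD ?ImD.
  by rewrite (_ : (fun n => _) = (fun n => Re (u n) + Re (v n)));
    [apply: cvgD|apply/funext => n; rewrite ReD].
by rewrite (_ : (fun n => _) = (fun n => Im (u n) + Im (v n)));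
  [apply: cvgD|apply/funext => n; rewrite ImD].
Qed.

Lemma cvgCZ u (L c : C) : cvgC u L -> cvgC (fun n => c * u n) (c * L).
Proof.
move=> [a b]; split; rewrite ?ReM ?ImM.
  rewrite (_ : (fun n => _) = (fun n => Re c * Re (u n) - Im c * Im (u n))).
    by apply: cvgB; apply: cvgMr.
  by apply/funext => n; rewrite ReM.
rewrite (_ : (fun n => _) = (fun n => Re c * Im (u n) + Im c * Re (u n))).
  by apply: cvgD; apply: cvgMr.
by apply/funext => n; rewrite ImM.
Qed.

Lemma cvgC_conj u (L : C) : cvgC u L ->
  cvgC (fun n => Num.conj (u n)) (Num.conj L).
Proof.
move=> [a b]; split; rewrite ?Re_conj ?Im_conj.
  by under eq_fun do rewrite Re_conj.
by under eq_fun do rewrite Im_conj; apply: cvgN.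
Qed.

Lemma cvgC_cmod_sq u (L : C) : cvgC u L ->
  (fun n => cmod (u n) ^+ 2) @ \oo --> cmod L ^+ 2.
Proof.
move=> [a b]; rewrite cmod_sq; under eq_fun do rewrite cmod_sq.
by apply: cvgD; rewrite expr2; under eq_fun do rewrite expr2; apply: cvgM.
Qed.

Lemma cvgC_near u (L : C) :
  (fun n => cmod (u n - L) ^+ 2) @ \oo --> (0 : R) -> cvgC u L.
Proof.
move=> h.
have h0 : (fun n => cmod (u n - L)) @ \oo --> (0 : R).
  rewrite -(sqrtr0 R) (_ : (fun n => _) = (fun n => Num.sqrt (cmod (u n - L) ^+ 2))).
    by apply: continuous_cvg => //; apply: sqrt_continuous.
  by apply/funext => n; rewrite sqrtr_sqr ger0_norm ?cmod_ge0.
split; apply/cvgrPdist_le => e e0; near=> n.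
  rewrite distrC -ReB (le_trans (Re_le_cmod _)) //.
  rewrite -[leLHS]ger0_norm ?cmod_ge0 // -[cmod _]subr0 distrC.
  by near: n; apply: cvgr_dist_le.
rewrite distrC -ImB (le_trans (Im_le_cmod _)) //.
rewrite -[leLHS]ger0_norm ?cmod_ge0 // -[cmod _]subr0 distrC.
by near: n; apply: cvgr_dist_le.
Unshelve. all: by end_near. Qed.

Lemma cvgn_cauchy (x : nat -> R) :
  (forall e : R, 0 < e -> exists K, forall k l, (K <= k)%N -> (K <= l)%N ->
    `|x k - x l| <= e) -> cvgn x.
Proof.
move=> h; apply/cauchy_cvgP/cauchyP => e e0.
have [K hK] := h (e / 2) (divr_gt0 e0 (ltr0Sn _ 1)).
exists (x K); exists K => // k /= Kk.
rewrite /ball /= (le_lt_trans (hK _ _ (leqnn _) Kk)) //; lra.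
Qed.

End ComplexLimits.

(** * The Hilbert space of square-summable sequences *)

Section SquareSummable.
Variable R : realType.
Local Notation C := R[i].
Local Notation Re := complex.Re.
Local Notation Im := complex.Im.
Implicit Types (f g h : cseq R) (N : nat).

(** Squared norms, partial and full, keep square roots away; [norm2] is met only where [closedH2]
    and [outer_poly] impose it. *)
Definition psq f N : R := \sum_(n < N) cmod (f n) ^+ 2.
Definition nsq f : R := limn (series (fun n => cmod (f n) ^+ 2)).

Lemma psqE f : series (fun n => cmod (f n) ^+ 2) = psq f.
Proof. by apply/funext => N; rewrite /series /= big_mkord. Qed.

Lemma psq_nd f : {homo psq f : m n / (m <= n)%N >-> m <= n}.
Proof.
move=> m n mn; rewrite /psq -!(big_mkord xpredT (fun i => cmod (f i) ^+ 2)).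
by rewrite (big_cat_nat _ mn) //= lerDl sumr_ge0 // => i _; apply: sqr_ge0.
Qed.

Lemma H2_bounded f (B : R) : (forall N, psq f N <= B) -> H2 f.
Proof.
move=> h; rewrite /H2 /= psqE; apply: nondecreasing_is_cvgn.
  exact: psq_nd.
by exists B => _ [N _ <-].
Qed.

Lemma cvg_psq f : H2 f -> psq f @ \oo --> nsq f.
Proof. by rewrite /H2 /nsq /= psqE. Qed.

Lemma psq_le_nsq f N : H2 f -> psq f N <= nsq f.
Proof.
rewrite /nsq /H2 /= psqE => h.
exact: nondecreasing_cvgn_le (@psq_nd f) h N.
Qed.

Lemma nsq_le f (B : R) : (forall N, psq f N <= B) -> nsq f <= B.
Proof.
move=> h; have := H2_bounded h; rewrite /nsq /H2 /= psqE => c.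
by apply: limr_le => //; apply: nearW.
Qed.

Lemma psq_ge0 f N : 0 <= psq f N.
Proof. by apply: sumr_ge0 => i _; apply: sqr_ge0. Qed.

Lemma nsq_ge0 f : H2 f -> 0 <= nsq f.
Proof. by move=> hf; apply: le_trans (psq_le_nsq 0 hf); apply: psq_ge0. Qed.

Lemma norm2E f : norm2 f = Num.sqrt (nsq f). Proof. by []. Qed.

Lemma coef_le_nsq f n : H2 f -> cmod (f n) ^+ 2 <= nsq f.
Proof.
move=> hf; apply: le_trans (psq_le_nsq n.+1 hf).
by rewrite /psq big_ord_recr /= lerDr psq_ge0.
Qed.

Lemma nsq_eq0 f : H2 f -> nsq f <= 0 -> f = (fun=> 0).
Proof.
move=> hf h; apply/funext => n; apply: cmod_eq0; apply/eqP.
rewrite -sqrf_eq0 eq_le sqr_ge0 andbT.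
exact: le_trans (coef_le_nsq n hf) h.
Qed.

Lemma H2_0 : H2 ((fun=> 0) : cseq R).
Proof.
apply: (@H2_bounded _ 0) => N; rewrite /psq big1 // => i _.
by rewrite cmod0 expr0n.
Qed.

Lemma nsq0 : nsq (fun=> 0) = 0.
Proof.
apply/eqP; rewrite eq_le nsq_ge0 ?andbT; last exact: H2_0.
apply: nsq_le => N; rewrite /psq big1 // => i _.
by rewrite cmod0 expr0n.
Qed.

Lemma psqD f g N : psq (caddf f g) N <= 2 * psq f N + 2 * psq g N.
Proof.
by rewrite /psq !mulr_sumr -big_split /=; apply: ler_sum => i _; apply: cmodD_sq.
Qed.

Lemma H2D f g : H2 f -> H2 g -> H2 (caddf f g).
Proof.
move=> hf hg; apply: (@H2_bounded _ (2 * nsq f + 2 * nsq g)) => N.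
apply: (le_trans (psqD _ _ _)).
by have := psq_le_nsq N hf; have := psq_le_nsq N hg; lra.
Qed.

Lemma psqZ c f N : psq (cscalef c f) N = cmod c ^+ 2 * psq f N.
Proof.
by rewrite /psq mulr_sumr; apply: eq_bigr => i _; rewrite cmodM exprMn.
Qed.

Lemma H2Z c f : H2 f -> H2 (cscalef c f).
Proof.
move=> hf; apply: (@H2_bounded _ (cmod c ^+ 2 * nsq f)) => N.
by rewrite psqZ ler_wpM2l ?sqr_ge0 // psq_le_nsq.
Qed.

Arguments H2Z c {f}.

Lemma csubfE f g : csubf f g = caddf f (cscalef (-1) g).
Proof. by apply/funext => n; rewrite /csubf /caddf /cscalef mulN1r. Qed.

Lemma H2B f g : H2 f -> H2 g -> H2 (csubf f g).
Proof. by move=> hf hg; rewrite csubfE; apply: H2D => //; apply: H2Z. Qed.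

Lemma nsqZ c f : H2 f -> nsq (cscalef c f) = cmod c ^+ 2 * nsq f.
Proof.
move=> hf; apply: cvg_lim => //; rewrite psqE.
rewrite (_ : psq _ = (fun N => cmod c ^+ 2 * psq f N)); last exact/funext/psqZ.
by apply: cvgMr; apply: cvg_psq.
Qed.

Definition pin f g N : C := \sum_(n < N) f n * Num.conj (g n).

Lemma inner_lim f g (L : C) : cvgC (pin f g) L -> inner f g = L.
Proof. exact: cvgC_lim. Qed.

Lemma cvgn_abs_bounded (x : nat -> R) (B : R) :
  (forall N, \sum_(n < N) `|x n| <= B) -> cvgn (fun N => \sum_(n < N) x n).
Proof.
move=> h.
have <- : series x = (fun N => \sum_(n < N) x n).
  by apply/funext => N; rewrite /series /= big_mkord.
apply: normed_cvg; apply: nondecreasing_is_cvgn.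
  by apply: nondecreasing_series => n _ _; apply: normr_ge0.
by exists B => _ [N _ <-]; have := h N; rewrite -(big_mkord xpredT (fun i => `|x i|)).
Qed.

(** |f_n conj(g_n)| <= |f_n|^2 + |g_n|^2 makes the defining series absolutely convergent. *)
Lemma cvg_pin f g : H2 f -> H2 g -> cvgC (pin f g) (inner f g).
Proof.
move=> hf hg; rewrite /inner -/(pin f g) /cvgC /limC /=.
have b n : cmod (f n * Num.conj (g n)) <= cmod (f n) ^+ 2 + cmod (g n) ^+ 2.
  rewrite cmodM cmod_conj.
  by have := sqr_ge0 (cmod (f n) - cmod (g n)); have := cmod_ge0 (f n);
     have := cmod_ge0 (g n); nra.
have b2 N : \sum_(n < N) (cmod (f n) ^+ 2 + cmod (g n) ^+ 2) <= nsq f + nsq g.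
  by rewrite big_split /= lerD // psq_le_nsq.
have c (p : C -> R) : (forall x, `|p x| <= cmod x) ->
    cvgn (fun N => \sum_(n < N) p (f n * Num.conj (g n))).
  move=> hp; apply: (@cvgn_abs_bounded (fun n => p (f n * Num.conj (g n)))
    (nsq f + nsq g)) => N.
  apply: le_trans (b2 N); apply: ler_sum => i _.
  exact: le_trans (hp _) (b _).
split.
  have -> : (fun n => Re (pin f g n)) =
      (fun N => \sum_(n < N) Re (f n * Num.conj (g n))).
    by apply/funext => N; rewrite /pin Re_sum.
  exact: c (@Re_le_cmod R).
have -> : (fun n => Im (pin f g n)) =
    (fun N => \sum_(n < N) Im (f n * Num.conj (g n))).
  by apply/funext => N; rewrite /pin Im_sum.
exact: c (@Im_le_cmod R).
Qed.

Lemma innerDl f g h : H2 f -> H2 g -> H2 h ->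
  inner (caddf f g) h = inner f h + inner g h.
Proof.
move=> hf hg hh; apply: inner_lim.
have -> : pin (caddf f g) h = (fun N => pin f h N + pin g h N).
  by apply/funext => N; rewrite -big_split; apply: eq_bigr => i _; rewrite mulrDl.
by apply: cvgCD; apply: cvg_pin.
Qed.

Lemma innerZl c f g : H2 f -> H2 g -> inner (cscalef c f) g = c * inner f g.
Proof.
move=> hf hg; apply: inner_lim.
have -> : pin (cscalef c f) g = (fun N => c * pin f g N).
  by apply/funext => N; rewrite mulr_sumr; apply: eq_bigr => i _; rewrite mulrA.
by apply: cvgCZ; apply: cvg_pin.
Qed.

Lemma inner_conj f g : H2 f -> H2 g -> inner g f = Num.conj (inner f g).
Proof.
move=> hf hg; apply: inner_lim.
have -> : pin g f = (fun N => Num.conj (pin f g N)).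
  apply/funext => N; rewrite conj_sum; apply: eq_bigr => i _.
  by rewrite conjM conjK mulrC.
by apply: cvgC_conj; apply: cvg_pin.
Qed.

Lemma innerDr f g h : H2 f -> H2 g -> H2 h ->
  inner f (caddf g h) = inner f g + inner f h.
Proof.
move=> hf hg hh; have hgh := H2D hg hh.
by rewrite inner_conj // innerDl // conjD -!inner_conj.
Qed.

Lemma innerZr c f g : H2 f -> H2 g ->
  inner f (cscalef c g) = Num.conj c * inner f g.
Proof.
move=> hf hg; have hcg := H2Z c hg.
by rewrite inner_conj // innerZl // conjM -!inner_conj.
Qed.

Lemma innerBl f g h : H2 f -> H2 g -> H2 h ->
  inner (csubf f g) h = inner f h - inner g h.
Proof.
by move=> hf hg hh; rewrite csubfE innerDl ?innerZl ?mulN1r //; apply: H2Z.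
Qed.

Lemma innerBr f g h : H2 f -> H2 g -> H2 h ->
  inner f (csubf g h) = inner f g - inner f h.
Proof.
by move=> hf hg hh; rewrite csubfE innerDr ?innerZr ?conjN ?conj1 ?mulN1r //; apply: H2Z.
Qed.

Lemma inner_nsq f : H2 f -> inner f f = (nsq f)%:C.
Proof.
move=> hf; apply: inner_lim.
have -> : pin f f = (fun N => (psq f N)%:C).
  apply/funext => N; rewrite /psq rmorph_sum; apply: eq_bigr => i _.
  by rewrite mul_conj.
by split => /=; [apply: cvg_psq|apply: cvg_cst].
Qed.

Lemma nsqD f g : H2 f -> H2 g ->
  nsq (caddf f g) = nsq f + nsq g + 2 * Re (inner f g).
Proof.
move=> hf hg; have hfg := H2D hf hg.
have := inner_nsq hfg; rewrite innerDl // !innerDr // !inner_nsq // => /(congr1 (@complex.Re R)).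
rewrite [inner g f]inner_conj // !ReD Re_conj /= => <-; ring.
Qed.

Lemma nsqB f g : H2 f -> H2 g ->
  nsq (csubf f g) = nsq f + nsq g - 2 * Re (inner f g).
Proof.
move=> hf hg; rewrite csubfE nsqD //; last exact: H2Z.
rewrite innerZr // nsqZ //.
rewrite conjN conj1 mulN1r ReN cmodN cmod1 expr1n; ring.
Qed.

Lemma parallelogram f g : H2 f -> H2 g ->
  nsq (caddf f g) + nsq (csubf f g) = 2 * nsq f + 2 * nsq g.
Proof. by move=> hf hg; rewrite nsqD // nsqB //; ring. Qed.

Lemma nsqD_le f g : H2 f -> H2 g -> nsq (caddf f g) <= 2 * nsq f + 2 * nsq g.
Proof.
by move=> hf hg; rewrite -parallelogram // lerDl nsq_ge0 //; apply: H2B.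
Qed.

(** Pythagoras for the removal of the component along [g]. Nonnegativity of the left side is the
    Cauchy-Schwarz inequality; its comparison with an infimum yields the orthogonality in
    [projection]. *)
Lemma nsq_sub_component f g : H2 f -> H2 g -> 0 < nsq g ->
  nsq (csubf f (cscalef (inner f g / (nsq g)%:C) g)) =
  nsq f - cmod (inner f g) ^+ 2 / nsq g.
Proof.
move=> hf hg g0; set c := inner f g.
have hc := H2Z (c / (nsq g)%:C) hg.
rewrite nsqB // nsqZ // innerZr // -/c.
rewrite cmodM cmodV cmod_real exprMn exprVn real_normK ?num_real //.
have -> : Num.conj (c / (nsq g)%:C) * c = (cmod c ^+ 2 / nsq g)%:C.
  by rewrite -fmorphV conjM conj_real mulrAC [_ * c]mulrC mul_conj -rmorphM.
by rewrite /=; field; rewrite gt_eqF.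
Qed.

Lemma inner0r f : H2 f -> inner f (fun=> 0) = 0.
Proof.
move=> hf; apply: inner_lim; rewrite (_ : pin _ _ = fun=> 0); first exact: cvgC_cst.
by apply/funext => N; rewrite /pin big1 // => i _; rewrite conj0 mulr0.
Qed.

Lemma CauchySchwarz f g : H2 f -> H2 g ->
  cmod (inner f g) ^+ 2 <= nsq f * nsq g.
Proof.
move=> hf hg.
have [g0|g0] := leP (nsq g) 0.
  by rewrite (nsq_eq0 hg g0) inner0r // cmod0 expr0n nsq0 mulr0.
have := nsq_ge0 (H2B hf (H2Z (inner f g / (nsq g)%:C) hg)).
by rewrite nsq_sub_component // -ler_pdivrMr // subr_ge0.
Qed.

Lemma inner_cvg (u : nat -> cseq R) f g :
  (forall k, H2 (u k)) -> H2 f -> H2 g ->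
  (fun k => nsq (csubf (u k) f)) @ \oo --> (0 : R) ->
  cvgC (fun k => inner (u k) g) (inner f g).
Proof.
move=> hu hf hg h; apply: cvgC_near.
apply: (@squeeze_cvgr _ _ _ _ (fun=> 0) (fun k => nsq (csubf (u k) f) * nsq g)).
- apply: nearW => k; rewrite sqr_ge0 /= -innerBl //.
  by apply: CauchySchwarz => //; apply: H2B.
- exact: cvg_cst.
- by rewrite -[X in _ --> X](mul0r (nsq g)); apply: cvgMl.
Qed.

Lemma cvg_sum_ord (F : nat -> nat -> R) (l : nat -> R) N :
  (forall i, F^~ i @ \oo --> l i) ->
  (fun k => \sum_(i < N) F k i) @ \oo --> \sum_(i < N) l i.
Proof.
move=> h; elim: N => [|N IH].
  by rewrite big_ord0; under eq_fun do rewrite big_ord0; apply: cvg_cst.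
rewrite big_ord_recr /=; under eq_fun do rewrite big_ord_recr /=.
exact: cvgD.
Qed.

(** The Cauchy condition has the shape d k + d l because the parallelogram law yields it so for a
    minimizing sequence. Limits are taken coefficient by coefficient. *)
Lemma H2_complete (u : nat -> cseq R) (d : nat -> R) :
  (forall k, H2 (u k)) -> d @ \oo --> (0 : R) ->
  (forall k l, nsq (csubf (u k) (u l)) <= d k + d l) ->
  exists2 f, H2 f & (fun k => nsq (csubf (u k) f)) @ \oo --> (0 : R).
Proof.
move=> hu d0 hd.
have coef k l n : cmod (u k n - u l n) ^+ 2 <= d k + d l.
  by apply: le_trans (hd k l); apply: (coef_le_nsq n (H2B (hu k) (hu l))).
have small (e : R) : 0 < e -> exists K, forall k, (K <= k)%N -> d k <= e.
  move=> e0; have /cvgrPdist_le /(_ e e0) [K _ hK] := d0.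
  exists K => k /hK /=; rewrite sub0r normrN; apply: le_trans; exact: ler_norm.
have cau n (e : R) : 0 < e -> exists K, forall k l, (K <= k)%N -> (K <= l)%N ->
    cmod (u k n - u l n) <= e.
  move=> e0; have [|K hK] := small (e ^+ 2 / 2); first by rewrite divr_gt0 ?exprn_gt0.
  exists K => k l /hK hk /hK hl.
  rewrite -(ler_pXn2r (ltn0Sn 1)) ?nnegrE ?cmod_ge0 ?(ltW e0) //.
  by apply: (le_trans (coef k l n)); lra.
pose f n := limC (fun k => u k n).
have uf n : cvgC (fun k => u k n) (f n).
  split; rewrite /f /limC /=; apply: cvgn_cauchy => e /(cau n) [K hK];
    exists K => k l kK lK; apply: le_trans (hK k l kK lK).
    by rewrite -ReB Re_le_cmod.
  by rewrite -ImB Im_le_cmod.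
(* Within a partial sum l may tend to infinity, so a bound on d k + d l for large l passes to the
   limit f. *)
have bnd k N (e : R) : (exists L, forall l, (L <= l)%N -> d k + d l <= e) ->
    psq (csubf (u k) f) N <= e.
  move=> [L hL].
  have c : (fun l => psq (csubf (u k) (u l)) N) @ \oo --> psq (csubf (u k) f) N.
    apply: (@cvg_sum_ord (fun l i => cmod (csubf (u k) (u l) i) ^+ 2)
      (fun i => cmod (csubf (u k) f i) ^+ 2)) => i; apply: cvgC_cmod_sq.
    rewrite /csubf; apply: cvgCD; first exact: cvgC_cst.
    have -> : (fun n : nat => - u n i) = (fun n => (-1) * u n i).
      by apply/funext => n; rewrite mulN1r.
    by rewrite -[- f i]mulN1r; apply: cvgCZ.
  rewrite -(cvg_lim _ c) //; apply: limr_le; first by apply/cvg_ex; eexists; exact: c.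
  exists L => // l /= Ll; apply: le_trans (hL l Ll).
  by apply: le_trans (hd k l); apply: psq_le_nsq; apply: H2B.
have hf : H2 f.
  have [L hL] := small 1 ltr01.
  have h0 : H2 (csubf (u 0%N) f).
    apply: (@H2_bounded _ (d 0%N + 1)) => N; apply: bnd.
    by exists L => l /hL; rewrite lerD2l.
  have -> : f = csubf (u 0%N) (csubf (u 0%N) f).
    by apply/funext => n; rewrite /csubf; ring.
  exact: H2B.
exists f => //.
apply/cvgrPdist_le => e e0.
have [|K hK] := small (e / 2); first by rewrite divr_gt0.
exists K => // k /= Kk.
rewrite sub0r normrN ger0_norm; last by apply: nsq_ge0; apply: H2B.
apply: nsq_le => N; apply: bnd; exists K => l /hK; have := hK _ Kk; lra.
Qed.

End SquareSummable.

Arguments H2Z {R} c {f} _.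

(** * Closed subspaces and orthogonal projection *)

Section ClosedSubspaces.
Variable R : realType.
Local Notation C := R[i].
Implicit Types (f g h : cseq R) (M N K : set (cseq R)).

Lemma closed_nsq M (u : nat -> cseq R) f : closed_subspace M ->
  (forall k, M (u k)) -> H2 f ->
  (fun k => nsq (csubf (u k) f)) @ \oo --> (0 : R) -> M f.
Proof.
move=> [_ hM] hu hf h; apply: (hM u) => //.
rewrite -(sqrtr0 R); apply: continuous_cvg => //; exact: sqrt_continuous.
Qed.

Lemma nsq_of_norm2 f : H2 f -> nsq f = norm2 f ^+ 2.
Proof. by move=> hf; rewrite norm2E sqr_sqrtr // nsq_ge0. Qed.

(** Trades the norm in [closedH2] for its square once and for all; [closed_nsq] is the opposite
    passage. *)
Lemma closed_subspaceI M :
  M `<=` H2 (R:=R) -> M (fun=> 0) ->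
  (forall f g, M f -> M g -> M (caddf f g)) ->
  (forall c f, M f -> M (cscalef c f)) ->
  (forall u f, (forall k, M (u k)) -> H2 f ->
    (fun k => nsq (csubf (u k) f)) @ \oo --> (0 : R) -> M f) ->
  closed_subspace M.
Proof.
move=> h1 h2 h3 h4 h5; split; first by split.
move=> u f hu hf h; apply: (h5 u) => //.
rewrite (_ : (fun k => _) =
    (fun k => norm2 (csubf (u k) f) * norm2 (csubf (u k) f))).
  by rewrite -[X in _ --> X](mul0r 0); apply: cvgM.
by apply/funext => k; rewrite nsq_of_norm2 //; apply: H2B => //; apply: h1.
Qed.

Section Ops.
Variables (M : set (cseq R)) (cM : closed_subspace M).
Lemma subH2 f : M f -> H2 f. Proof. by case: cM => -[h _] _; apply: h. Qed.
Lemma sub0 : M (fun=> 0). Proof. by case: cM => -[_ []]. Qed.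
Lemma subD f g : M f -> M g -> M (caddf f g).
Proof. by case: cM => -[_ [_ [h _]]] _; apply: h. Qed.
Lemma subZ c f : M f -> M (cscalef c f).
Proof. by case: cM => -[_ [_ [_ h]]] _; apply: h. Qed.
Lemma subB f g : M f -> M g -> M (csubf f g).
Proof. by move=> hf hg; rewrite csubfE; apply: subD => //; apply: subZ. Qed.
End Ops.

Lemma closed_subspace_setI M N : closed_subspace M -> closed_subspace N ->
  closed_subspace (M `&` N).
Proof.
move=> cM cN; apply: closed_subspaceI.
- by move=> f [/(subH2 cM)].
- by split; [exact: (sub0 cM)|exact: (sub0 cN)].
- by move=> f g [? ?] [? ?]; split; [apply: (subD cM)|apply: (subD cN)].
- by move=> c f [? ?]; split; [apply: (subZ cM)|apply: (subZ cN)].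
- move=> u f hu hf h; split; apply: (closed_nsq _ _ hf h) => // k;
    by have [] := hu k.
Qed.

(** A minimizing sequence is Cauchy by the parallelogram law. Its terms satisfy the orthogonality up
    to an error tending to 0, and the relation passes to the limit. *)
Lemma projection K f : closed_subspace K -> H2 f ->
  exists2 p, K p & forall g, K g -> inner (csubf f p) g = 0.
Proof.
move=> cK hf.
pose D := [set nsq (csubf f g) | g in K].
have hD g : K g -> H2 (csubf f g) by move=> /(subH2 cK) hg; apply: H2B.
have D0 : has_inf D.
  split; first by exists (nsq (csubf f (fun=> 0))); exists (fun=> 0) => //; apply: sub0.
  by exists 0 => _ [g Kg <-]; apply: nsq_ge0; apply: hD.
have dle g : K g -> inf D <= nsq (csubf f g).
  by move=> Kg; apply: ge_inf; [case: D0|exists g].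
have /choice [u hu] : forall k : nat, exists g,
    K g /\ nsq (csubf f g) <= inf D + k.+1%:R^-1.
  move=> k; have [|_ [g Kg <-] /ltW hg] := inf_adherent (eps := k.+1%:R^-1) _ D0.
    by rewrite invr_gt0.
  by exists g.
have uK k : K (u k) by case: (hu k).
have uH k : H2 (u k) := subH2 cK (uK k).
have ud k : nsq (csubf f (u k)) <= inf D + k.+1%:R^-1 by case: (hu k).
have inv0 : (fun k => k.+1%:R^-1) @ \oo --> (0 : R) by exact: cvg_harmonic.
(* The parallelogram law doubles the excess 1 / (k + 1) of u_k over the infimum. *)
have [||p hp up] := @H2_complete _ u (fun k => 2 * k.+1%:R^-1) uH.
- by rewrite -[X in _ --> X](mulr0 2); apply: cvgMr.
- move=> k l /=.
  have := parallelogram (hD _ (uK l)) (hD _ (uK k)).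
  have -> : csubf (csubf f (u l)) (csubf f (u k)) = csubf (u k) (u l).
    by apply/funext => n; rewrite /csubf; ring.
  have -> : caddf (csubf f (u l)) (csubf f (u k)) =
      cscalef 2 (csubf f (cscalef 2^-1 (caddf (u l) (u k)))).
    apply/funext => n; rewrite /csubf /caddf /cscalef mulrBr mulrA divff ?mul1r; first by ring.
    by rewrite pnatr_eq0.
  (* The midpoint of u_k and u_l lies in K, so its squared distance to f is at least the infimum. *)
  have Km : K (cscalef 2^-1 (caddf (u l) (u k))).
    by apply: (subZ cK); apply: (subD cK).
  rewrite nsqZ; last exact: hD.
  have -> : cmod (2 : C) ^+ 2 = 4 by rewrite cmod_sq /=; ring.
  by move: (dle _ Km) (ud k) (ud l); move: (k.+1%:R^-1) (l.+1%:R^-1) => a b; lra.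
have Kp : K p by exact: closed_nsq up.
exists p => // g Kg; have hg := subH2 cK Kg.
have [g0|g0] := leP (nsq g) 0.
  by rewrite (nsq_eq0 hg g0) inner0r //; apply: hD.
(* Minimality is tested at u_k + c g, where c g is the component of f - u_k along g. *)
have e_small k : cmod (inner (csubf f (u k)) g) ^+ 2 <= nsq g * k.+1%:R^-1.
  pose c := inner (csubf f (u k)) g / (nsq g)%:C.
  have := nsq_sub_component (hD _ (uK k)) hg g0; rewrite -/c => e.
  have -> : cmod (inner (csubf f (u k)) g) ^+ 2 = nsq g * (cmod (inner (csubf f (u k)) g) ^+ 2 / nsq g).
    by field; rewrite gt_eqF.
  rewrite ler_pM2l //.
  have := dle (caddf (u k) (cscalef c g)) (subD cK (uK k) (subZ cK c Kg)).
  rewrite (_ : csubf f _ = csubf (csubf f (u k)) (cscalef c g)); last first.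
    by apply/funext => n; rewrite /csubf /caddf; ring.
  by rewrite e; have := ud k; move: (k.+1%:R^-1) => a; lra.
have lim0 : (fun k => cmod (inner (csubf f (u k)) g) ^+ 2) @ \oo --> (0 : R).
  apply: (@squeeze_cvgr _ _ _ _ (fun=> 0) (fun k => nsq g * k.+1%:R^-1)).
  - by apply: nearW => k; rewrite sqr_ge0 e_small.
  - exact: cvg_cst.
  - by rewrite -[X in _ --> X](mulr0 (nsq g)); apply: cvgMr.
have c1 : cvgC (fun k => inner (csubf f (u k)) g) (inner (csubf f p) g).
  apply: inner_cvg => //; [by move=> k; apply: hD|by apply: hD|].
  rewrite (_ : (fun k => _) = (fun k => nsq (csubf (u k) p))) //.
  apply/funext => k; rewrite (_ : csubf _ _ = cscalef (-1) (csubf (u k) p)).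
    by rewrite nsqZ ?cmodN ?cmod1 ?expr1n ?mul1r //; apply: H2B.
  by apply/funext => n; rewrite /csubf /cscalef; ring.
have /cvgC_cmod_sq c2 := c1.
apply: cmod_eq0; apply/eqP; rewrite -sqrf_eq0; apply/eqP.
exact: cvg_unique c2 lim0.
Qed.

End ClosedSubspaces.

(** * The shift, Cauchy products and Beurling's theorem *)

Section Shift.
Variable R : realType.
Local Notation C := R[i].
Local Notation Re := complex.Re.
Local Notation Im := complex.Im.
Implicit Types (f g h u v : cseq R) (M N K : set (cseq R)).
Local Notation shift k := (iter k (@Mz R)).

Lemma MzD f g : Mz (caddf f g) = caddf (Mz f) (Mz g).
Proof. by apply/funext => -[|n]; rewrite /caddf /= ?addr0. Qed.
Lemma MzZ c f : Mz (cscalef c f) = cscalef c (Mz f).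
Proof. by apply/funext => -[|n]; rewrite /cscalef /= ?mulr0. Qed.
Lemma MzB f g : Mz (csubf f g) = csubf (Mz f) (Mz g).
Proof. by apply/funext => -[|n]; rewrite /csubf /= ?subr0. Qed.

Lemma psq_Mz f L : psq (Mz f) L.+1 = psq f L.
Proof. by rewrite /psq big_ord_recl /= cmod0 expr0n add0r. Qed.

Lemma H2_Mz f : H2 f -> H2 (Mz f).
Proof.
move=> hf; apply: (@H2_bounded _ _ (nsq f)) => N.
by apply: le_trans (psq_nd _ (leqnSn N)) _; rewrite psq_Mz psq_le_nsq.
Qed.

Lemma H2_unMz f : H2 (Mz f) -> H2 f.
Proof.
move=> hf; apply: (@H2_bounded _ _ (nsq (Mz f))) => N.
by rewrite -psq_Mz psq_le_nsq.
Qed.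

Lemma nsq_Mz f : H2 f -> nsq (Mz f) = nsq f.
Proof.
move=> hf; apply: cvg_lim => //; rewrite psqE.
rewrite -(cvg_shiftS (psq (Mz f))).
have -> : [sequence psq (Mz f) n.+1]_n = psq f by apply/funext/psq_Mz.
exact: cvg_psq.
Qed.

Lemma cvgC_shiftS (x : nat -> C) (L : C) : cvgC (fun n => x n.+1) L -> cvgC x L.
Proof.
move=> [h1 h2]; split.
  by rewrite -(cvg_shiftS (fun n => Re (x n))).
by rewrite -(cvg_shiftS (fun n => Im (x n))).
Qed.

Lemma inner_Mz_adj f g : H2 f -> H2 g ->
  inner f (Mz g) = inner (fun n => f n.+1) g.
Proof.
move=> hf hg; apply: inner_lim; apply: cvgC_shiftS.
rewrite (_ : (fun n => _) = pin (fun n => f n.+1) g).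
  apply: cvg_pin => //; apply: H2_unMz.
  rewrite (_ : Mz _ = csubf f (fun n => if n == 0%N then f 0%N else 0)).
    apply: H2B => //; apply: (@H2_bounded _ _ (cmod (f 0%N) ^+ 2)) => -[|N].
      by rewrite /psq big_ord0 sqr_ge0.
    rewrite /psq big_ord_recl /= big1 ?addr0 // => i _.
    by rewrite cmod0 expr0n.
  by apply/funext => -[|n]; rewrite /csubf /= ?subrr ?subr0.
by apply/funext => N; rewrite /pin big_ord_recl /= conj0 mulr0 add0r.
Qed.

Lemma inner_Mz f g : H2 f -> H2 g -> inner (Mz f) (Mz g) = inner f g.
Proof. by move=> hf hg; rewrite inner_Mz_adj //; apply: H2_Mz. Qed.

Lemma H2_shift k f : H2 f -> H2 (shift k f).
Proof. by move=> hf; elim: k => //= k; apply: H2_Mz. Qed.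

Arguments H2_shift k {f}.

Lemma nsq_shift k f : H2 f -> nsq (shift k f) = nsq f.
Proof. by move=> hf; elim: k => //= k IH; rewrite nsq_Mz // ; apply: H2_shift. Qed.

Lemma inner_shift k l f g : H2 f -> H2 g ->
  inner (shift (k + l) f) (shift l g) = inner (shift k f) g.
Proof.
move=> hf hg; elim: l => [|l IH]; first by rewrite addn0.
by rewrite addnS /= inner_Mz //; apply: H2_shift.
Qed.

Lemma shiftE k f n : shift k f n = if (k <= n)%N then f (n - k)%N else 0.
Proof.
elim: k n => [|k IH] n /=; first by rewrite subn0.
by case: n => //= n; rewrite IH ltnS subSS.
Qed.

(** The shift is isometric, so convergence of images gives convergence of preimages; the limit
    vanishes at 0 because every term does. *)
Lemma closed_Mz N : closed_subspace N -> closed_subspace (@Mz R @` N).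
Proof.
move=> cN; apply: closed_subspaceI.
- by move=> _ [f /(subH2 cN) hf <-]; apply: H2_Mz.
- exists (fun=> 0); first exact: sub0.
  by apply/funext => -[].
- by move=> _ _ [f Nf <-] [g Ng <-]; exists (caddf f g); [apply: subD|rewrite MzD].
- by move=> c _ [f Nf <-]; exists (cscalef c f); [apply: subZ|rewrite MzZ].
- move=> u f hu hf h.
  have /choice [v hv] : forall k, exists g, N g /\ Mz g = u k.
    by move=> k; have [g Ng <-] := hu k; exists g.
  have vN k : N (v k) by case: (hv k).
  have vE k : u k = Mz (v k) by case: (hv k).
  have uH k : H2 (u k) by rewrite vE; apply/H2_Mz/(subH2 cN).
  have f0 : f 0%N = 0.
    apply: cmod_eq0; apply/eqP; rewrite -sqrf_eq0 eq_le sqr_ge0 andbT.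
    rewrite -(cvg_lim _ h) //; apply: limr_ge; first by apply/cvg_ex; eexists; exact: h.
    apply: nearW => k; rewrite -cmodN.
    have -> : - f 0%N = csubf (u k) f 0%N by rewrite vE /csubf /= sub0r.
    by apply: coef_le_nsq; apply: H2B.
  have fE : f = Mz (fun n => f n.+1) by apply/funext => -[|n].
  have gH : H2 (fun n => f n.+1) by apply: H2_unMz; rewrite -fE.
  exists (fun n => f n.+1); last by rewrite -fE.
  apply: (closed_nsq cN vN gH).
  rewrite (_ : (fun k => _) = (fun k => nsq (csubf (u k) f))) //.
  apply/funext => k; rewrite vE [in RHS]fE -MzB nsq_Mz //.
  by apply: H2B => //; apply: (subH2 cN).
Qed.

(** The product of two power series. It may leave H^2, but not when the shifts of one factor are
    orthogonal. *)
Definition cprod u f : cseq R := fun n => \sum_(k < n.+1) u k * f (n - k)%N.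

Lemma cprodC u v : cprod u v = cprod v u.
Proof.
apply/funext => n; rewrite /cprod (reindex_inj rev_ord_inj) /=.
apply: eq_bigr => i _; rewrite subSS subKn 1?mulrC //.
by rewrite -ltnS.
Qed.

(* comb u f L is the product of f with the L-th Taylor polynomial of u *)
Definition comb u f L : cseq R := fun n => \sum_(k < L) u k * shift k f n.

Lemma combS u f L : comb u f L.+1 = caddf (comb u f L) (cscalef (u L) (shift L f)).
Proof. by apply/funext => n; rewrite /comb big_ord_recr. Qed.

Lemma comb0 u f : comb u f 0 = (fun=> 0).
Proof. by apply/funext => n; rewrite /comb big_ord0. Qed.

Lemma comb_cprod u f L n : (n < L)%N -> comb u f L n = cprod u f n.
Proof.
move=> nL; rewrite /comb /cprod.
rewrite -(big_mkord xpredT (fun k => u k * shift k f n)).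
rewrite (big_cat_nat _ nL) //= big_mkord [X in _ + X]big_nat_cond [X in _ + X]big1 ?addr0.
  by apply: eq_bigr => i _; rewrite shiftE -ltnS ltn_ord.
by move=> i /andP[/andP[ni _] _]; rewrite shiftE leqNgt ni /= mulr0.
Qed.

Lemma H2_comb u f L : H2 f -> H2 (comb u f L).
Proof.
move=> hf; elim: L => [|L IH]; first by rewrite comb0; apply: H2_0.
by rewrite combS; apply: H2D => //; apply/H2Z/H2_shift.
Qed.

Arguments H2_comb u {f} L.

Lemma inner_comb_eq0 u f L g : H2 f -> H2 g ->
  (forall k, (k < L)%N -> inner (shift k f) g = 0) -> inner (comb u f L) g = 0.
Proof.
move=> hf hg; elim: L => [|L IH] h.
  by rewrite comb0 inner_conj ?inner0r ?conj0 //; apply: H2_0.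
rewrite combS innerDl ?innerZl ?IH ?h ?mulr0 ?addr0 //.
- by move=> k kL; apply: h; apply: ltnW.
- exact: H2_shift.
- exact: H2_comb.
- by apply/H2Z/H2_shift.
Qed.

(** * Multiplication by a vector whose shifts are orthogonal *)

Section Isometric.
Variable (f : cseq R) (hf : H2 f).
Hypothesis orth : forall k, inner (shift k.+1 f) f = 0.

Lemma shift_orth k l : (k < l)%N -> inner (shift k f) (shift l f) = 0.
Proof.
move=> kl; rewrite inner_conj; [|exact: H2_shift..].
by rewrite -(subnK kl) addnS -addSn inner_shift // orth conj0.
Qed.

(** Pythagoras: the shifts of [f] are orthogonal and have equal norms. *)
Lemma nsq_comb u L : nsq (comb u f L) = nsq f * psq u L.
Proof.
elim: L => [|L IH]; first by rewrite comb0 nsq0 /psq big_ord0 mulr0.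
have hs := H2_shift L hf; have hc := H2_comb u L hf.
rewrite combS nsqD //; last exact: H2Z.
rewrite innerZr // inner_comb_eq0 //; last by move=> k; apply: shift_orth.
rewrite IH nsqZ // nsq_shift // mulr0 /= mulr0 addr0.
by rewrite /psq big_ord_recr /=; ring.
Qed.

(** The first L coefficients of the product are those of [comb u f L], whose norm is known. *)
Lemma psq_cprod u L : psq (cprod u f) L <= nsq f * psq u L.
Proof.
rewrite -nsq_comb (_ : psq _ _ = psq (comb u f L) L).
  exact/psq_le_nsq/H2_comb.
by apply: eq_bigr => i _; rewrite comb_cprod.
Qed.

Lemma H2_cprod u : H2 u -> H2 (cprod u f).
Proof.
move=> hu; apply: (@H2_bounded _ _ (nsq f * nsq u)) => L.
apply: (le_trans (psq_cprod u L)).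
by rewrite ler_wpM2l ?nsq_ge0 // psq_le_nsq.
Qed.

Lemma nsq_cprod u : H2 u -> nsq (cprod u f) <= nsq f * nsq u.
Proof.
move=> hu; apply: nsq_le => L; apply: (le_trans (psq_cprod u L)).
by rewrite ler_wpM2l ?nsq_ge0 // psq_le_nsq.
Qed.

Lemma cvg_comb u : H2 u ->
  (fun L => nsq (csubf (comb u f L) (cprod u f))) @ \oo --> (0 : R).
Proof.
move=> hu.
(* t L is minus the tail of u from index L on, so the error is a product of f with a tail. *)
pose t L : cseq R := fun n => if (n < L)%N then 0 else - u n.
have tE L : csubf (comb u f L) (cprod u f) = cprod (t L) f.
  apply/funext => n; rewrite /csubf /comb /cprod.
  have -> : \sum_(k < L) u k * shift k f n =
      \sum_(k < n.+1) (if (k < L)%N then u k else 0) * f (n - k)%N.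
    (* Padding to length L + n + 1: beyond L the coefficient is replaced by 0, and beyond n the
       shift vanishes at n. *)
    have -> : \sum_(k < L) u k * shift k f n =
        \sum_(k < L + n.+1) (if (k < L)%N then u k else 0) * shift k f n.
      rewrite big_split_ord /= [X in _ + X]big1 ?addr0; first last.
        by move=> i _; rewrite ltnNge leq_addr /= mul0r.
      by apply: eq_bigr => i _; rewrite ltn_ord.
    under eq_bigr do rewrite shiftE.
    rewrite addnC big_split_ord /= [X in _ + X]big1 ?addr0.
      by apply: eq_bigr => i _; rewrite leq_ord.
    by move=> i _; rewrite [(_ <= n)%N]leqNgt addSn ltnS leq_addr /= mulr0.
  rewrite -sumrB; apply: eq_bigr => i _; rewrite /t.
  by case: ifP => _; ring.
have tb L (N : nat) : psq (t L) N <= nsq u - psq u L.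
  apply: (le_trans (psq_nd _ (leq_addl L N))).
  rewrite lerBrDr; apply: le_trans (psq_le_nsq (L + N) hu).
  rewrite /psq !big_split_ord /= [X in X + _ + _]big1 ?add0r.
    rewrite [leRHS]addrC lerD2r; apply: ler_sum => i _.
    by rewrite /t ltnNge leq_addr /= cmodN.
  by move=> i _; rewrite /t ltn_ord cmod0 expr0n.
have tH L : H2 (t L) := H2_bounded (tb L).
apply: (@squeeze_cvgr _ _ _ _ (fun=> 0) (fun L => nsq f * (nsq u - psq u L))).
- apply: nearW => L; rewrite tE nsq_ge0 /=; last exact: H2_cprod.
  apply: (le_trans (nsq_cprod (tH L))).
  by rewrite ler_wpM2l ?nsq_ge0 //; apply: nsq_le.
- exact: cvg_cst.
- rewrite -[X in _ --> X](mulr0 (nsq f)); apply: cvgMr.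
  by rewrite -(subrr (nsq u)); apply: cvgB; [apply: cvg_cst|apply: cvg_psq].
Qed.

End Isometric.

(** Power series have no zero divisors: with b the order of vanishing of [v], the coefficient of
    index a + b is u_a v_b as soon as u_i = 0 for all i < a. *)
Lemma cprod_eq0 u v : cprod u v = (fun=> 0) -> v <> (fun=> 0) -> u = (fun=> 0).
Proof.
move=> h v0; apply/funext.
have /ex_minnP [b vb bmin] : exists b, v b != 0.
  apply: contra_notP v0 => /forallNP nv; apply/funext => n.
  by have /negP := nv n; rewrite negbK => /eqP.
elim/ltn_ind => a IH.
have := congr1 (fun w => w (a + b)%N) h; rewrite /cprod.
have ab : (a < (a + b).+1)%N by rewrite ltnS leq_addr.
rewrite (bigD1 (Ordinal ab)) //= addKn big1 ?addr0.
  by move/eqP; rewrite mulf_eq0 (negbTE vb) orbF => /eqP.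
move=> i; rewrite -val_eqE /= => ia.
have [lt|ge] := ltnP i a; first by rewrite IH // mul0r.
have : (a + b - i < b)%N.
  have : (a < i)%N by rewrite ltn_neqAle eq_sym ia.
  by move=> ai; rewrite ltn_subLR ?ltn_add2r // -ltnS ltn_ord.
move=> lb; have [->|nz] := eqVneq (v (a + b - i)%N) 0; first by rewrite mulr0.
by have := bmin _ nz; rewrite leqNgt lb.
Qed.

Lemma cvg_unique0 (x : nat -> C) (L : C) : cvgC x L -> (forall n, x n = 0) -> L = 0.
Proof.
move=> h x0; rewrite -(cvgC_lim h); apply: cvgC_lim.
by rewrite (_ : x = fun=> 0); [apply: cvgC_cst|apply/funext].
Qed.

(* The two products u f and f u coincide, so orthogonality of the two ranges
   forces the product to vanish. *)
Lemma orth_ranges_eq0 f g : H2 f -> H2 g ->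
  (forall k, inner (shift k.+1 f) f = 0) ->
  (forall k, inner (shift k.+1 g) g = 0) ->
  (forall k l, inner (shift k f) (shift l g) = 0) ->
  f <> (fun=> 0) -> g = (fun=> 0).
Proof.
move=> hf hg of_ og ofg f0.
have gf := H2_cprod hf of_ hg; have fg := H2_cprod hg og hf.
have z L L' : inner (comb g f L) (comb f g L') = 0.
  apply: inner_comb_eq0 => //; first exact: H2_comb.
  move=> k _; rewrite inner_conj; [|exact: H2_comb|exact: H2_shift].
  rewrite inner_comb_eq0 ?conj0 //; first exact: H2_shift.
  by move=> l _; rewrite inner_conj ?ofg ?conj0 //; apply: H2_shift.
(* The limit is taken in one factor at a time, since [inner_cvg] moves the left argument. *)
have z1 L : inner (comb g f L) (cprod f g) = 0.
  rewrite inner_conj //; last exact: H2_comb.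
  rewrite (_ : inner (cprod f g) (comb g f L) = 0) ?conj0 //.
  apply: (cvg_unique0 (inner_cvg (fun L' => H2_comb f L' hg) fg (H2_comb g L hf)
    (cvg_comb hg og hf))) => L'.
  by rewrite inner_conj ?z ?conj0 //; apply: H2_comb.
have z2 : inner (cprod g f) (cprod f g) = 0.
  exact: (cvg_unique0 (inner_cvg (fun L' => H2_comb g L' hf) gf fg (cvg_comb hf of_ hg)) z1).
apply: (@cprod_eq0 g f) => //.
apply: nsq_eq0 => //; move: z2; rewrite [cprod f g]cprodC inner_nsq //.
by move=> /(congr1 (@complex.Re R)) /= ->.
Qed.

Lemma shift_in N k f : T_invariant (@Mz R) N -> N f -> N (shift k f).
Proof. by move=> iN Nf; elim: k => //= k; apply: iN. Qed.

(** [theta] spans the orthogonal complement of zN in N: a vector w of this complement orthogonal to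
    [theta] has all its shifts orthogonal to those of [theta], and [orth_ranges_eq0] gives w = 0.
    The conclusion stops at N = C theta + zN, which [shift_span] iterates. *)
Theorem Beurling N : closed_subspace N -> T_invariant (@Mz R) N ->
  (exists f, N f /\ f <> (fun=> 0)) ->
  exists theta, [/\ N theta, nsq theta = 1,
    (forall g, N g -> inner theta (Mz g) = 0) &
    (forall f, N f -> exists c, exists2 g, N g &
       f = caddf (cscalef c theta) (Mz g))].
Proof.
move=> cN iN [f0 [Nf0 nz]].
have cZ := closed_Mz cN.
have ZN g : (@Mz R @` N) g -> N g by move=> [h Nh <-]; apply: iN.
(* An element of N with the least order of vanishing is not z g with g in N, since g would vanish to
   a lower order. *)
have [f Nf fZ] : exists2 f, N f & ~ (@Mz R @` N) f.
  have ex : exists n, `[< exists2 f, N f & f n != 0 >].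
    apply: contra_notP nz => /forallNP nf; apply/funext => n.
    by apply/eqP/negPn/negP => fn; apply: (nf n); apply/asboolP; exists f0.
  have [m /asboolP [f Nf fm] mmin] := ex_minnP ex.
  exists f => // -[g Ng gf]; move: fm; rewrite -gf.
  case: m mmin => [|m] mmin /=; first by rewrite eqxx.
  move=> gm; have : (m.+1 <= m)%N by apply: mmin; apply/asboolP; exists g.
  by rewrite ltnn.
have [p Zp orth] := projection cZ (subH2 cN Nf).
set e := csubf f p in orth.
have Ne : N e by apply: (subB cN) => //; apply: ZN.
have he := subH2 cN Ne.
have e0 : 0 < nsq e.
  rewrite ltNge; apply/negP => /(nsq_eq0 he) ez; apply: fZ.
  suff -> : f = p by [].
  apply/funext => n; have := congr1 (fun w => w n) ez.
  by rewrite /e /csubf => /eqP; rewrite subr_eq0 => /eqP.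
pose s : C := ((Num.sqrt (nsq e))^-1)%:C.
pose theta := cscalef s e.
have Nt : N theta by apply: (subZ cN).
have ht := subH2 cN Nt.
have nt : nsq theta = 1.
  rewrite nsqZ // cmod_real real_normK ?num_real // exprVn sqr_sqrtr ?mulVf ?ltW //.
  by rewrite gt_eqF.
have ot g : N g -> inner theta (Mz g) = 0.
  move=> Ng; have hg := H2_Mz (subH2 cN Ng).
  by rewrite innerZl // orth ?mulr0 //; exists g.
have wander w : N w -> (forall g, N g -> inner w (Mz g) = 0) ->
    forall h k, N h -> inner (shift k.+1 h) w = 0.
  move=> Nw ow h k Nh.
  have hw := subH2 cN Nw; have hh := H2_shift k.+1 (subH2 cN Nh).
  by rewrite inner_conj // ow ?conj0 //; apply: shift_in.
exists theta; split => // h Nh.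
have hh := subH2 cN Nh.
have [q Zq oq] := projection cZ hh.
have [g Ng gq] := Zq.
pose c := inner (csubf h q) theta.
have Nhq : N (csubf h q) by apply: (subB cN) => //; apply: ZN.
have hhq := subH2 cN Nhq.
(* w is what remains of h once its components in zN and along theta are removed. *)
pose w := csubf (csubf h q) (cscalef c theta).
have Nw : N w by apply: (subB cN) => //; apply: (subZ cN).
have hw := subH2 cN Nw.
have ow k : N k -> inner w (Mz k) = 0.
  move=> Nk; have hk := H2_Mz (subH2 cN Nk).
  have hz := H2Z c ht.
  by rewrite innerBl // innerZl // ot // mulr0 subr0 oq //; exists k.
have wt : inner w theta = 0.
  have hz := H2Z c ht.
  by rewrite innerBl // innerZl // (inner_nsq ht) nt mulr1 subrr.
have w0 : w = (fun=> 0).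
  apply: (@orth_ranges_eq0 theta) => //.
  - by move=> k; apply: wander.
  - by move=> k; apply: wander.
  - move=> k l; have [kl|lk] := ltnP k l.
      rewrite inner_conj; [|exact: H2_shift..].
      by rewrite -(subnK kl) addnS -addSn inner_shift // wander ?conj0.
    rewrite -(subnK lk) inner_shift //.
    case: (k - l)%N => [|m] /=; first by rewrite inner_conj // wt conj0.
    exact: wander.
  - by move=> t0; move: nt; rewrite t0 nsq0 => /eqP; rewrite eq_sym oner_eq0.
exists c, g => //; rewrite gq; apply/funext => n.
have := congr1 (fun v => v n) w0; rewrite /w /csubf /caddf /= => /eqP.
by rewrite subr_eq0 => /eqP <-; ring.
Qed.

(** Wold's argument: a vector of N orthogonal to all z^k theta is z g with g of the same kind, hence
    vanishes to every order. [K] is merely closed, which admits the set of g with z g orthogonal to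
    phi that [phi_orth] needs. *)
Lemma shift_span N theta K : closed_subspace N -> T_invariant (@Mz R) N ->
  N theta -> nsq theta = 1 ->
  (forall g, N g -> inner theta (Mz g) = 0) ->
  (forall f, N f -> exists c, exists2 g, N g &
       f = caddf (cscalef c theta) (Mz g)) ->
  closed_subspace K -> (forall k, K (shift k theta)) -> N `<=` K.
Proof.
move=> cN iN Nt nt ot dec cK Kt f Nf.
have ht := subH2 cN Nt; have hf := subH2 cN Nf.
(* Projecting onto the intersection keeps the remainder in N. *)
have [p [Kp Np] op] := projection (closed_subspace_setI cK cN) hf.
suff e0 n e : N e -> (forall k, inner e (shift k theta) = 0) -> e n = 0.
  suff -> : f = p by [].
  apply/funext => n; apply/eqP; rewrite -subr_eq0; apply/eqP.
  apply: (e0 n (csubf f p)); first exact: (subB cN).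
  by move=> k; apply: op; split => //; apply: shift_in.
have zero w : N w -> (forall k, inner w (shift k theta) = 0) ->
    exists2 g, N g & w = Mz g.
  move=> Nw ow; have [c [g Ng wE]] := dec _ Nw.
  have hg := H2_Mz (subH2 cN Ng); have hc := H2Z c ht.
  have c0 : c = 0.
    have := ow 0%N; rewrite /= wE innerDl // innerZl // inner_nsq // nt.
    by rewrite [inner (Mz g) _]inner_conj // ot // conj0 mulr1 addr0.
  exists g => //; rewrite wE c0; apply/funext => m.
  by rewrite /caddf /cscalef mul0r add0r.
elim: n e => [|n IH] e Ne oe; have [g Ng eE] := zero _ Ne oe; rewrite eE //=.
apply: IH => // k; have hg := subH2 cN Ng.
by have := oe k.+1; rewrite eE /= inner_Mz //; apply: H2_shift.
Qed.

End Shift.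

Arguments H2_shift {R} k {f} _.
Arguments H2_comb {R} u {f} L _.

(** * Polynomial multiples and the outerness of 1 + kappa z *)

Section OuterPolynomial.
Variable R : realType.
Local Notation C := R[i].
Implicit Types (f g h u v : cseq R) (P Q p q : {poly C}).
Local Notation shift k := (iter k (@Mz R)).

Lemma pmulfD P Q f : pmulf (P + Q) f = caddf (pmulf P f) (pmulf Q f).
Proof.
apply/funext => n; rewrite /caddf /pmulf -big_split /=.
by apply: eq_bigr => i _; rewrite coefD mulrDl.
Qed.

Lemma pmulfX P f : pmulf ('X * P) f = Mz (pmulf P f).
Proof.
apply/funext => -[|n]; rewrite /pmulf /= big_ord_recl coefXM /= mul0r add0r.
  by rewrite big_ord0.
by apply: eq_bigr => i _; rewrite coefXM /= subSS.
Qed.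

Lemma pmulfC c P f : pmulf (c%:P * P) f = cscalef c (pmulf P f).
Proof.
apply/funext => n; rewrite /pmulf /cscalef mulr_sumr.
by apply: eq_bigr => i _; rewrite coefCM mulrA.
Qed.

Lemma pmulf1 f : pmulf 1 f = f.
Proof.
apply/funext => n; rewrite /pmulf big_ord_recl coef1 mul1r subn0 big1 ?addr0 //.
by move=> i _; rewrite coef1 mul0r.
Qed.

Lemma pcoefD P Q : pcoef (P + Q) = caddf (pcoef P) (pcoef Q).
Proof. by apply/funext => n; rewrite /pcoef /caddf coefD. Qed.

Lemma pcoefZ c P : pcoef (c%:P * P) = cscalef c (pcoef P).
Proof. by apply/funext => n; rewrite /pcoef /cscalef coefCM. Qed.

Lemma pcoefX P : pcoef ('X * P) = Mz (pcoef P).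
Proof. by apply/funext => -[|n]; rewrite /pcoef coefXM. Qed.

Lemma pcoefXn k P : pcoef ('X^k * P) = shift k (pcoef P).
Proof.
elim: k => [|k IH] /=; first by rewrite expr0 mul1r.
by rewrite exprS -mulrA pcoefX IH.
Qed.

Lemma H2_finite f L : (forall n, (L <= n)%N -> f n = 0) -> H2 f.
Proof.
move=> h; apply: (@H2_bounded _ _ (psq f L)) => N.
apply: (le_trans (psq_nd _ (leq_addl L N))).
rewrite {1}/psq big_split_ord /= [X in _ + X]big1 ?addr0 //.
by move=> i _; rewrite h ?leq_addr // cmod0 expr0n.
Qed.

Lemma H2_pcoef P : H2 (pcoef P).
Proof. by apply: (@H2_finite _ (size P)) => n; apply: nth_default. Qed.

Lemma inner_finite f g L : (forall n, (L <= n)%N -> g n = 0) ->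
  inner f g = pin f g L.
Proof.
move=> h; apply: inner_lim.
have c N : (L <= N)%N -> pin f g N = pin f g L.
  move=> LN; rewrite -(subnKC LN) {1}/pin big_split_ord /= [X in _ + X]big1 ?addr0 //.
  by move=> i _; rewrite h ?leq_addr // conj0 mulr0.
split; apply: cvg_near_cst; exists L => // N /= /c -> //.
Qed.

Lemma inner_shift_adj k f g : H2 f -> H2 g ->
  inner f (shift k g) = inner (fun n => f (n + k)%N) g.
Proof.
move=> hf hg; elim: k f hf => [|k IH] f hf.
  by congr inner; apply/funext => n; rewrite addn0.
have hs : H2 (fun n => f n.+1).
  apply: (@H2_bounded _ _ (nsq f)) => N.
  apply: le_trans (psq_le_nsq N.+1 hf).
  by rewrite /psq big_ord_recl lerDr sqr_ge0.
rewrite [iter _ _ _]/= inner_Mz_adj // ?IH //; last exact: H2_shift.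
by congr inner; apply/funext => n; rewrite addnS.
Qed.

(* If e is orthogonal to every z^k (1 + kappa z), then |e_k| <= |e_{k+1}| for
   all k, which is incompatible with square summability unless e = 0. *)
Lemma outer_linear (kappa : C) : cmod kappa <= 1 ->
  outer_poly (1 + kappa *: 'X).
Proof.
move=> k1; set p := 1 + _.
(* S is the closure of the multiples of p; f lies in it once the remainder of its projection onto S
   vanishes. *)
pose S : set (cseq R) := [set f | H2 f /\
  forall eps : R, 0 < eps -> exists q, nsq (csubf (pcoef (q * p)) f) < eps].
have hS P f : H2 f -> H2 (csubf (pcoef P) f).
  by move=> hf; apply: H2B => //; apply: H2_pcoef.
have cS : closed_subspace S.
  apply: closed_subspaceI.
  - by move=> f [].
  - split; first exact: H2_0.
    move=> e e0; exists 0; rewrite mul0r (_ : csubf _ _ = fun=> 0) ?nsq0 //.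
    by apply/funext => n; rewrite /csubf /pcoef coef0 subr0.
  - move=> f g [hf Sf] [hg Sg]; split; first exact: H2D.
    move=> e e0; have e4 : 0 < e / 4 by rewrite divr_gt0.
    have [q1 h1] := Sf _ e4; have [q2 h2] := Sg _ e4.
    exists (q1 + q2).
    rewrite (_ : csubf _ _ = caddf (csubf (pcoef (q1 * p)) f) (csubf (pcoef (q2 * p)) g)).
      apply: (le_lt_trans (nsqD_le _ _)); [exact: hS|exact: hS|lra].
    by apply/funext => n; rewrite mulrDl pcoefD /csubf /caddf; ring.
  - move=> c f [hf Sf]; split; first exact: H2Z.
    move=> e e0; have d0 : 0 < 1 + cmod c ^+ 2 by rewrite ltr_pwDl // sqr_ge0.
    have [q hq] := Sf (e / (1 + cmod c ^+ 2)) (divr_gt0 e0 d0).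
    exists (c%:P * q).
    rewrite (_ : csubf _ _ = cscalef c (csubf (pcoef (q * p)) f)).
      rewrite nsqZ; last exact: hS.
      move: hq; rewrite ltr_pdivlMr //.
      by have := nsq_ge0 (hS (q * p) _ hf); nra.
    by apply/funext => n; rewrite -mulrA pcoefZ /csubf /cscalef mulrBr.
  - move=> u f hu hf h; split => // e e0.
    have e4 : 0 < e / 4 by rewrite divr_gt0.
    have /cvgrPdist_lt /(_ _ e4) [K _ /(_ K (leqnn K))] := h.
    have [uH Su] := hu K.
    rewrite /= sub0r normrN ger0_norm; last by apply: nsq_ge0; apply: H2B.
    move=> hK; have [q hq] := Su _ e4; exists q.
    rewrite (_ : csubf _ _ = caddf (csubf (pcoef (q * p)) (u K)) (csubf (u K) f)).
      apply: (le_lt_trans (nsqD_le _ _)); [exact: hS|exact: H2B|lra].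
    by apply/funext => n; rewrite /csubf /caddf; ring.
have Sp k : S (pcoef ('X^k * p)).
  split; first exact: H2_pcoef.
  move=> e e0; exists 'X^k; rewrite (_ : csubf _ _ = fun=> 0) ?nsq0 //.
  by apply/funext => n; rewrite /csubf subrr.
move=> f hf eps eps0.
have [s Ss os] := projection cS hf.
have hs := subH2 cS Ss; have he := H2B hf hs.
set e := csubf f s in os he.
have p0 n : (2 <= n)%N -> pcoef p n = 0.
  by case: n => [|[|n]] // _; rewrite /pcoef /p coefD coef1 coefZ coefX /= mulr0 addr0.
have rec k : e k + e k.+1 * Num.conj kappa = 0.
  rewrite -(os _ (Sp k)) pcoefXn inner_shift_adj //; last exact: H2_pcoef.
  rewrite (inner_finite _ p0) /pin !big_ord_recl big_ord0 /pcoef /p /=.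
  rewrite !coefD !coef1 !coefZ !coefX /= mulr0 mulr1 !addr0 !add0r conj1 mulr1.
  by [].
have mono1 k : cmod (e k) <= cmod (e k.+1).
  move/eqP: (rec k); rewrite addr_eq0 => /eqP ->.
  by rewrite cmodN cmodM cmod_conj -[leRHS]mulr1 ler_wpM2l ?cmod_ge0.
have mono2 k l : cmod (e k) <= cmod (e (k + l)%N).
  by elim: l => [|l IH]; rewrite ?addn0 // addnS; apply: le_trans IH (mono1 _).
have e0 : e = fun=> 0.
  apply/funext => k; apply: cmod_eq0; apply/eqP.
  rewrite -sqrf_eq0 eq_le sqr_ge0 andbT.
  have c0 : (fun n => cmod (e n) ^+ 2) @ \oo --> (0 : R).
    exact: cvg_series_cvg_0.
  rewrite -(cvg_lim _ c0) //; apply: limr_ge; first by apply/cvg_ex; eexists; exact: c0.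
  exists k => // n /= kn; rewrite -(subnKC kn).
  by rewrite ler_pXn2r ?nnegrE ?cmod_ge0.
have <- : s = f.
  apply/funext => n; have := congr1 (fun w => w n) e0; rewrite /e /csubf.
  by move/eqP; rewrite subr_eq0 => /eqP.
have [_ /(_ (eps ^+ 2))] := Ss; rewrite exprn_gt0 // => /(_ isT) [q hq].
exists q; rewrite norm2E -[ltRHS]ger0_norm ?ltW // -sqrtr_sqr.
by rewrite ltr_sqrt // exprn_gt0.
Qed.

End OuterPolynomial.

(** * Point evaluation and the bound by one on the disc *)

Section PointEvaluation.
Variable R : realType.
Local Notation C := R[i].
Implicit Types (f g u : cseq R) (z : C).
Local Notation shift k := (iter k (@Mz R)).

(** The Szego kernel 1 / (1 - conj(z) w) as a power series in w: pairing with it evaluates at z. *)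
Definition kernel z : cseq R := fun n => Num.conj (z ^+ n).

Lemma hvalE f z : hval f z = inner f (kernel z).
Proof.
rewrite /hval /inner; congr limC; apply/funext => N.
by rewrite /psum; apply: eq_bigr => i _; rewrite conjK.
Qed.

Lemma H2_kernel z : cmod z < 1 -> H2 (kernel z).
Proof.
move=> z1; have z0 := cmod_ge0 z.
have z21 : cmod z ^+ 2 < 1 by nra.
apply: (@H2_bounded _ _ ((1 - cmod z ^+ 2)^-1)) => N.
have -> : psq (kernel z) N = \sum_(i < N) (cmod z ^+ 2) ^+ i.
  by apply: eq_bigr => i _; rewrite cmod_conj cmodX exprAC.
have p : 0 < 1 - cmod z ^+ 2 by rewrite subr_gt0.
rewrite -[leRHS]mul1r ler_pdivlMr // mulrC -opprB mulNr.
by rewrite -subrX1 opprB lerBlDr lerDl exprn_ge0 // exprn_ge0.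
Qed.

Lemma cvg_psum f z : H2 f -> cmod z < 1 -> cvgC (psum f z) (hval f z).
Proof.
move=> hf z1; rewrite hvalE.
rewrite (_ : psum f z = pin f (kernel z)); first exact: cvg_pin (H2_kernel z1).
by apply/funext => N; apply: eq_bigr => i _; rewrite conjK.
Qed.

Lemma hval_shift k f z : H2 f -> cmod z < 1 ->
  inner (shift k f) (kernel z) = z ^+ k * hval f z.
Proof.
move=> hf z1; have hk := H2_kernel z1.
elim: k => [|k IH]; first by rewrite mul1r hvalE.
have hs := H2_shift k hf; have hs1 := H2_shift k.+1 hf.
rewrite inner_conj // [iter _ _ _]/= inner_Mz_adj //.
rewrite (_ : (fun n => _) = cscalef (Num.conj z) (kernel z)); last first.
  by apply/funext => n; rewrite /kernel /cscalef exprS conjM.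
by rewrite innerZl // conjM conjK -inner_conj // IH exprS mulrA.
Qed.

(** Evaluation at z is multiplicative, and the truncated kernel takes the value [psq (kernel z) L]
    at z. *)
Lemma hval_comb f z L : H2 f -> cmod z < 1 ->
  inner (comb (kernel z) f L) (kernel z) = (psq (kernel z) L)%:C * hval f z.
Proof.
move=> hf z1; have hk := H2_kernel z1.
elim: L => [|L IH].
  rewrite comb0 inner_conj ?inner0r ?conj0 //; last exact: H2_0.
  by rewrite /psq big_ord0 mul0r.
have hs := H2_shift L hf; have hc := H2_comb (kernel z) L hf.
have hz := H2Z (kernel z L) hs.
rewrite combS innerDl // innerZl // hval_shift // IH /psq big_ord_recr /=.
rewrite rmorphD mulrDl; congr (_ + _); rewrite mulrA; congr (_ * _).
by have := mul_conj (kernel z L); rewrite {2}/kernel conjK => ->.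
Qed.

(** With k_L the truncation of the kernel k_z, |f(z)| ||k_L||^2 = |<k_L f, k_z>| <= ||k_L|| ||k_z||,
    since multiplication by [f] is isometric; then L tends to infinity. *)
Lemma hval_le1 f z : H2 f -> nsq f = 1 ->
  (forall k, inner (shift k.+1 f) f = 0) -> cmod z < 1 ->
  cmod (hval f z) <= 1.
Proof.
move=> hf nf orth z1; have hk := H2_kernel z1.
set v := hval f z.
have b L : cmod v ^+ 2 * psq (kernel z) L <= nsq (kernel z).
  have [p0|p0] := leP (psq (kernel z) L) 0.
    apply: (@le_trans _ _ 0); last exact: nsq_ge0.
    by rewrite mulr_ge0_le0 ?sqr_ge0.
  have hc := H2_comb (kernel z) L hf.
  have := CauchySchwarz hc hk.
  rewrite hval_comb // (nsq_comb hf orth) nf mul1r cmodM cmod_real exprMn.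
  rewrite real_normK ?num_real // -/v expr2 -mulrA ler_pM2l //.
  by rewrite mulrC.
have k0 : 0 < nsq (kernel z).
  apply: lt_le_trans (coef_le_nsq 0 hk).
  by rewrite /kernel expr0 conj1 cmod1 expr1n.
have c : (fun L => cmod v ^+ 2 * psq (kernel z) L) @ \oo --> cmod v ^+ 2 * nsq (kernel z).
  by apply: cvgMr; apply: cvg_psq.
have : cmod v ^+ 2 * nsq (kernel z) <= 1 * nsq (kernel z).
  rewrite mul1r -(cvg_lim _ c) //; apply: limr_le; last exact: nearW.
  by apply/cvg_ex; eexists; exact: c.
rewrite ler_pM2r // => h.
by rewrite -(ler_pXn2r (ltn0Sn 1)) ?nnegrE ?cmod_ge0 // expr1n.
Qed.

End PointEvaluation.

(** * Integration through primitives, and elementary trigonometric integrals *)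

Section Primitive.
Variable R : realType.
Implicit Types (f g : R -> R) (a b c v w x y : R).

(* the integral of f over [a, b] is v, expressed through a primitive *)
Definition integ a b f v :=
  exists F : R -> R, (forall x, is_derive x (1 : R) F (f x)) /\ F b - F a = v.

Lemma integ_ext a b f g v : f =1 g -> integ a b f v -> integ a b g v.
Proof. by move=> /funext ->. Qed.

Lemma integD a b f g v w : integ a b f v -> integ a b g w ->
  integ a b (fun x => f x + g x) (v + w).
Proof.
move=> [F [dF <-]] [G [dG <-]]; exists (F + G); split.
  by move=> x; apply: is_deriveD.
by rewrite !fctE; ring.
Qed.

Lemma integZ a b c f v : integ a b f v -> integ a b (fun x => c * f x) (c * v).
Proof.
move=> [F [dF <-]]; exists (c \*: F); split; last by rewrite /= /GRing.scale /=; ring.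
by move=> x; apply: is_deriveZ.
Qed.

Lemma integ_cst a b c : integ a b (fun=> c) (c * (b - a)).
Proof.
rewrite -[X in integ _ _ X]/(fun x : R => c).
apply: (@integ_ext _ _ (fun x => c * 1)); first by move=> x; rewrite mulr1.
apply: integZ; exists id; split => // x; exact: is_derive_id.
Qed.

Lemma integ_sum a b (f : nat -> R -> R) (v : nat -> R) N :
  (forall i, (i < N)%N -> integ a b (f i) (v i)) ->
  integ a b (fun x => \sum_(i < N) f i x) (\sum_(i < N) v i).
Proof.
elim: N => [|N IH] h.
  rewrite big_ord0; apply: (@integ_ext _ _ (fun=> 0)).
    by move=> x; rewrite big_ord0.
  by have := @integ_cst a b 0; rewrite mul0r.
rewrite big_ord_recr /=; apply: (@integ_ext _ _ (fun x => \sum_(i < N) f i x + f N x)).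
  by move=> x; rewrite big_ord_recr.
apply: integD; last exact: h.
by apply: IH => i iN; apply: h; apply: ltnW.
Qed.

(** By the mean value theorem v = f(c) (b - a) for some c in [a, b]. *)
Lemma integ_ge0 a b f v : a <= b -> (forall x, a <= x <= b -> 0 <= f x) ->
  integ a b f v -> 0 <= v.
Proof.
move=> ab f0 [F [dF <-]].
have cF : {within `[a, b], continuous F}.
  apply: continuous_subspaceT => x; apply: differentiable_continuous.
  by apply/derivable1_diffP; case: (dF x).
have [c] := MVT_segment ab (fun x _ => dF x) cF.
rewrite in_itv /= => cab ->; apply: mulr_ge0; first exact: f0.
by rewrite subr_ge0.
Qed.

Lemma integ_le a b f g v w : a <= b -> (forall x, a <= x <= b -> f x <= g x) ->
  integ a b f v -> integ a b g w -> v <= w.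
Proof.
move=> ab fg hf hg; rewrite -subr_ge0 -mulN1r.
apply: (@integ_ge0 a b (fun x => g x + -1 * f x)) => //.
  by move=> x /fg; lra.
by apply: integD => //; apply: integZ.
Qed.

Lemma is_derive_sinM c x : is_derive x (1 : R) (fun y => sin (c * y)) (c * cos (c * x)).
Proof.
have d : is_derive x (1 : R) (c \*: id) (c *: (1 : R)) by apply: is_deriveZ.
have := is_derive1_comp (is_derive_sin (c * x)) d.
by rewrite /GRing.scale /= mulr1 mulrC.
Qed.

Lemma is_derive_cosM c x : is_derive x (1 : R) (fun y => cos (c * y)) (- c * sin (c * x)).
Proof.
have d : is_derive x (1 : R) (c \*: id) (c *: (1 : R)) by apply: is_deriveZ.
have := is_derive1_comp (is_derive_cos (c * x)) d.
by rewrite /GRing.scale /= mulr1 mulrC mulrN mulNr.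
Qed.

Lemma integ_cosM a b c : c != 0 ->
  integ a b (fun x => cos (c * x)) ((sin (c * b) - sin (c * a)) / c).
Proof.
move=> c0; apply: (@integ_ext _ _ (fun x => c^-1 * (c * cos (c * x)))).
  by move=> x; rewrite mulrA mulVf ?mul1r.
rewrite mulrC; apply: integZ; exists (fun y => sin (c * y)); split => // x.
exact: is_derive_sinM.
Qed.

Lemma integ_sinM a b c : c != 0 ->
  integ a b (fun x => sin (c * x)) ((cos (c * a) - cos (c * b)) / c).
Proof.
move=> c0; apply: (@integ_ext _ _ (fun x => - c^-1 * (- c * sin (c * x)))).
  by move=> x; rewrite mulrA mulrNN mulVf ?mul1r.
rewrite [_ / c]mulrC -opprB mulrN -mulNr; apply: integZ.
by exists (fun y => cos (c * y)); split => // x; apply: is_derive_cosM.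
Qed.

Lemma sin_natpi n : sin (n%:R * pi : R) = 0.
Proof.
by rewrite mulr_natl -[X in sin X]add0r (alternatingn (@sinDpi R)) sin0 mulr0.
Qed.

Lemma integ_cosn n : integ 0 pi (fun x => cos (n%:R * x)) (if n == 0%N then pi else 0).
Proof.
case: n => [|n] /=.
  apply: (@integ_ext _ _ (fun=> 1)); first by move=> x; rewrite mul0r cos0.
  by have := @integ_cst 0 pi 1; rewrite mul1r subr0.
have := @integ_cosM 0 pi n.+1%:R; rewrite sin_natpi mulr0 sin0 subrr mul0r.
by apply; rewrite pnatr_eq0.
Qed.

(** By the product-to-sum formula; as k > 0, the frequency k + n is nonzero and contributes
    nothing. *)
Lemma integ_sinsin k n : (0 < k)%N ->
  integ 0 pi (fun x => sin (k%:R * x) * sin (n%:R * x)) (if k == n then pi / 2 else 0).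
Proof.
wlog nk : k n / (n <= k)%N => [hw k0|k0].
  have [|kn] := leqP n k; first by move=> nk; apply: hw.
  apply: (@integ_ext _ _ (fun x => sin (n%:R * x) * sin (k%:R * x))).
    by move=> x; rewrite mulrC.
  by rewrite eq_sym; apply: hw; [apply: ltnW|apply: leq_ltn_trans kn].
apply: (@integ_ext _ _ (fun x => 2^-1 * cos ((k - n)%:R * x) + - 2^-1 * cos ((k + n)%:R * x))).
  move=> x; rewrite natrB // natrD mulrBl mulrDl cosB cosD; lra.
rewrite (_ : (if k == n then _ else _) =
  2^-1 * (if (k - n == 0)%N then pi else 0) + - 2^-1 * (if (k + n == 0)%N then pi else 0)).
  by apply: integD; apply: integZ; apply: integ_cosn.
rewrite subn_eq0 addn_eq0 (gtn_eqF k0) /= mulr0 addr0 eqn_leq nk andbT.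
by case: ifP => _; [rewrite mulrC|rewrite mulr0].
Qed.

(** Integration of cos <= 1; integrating again gives [cos_ge], and once more [sin_ge]. *)
Lemma sin_le x : 0 <= x -> sin x <= x.
Proof.
move=> x0; have := @integ_le 0 x cos (fun=> 1) (sin x - sin 0) (1 * (x - 0)) x0.
rewrite sin0 !subr0 mul1r; apply; last 2 first.
- by exists sin; split; [apply: is_derive_sin|rewrite sin0 subr0].
- by have := @integ_cst 0 x 1; rewrite subr0 mul1r.
by move=> y _; apply: cos_le1.
Qed.

Lemma integ_id x : integ 0 x id (x ^+ 2 / 2).
Proof.
exists (2^-1 \*: (id ^+ 2 : R -> R)); split.
  move=> y; have := is_deriveZ 2^-1 (is_deriveX 2 (is_derive_id y (1 : R))).
  rewrite /GRing.scale /= expr1 mulr1 mulrA mulVf ?mul1r //.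
by rewrite !fctE /= /GRing.scale /=; lra.
Qed.

Lemma integ_sqr x : integ 0 x (fun y => y ^+ 2) (x ^+ 3 / 3).
Proof.
exists (3^-1 \*: (id ^+ 3 : R -> R)); split.
  move=> y; have := is_deriveZ 3^-1 (is_deriveX 3 (is_derive_id y (1 : R))).
  by rewrite /GRing.scale /= mulr1 mulrA mulVf ?mul1r.
by rewrite !fctE /= /GRing.scale /=; lra.
Qed.

Lemma cos_ge x : 0 <= x -> 1 - x ^+ 2 / 2 <= cos x.
Proof.
move=> x0; have := @integ_le 0 x sin id (cos 0 - cos x) (x ^+ 2 / 2) x0.
rewrite cos0 => h; suff : 1 - cos x <= x ^+ 2 / 2 by lra.
apply: h; last exact: integ_id.
  by move=> y /andP[y0 _]; apply: sin_le.
have := @integ_sinM 0 x 1 (oner_neq0 R); rewrite !mul1r cos0 divr1.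
by apply: integ_ext => y; rewrite mul1r.
Qed.

Lemma sin_ge x : 0 <= x -> x - x ^+ 3 / 6 <= sin x.
Proof.
move=> x0; apply: (@integ_le 0 x (fun y => 1 + - 2^-1 * y ^+ 2) cos _ _ x0).
- by move=> y /andP[/cos_ge h _]; lra.
- rewrite (_ : x - _ = 1 * (x - 0) + - 2^-1 * (x ^+ 3 / 3)); last by field.
  by apply: integD; [apply: integ_cst|apply: integZ; apply: integ_sqr].
- by exists sin; split; [apply: is_derive_sin|rewrite sin0 subr0].
Qed.

Lemma sin_ge_half x : 0 <= x <= 1 -> x / 2 <= sin x.
Proof. by move=> /andP[x0 x1]; have := sin_ge x0; nra. Qed.

End Primitive.

(** * The kernel with coefficients k r^k and its truncations *)

Section AbelKernel.
Variable R : realType.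
Local Notation C := R[i].
Local Notation Re := complex.Re.
Local Notation Im := complex.Im.
Implicit Types (r h : R) (z : C) (M N n : nat).

Lemma expiX (t : R) n : expi t ^+ n = expi (n%:R * t).
Proof.
elim: n => [|n IH]; first by rewrite mul0r /expi cos0 sin0.
rewrite exprS IH -natr1 mulrDl mul1r addrC; apply: complexP;
  rewrite ?ReM ?ImM /= ?cosD ?sinD; ring.
Qed.

Lemma cmod_expi (t : R) : cmod (expi t) = 1.
Proof. by rewrite /cmod /= cos2Dsin2 sqrtr1. Qed.

Lemma sum_natmul_geometric z M : z != 1 ->
  \sum_(k < M) k%:R * z ^+ k =
  z / (1 - z) ^+ 2 - (M%:R * z ^+ M * (1 - z) + z ^+ M.+1) / (1 - z) ^+ 2.
Proof.
move=> z1; have d : 1 - z != 0 by rewrite subr_eq0 eq_sym.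
elim: M => [|M IH].
  by rewrite big_ord0 expr0 expr1; field.
by rewrite big_ord_recr /= IH -natr1 !exprS; field.
Qed.

Lemma cmod_nat n : cmod (n%:R : C) = n%:R.
Proof. by rewrite -(rmorph_nat (real_complex R)) cmod_real ger0_norm. Qed.

(** With r = s^2, M s^M is at most the sum of s^i over i < M, hence at most 1 / (1 - s), and a
    factor s^M is left over. *)
Lemma natmul_expn_cvg0 r : 0 <= r < 1 -> (fun M => M%:R * r ^+ M) @ \oo --> (0 : R).
Proof.
move=> /andP[r0 r1]; pose s := Num.sqrt r.
have s0 : 0 <= s := sqrtr_ge0 r.
have s1 : s < 1 by rewrite -(sqrtr1 R) ltr_sqrt.
have rs : r = s * s by rewrite -expr2 sqr_sqrtr.
have b M : M%:R * s ^+ M <= (1 - s)^-1.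
  have p : 0 < 1 - s by rewrite subr_gt0.
  rewrite -[leRHS]mul1r ler_pdivlMr //.
  have : M%:R * s ^+ M <= \sum_(i < M) s ^+ i.
    rewrite mulr_natl -[X in _ *+ X]card_ord -sumr_const; apply: ler_sum => i _.
    by apply: ler_wiXn2l; rewrite ?(ltW s1) // ltnW.
  move=> h; apply: (@le_trans _ _ ((\sum_(i < M) s ^+ i) * (1 - s))).
    by rewrite ler_pM2r.
  rewrite mulrC -opprB mulNr -subrX1 opprB lerBlDr lerDl exprn_ge0 //.
apply: (@squeeze_cvgr _ _ _ _ (fun=> 0) (fun M => (1 - s)^-1 * s ^+ M)).
- apply: nearW => M; rewrite mulr_ge0 ?exprn_ge0 //= rs exprMn mulrA.
  by rewrite ler_wpM2r ?exprn_ge0.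
- exact: cvg_cst.
- by apply: cvg_geometric; rewrite ger0_norm.
Qed.

(** The sum of k r^k sin(kh), that is Im(z / (1 - z)^2) for z = r e^{ih}; also minus half the
    derivative in h of the Poisson kernel. *)
Definition abel_kernel r h : R :=
  r * (1 - r ^+ 2) * sin h / (1 - 2 * r * cos h + r ^+ 2) ^+ 2.

Definition abel_psum r M h : R := \sum_(k < M) k%:R * r ^+ k * sin (k%:R * h).

(** Bounds the remainder in [sum_natmul_geometric] uniformly in h: |1 - z| <= 2 in the numerator, |1
    - z| >= 1 - r in the denominator. *)
Definition abel_err r M : R := (2 * (M%:R * r ^+ M) + r ^+ M) / (1 - r) ^+ 2.

Section Fixed.
Variables (r h : R).
Hypothesis r01 : 0 < r < 1.
Let z : C := r%:C * expi h.
Let D : R := 1 - 2 * r * cos h + r ^+ 2.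

Let cz : cmod z = r.
Proof. by case/andP: r01 => r0 _; rewrite cmodM cmod_expi cmod_real mulr1 gtr0_norm. Qed.

Let Rez : Re z = r * cos h. Proof. by rewrite /z Re_realM. Qed.
Let Imz : Im z = r * sin h. Proof. by rewrite /z Im_realM. Qed.

Let D1 : cmod (1 - z) ^+ 2 = D.
Proof.
rewrite cmod_sq ReB ImB Rez Imz /= /D.
have := cos2Dsin2 h; set c := cos h; set s := sin h => e.
have -> : r ^+ 2 = r ^+ 2 * (c ^+ 2 + s ^+ 2) by rewrite e mulr1.
ring.
Qed.

Let D_ge : (1 - r) ^+ 2 <= D.
Proof.
case/andP: r01 => r0 _; rewrite /D; have := cos_le1 h; nra.
Qed.

Let D_gt0 : 0 < D.
Proof.
case/andP: r01 => r0 r1; apply: lt_le_trans D_ge.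
by rewrite exprn_gt0 // subr_gt0.
Qed.

Let z1 : z != 1.
Proof.
apply/eqP => e; move: D_gt0; rewrite -D1 e subrr cmod0 expr0n /=.
by rewrite ltxx.
Qed.

Lemma abel_kernelE : Im (z / (1 - z) ^+ 2) = abel_kernel r h.
Proof.
have d : 1 - z != 0 by rewrite subr_eq0 eq_sym; exact: z1.
have Dc : (D%:C : C) != 0 by apply/eqP => -[] /eqP; rewrite gt_eqF.
have dc : Num.conj (1 - z) != 0.
  by apply/eqP => e; move: d; rewrite -[1 - z]conjK e conj0 eqxx.
have e : z / (1 - z) ^+ 2 = ((D ^+ 2)^-1)%:C * (z * Num.conj (1 - z) ^+ 2).
  have -> : ((D ^+ 2)^-1)%:C = (((1 - z) * Num.conj (1 - z)) ^+ 2)^-1 :> C.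
    by rewrite mul_conj D1 -rmorphXn -fmorphV.
  move: (1 - z) d dc => y y0 w0.
  by field; apply/andP; split; [exact: w0|exact: y0].
rewrite e Im_realM /abel_kernel -/D [RHS]mulrC; congr (_ * _).
rewrite expr2 ImM [Re (_ * _)]ReM [Im (_ * _)]ImM Re_conj Im_conj ReB ImB Rez Imz /=.
have := cos2Dsin2 h; set c := cos h; set s := sin h => e1.
have -> : r * (1 - r ^+ 2) * s = r * (1 - r ^+ 2 * (c ^+ 2 + s ^+ 2)) * s by rewrite e1 mulr1.
ring.
Qed.

Lemma abel_psumE M : abel_psum r M h = Im (\sum_(k < M) k%:R * z ^+ k).
Proof.
rewrite Im_sum; apply: eq_bigr => k _.
rewrite /z exprMn expiX -rmorphXn -(rmorph_nat (real_complex R)) mulrA -rmorphM.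
by rewrite Im_realM.
Qed.

Lemma abel_psum_err M : `|abel_psum r M h - abel_kernel r h| <= abel_err r M.
Proof.
case/andP: r01 => r0 r1.
rewrite abel_psumE sum_natmul_geometric; last exact: z1.
rewrite -abel_kernelE ImB addrAC subrr add0r normrN.
apply: (le_trans (Im_le_cmod _)).
rewrite cmodM cmodV cmodX D1 /abel_err.
apply: ler_pM; rewrite ?cmod_ge0 ?invr_ge0 ?(ltW D_gt0) //; last first.
  by rewrite lef_pV2 ?posrE // exprn_gt0 // subr_gt0.
apply: (le_trans (cmodD _ _)).
rewrite !cmodM !cmodX cz cmod_nat; apply: lerD.
  rewrite [leLHS]mulrC ler_wpM2r ?mulr_ge0 ?exprn_ge0 ?(ltW r0) //.
  by apply: (le_trans (cmodD _ _)); rewrite cmod1 cmodN cz; lra.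
by apply: ler_wiXn2l; rewrite ?ltW.
Qed.

Lemma abel_kernel_ge0 : 0 <= h <= pi -> 0 <= abel_kernel r h.
Proof.
move=> hpi; case/andP: r01 => r0 r1; rewrite /abel_kernel divr_ge0 ?sqr_ge0 //.
by rewrite !mulr_ge0 ?sin_ge0_pi ?(ltW r0) // subr_ge0 expr_le1 // ltW.
Qed.

(** Concentration at 0: for h >= d the denominator is at least (2 r (1 - cos d))^2, and r >= 1/2
    absorbs the remaining factor (1 + r) / (4 r). *)
Lemma abel_kernel_le_away (d : R) : 2^-1 <= r -> 0 < d -> d <= h <= pi ->
  abel_kernel r h <= (1 - r) / (1 - cos d) ^+ 2.
Proof.
move=> r2 d0 /andP[dh hp]; case/andP: r01 => r0 r1.
have dp : d <= pi := le_trans dh hp.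
have c1 : cos d < 1.
  rewrite -(cos0 R) ltr_cos // in_itv /= ?lexx ?pi_ge0 //.
  by rewrite (ltW d0).
have ch : cos h <= cos d.
  by rewrite leNgt ltr_cos ?in_itv /= -?leNgt ?hp ?dp ?(ltW d0) // (le_trans (ltW d0)).
have p : 0 < 1 - cos d by rewrite subr_gt0.
have Dge : 2 * r * (1 - cos d) <= D.
  by rewrite /D; have := sqr_ge0 (1 - r); nra.
have q : 0 < 2 * r * (1 - cos d) by rewrite !mulr_gt0.
rewrite /abel_kernel -/D.
have s1 := sin_le1 h.
have s0 : 0 <= sin h by apply: sin_ge0_pi; rewrite (le_trans (ltW d0) dh).
apply: (@le_trans _ _ (r * (1 - r ^+ 2) / (2 * r * (1 - cos d)) ^+ 2)).
  apply: ler_pM.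
  - by rewrite !mulr_ge0 ?(ltW r0) // subr_ge0 expr_le1 // ltW.
  - by rewrite invr_ge0 sqr_ge0.
  - rewrite ler_piMr // mulr_ge0 ?(ltW r0) // subr_ge0 expr_le1 // ltW //.
  - rewrite lef_pV2 ?posrE ?exprn_gt0 // ler_pXn2r ?nnegrE ?(ltW q) ?(ltW D_gt0) //.
rewrite exprMn invfM mulrA ler_pM2r ?invr_gt0 ?exprn_gt0 //.
rewrite ler_pdivrMr ?exprn_gt0 ?mulr_gt0 //.
have : 0 <= r * (1 - r) by rewrite mulr_ge0 ?subr_ge0 ?(ltW r0) ?(ltW r1).
nra.
Qed.

(** A crude bound, sufficient because it only multiplies truncation errors that tend to 0 while r is
    fixed. *)
Lemma abel_kernel_le : abel_kernel r h <= (1 - r) ^- 2.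
Proof.
case/andP: r01 => r0 r1.
rewrite -abel_kernelE (le_trans (ler_norm _)) // (le_trans (Im_le_cmod _)) //.
rewrite cmodM cmodV cmodX D1 cz -[leRHS]mul1r; apply: ler_pM; rewrite ?(ltW r0) ?(ltW r1) //.
  by rewrite invr_ge0 ltW.
by rewrite lef_pV2 ?posrE // exprn_gt0 // subr_gt0.
Qed.

End Fixed.

Lemma abel_err_cvg0 r : 0 < r < 1 -> abel_err r @ \oo --> (0 : R).
Proof.
move=> /andP[r0 r1].
rewrite -[X in _ --> X](mul0r ((1 - r) ^- 2)); apply: cvgMl.
rewrite -[X in _ --> X](addr0 0); apply: cvgD.
  rewrite -[X in _ --> X](mulr0 2); apply: cvgMr.
  by apply: natmul_expn_cvg0; rewrite (ltW r0).
have := @cvg_geometric R 1 r; rewrite gtr0_norm // => /(_ r1).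
by rewrite /geometric /=; under eq_fun do rewrite mul1r.
Qed.

Lemma abel_err_ge0 r M : 0 < r < 1 -> 0 <= abel_err r M.
Proof.
move=> /andP[r0 r1]; rewrite /abel_err divr_ge0 ?sqr_ge0 // addr_ge0 ?exprn_ge0 ?(ltW r0) //.
by rewrite !mulr_ge0 ?exprn_ge0 ?(ltW r0).
Qed.

End AbelKernel.

(** * Abel sums recovered from an integrated sine series *)

Section AbelSummation.
Variable R : realType.
Implicit Types (r h d e : R) (M N n : nat).

Lemma integ_abel_psum_sin r M n : (n < M)%N ->
  integ 0 pi (fun h => abel_psum r M h * sin (n%:R * h)) (n%:R * r ^+ n * (pi / 2)).
Proof.
move=> nM.
apply: (@integ_ext _ _ _ (fun h => \sum_(k < M) k%:R * r ^+ k * (sin (k%:R * h) * sin (n%:R * h)))).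
  by move=> h; rewrite /abel_psum mulr_suml; apply: eq_bigr => k _; rewrite mulrA.
rewrite (_ : n%:R * r ^+ n * (pi / 2) =
  \sum_(k < M) k%:R * r ^+ k * (if k == n :> nat then pi / 2 else 0)).
  apply: (@integ_sum _ _ _ (fun k h => k%:R * r ^+ k * (sin (k%:R * h) * sin (n%:R * h)))
    (fun k => k%:R * r ^+ k * (if k == n :> nat then pi / 2 else 0))) => -[|k] _.
    rewrite !mul0r; apply: (@integ_ext _ _ _ (fun=> 0)); first by move=> h; rewrite !mul0r.
    by have := @integ_cst R 0 pi 0; rewrite mul0r.
  by apply: integZ; apply: integ_sinsin.
rewrite (bigD1 (Ordinal nM)) //= eqxx big1 ?addr0 //.
by move=> i; rewrite -val_eqE /= => /negbTE ->; rewrite mulr0.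
Qed.

(** For n >= 1, sin(nh) / n is half the integral of cos(nx) over [-h, h]; the term n = 0
    vanishes. *)
Definition sine_psum (a : nat -> R) N h : R :=
  \sum_(n < N) a n / n%:R * sin (n%:R * h).

(** The weight n of the kernel cancels the division by n. The integrand does not see the coefficient
    of index 0, whence a 0 = 0. *)
Lemma integ_abel_psum_sine_psum (a : nat -> R) r M N : a 0%N = 0 -> (N <= M)%N ->
  integ 0 pi (fun h => abel_psum r M h * sine_psum a N h)
    ((\sum_(n < N) a n * r ^+ n) * (pi / 2)).
Proof.
move=> a0 NM.
apply: (@integ_ext _ _ _ (fun h => \sum_(n < N) a n / n%:R * (abel_psum r M h * sin (n%:R * h)))).
  by move=> h; rewrite /sine_psum mulr_sumr; apply: eq_bigr => n _; ring.
rewrite mulr_suml (eq_bigr (fun n : 'I_N => a n / n%:R * (n%:R * r ^+ n * (pi / 2)))).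
  apply: (@integ_sum _ _ _ (fun n h => a n / n%:R * (abel_psum r M h * sin (n%:R * h)))
    (fun n => a n / n%:R * (n%:R * r ^+ n * (pi / 2)))) => n nN.
  by apply: integZ; apply: integ_abel_psum_sin; apply: leq_trans NM.
move=> [[|n] hn] _ /=; first by rewrite a0 !mul0r.
by rewrite !mulrA divfK // pnatr_eq0.
Qed.

(** [sine_psum a N] stands for a function B up to an error [tN], with |B| <= t0 everywhere and
    |B(h)| <= e h near 0. On [0, d] the bound e h is replaced by 2 e sin h, whose integral against
    the kernel is the coefficient n = 1: hence the main term 2 e. The other terms become small as M
    and N tend to infinity, or as r tends to 1. *)
Lemma abel_finite_bound (a : nat -> R) r d e t0 tN M N :
  a 0%N = 0 -> (N <= M)%N -> (1 < M)%N -> 0 < r < 1 -> 2^-1 <= r ->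
  0 < d <= 1 -> 0 <= e -> 0 <= t0 -> 0 <= tN ->
  (forall h, `|sine_psum a N h| <= t0 + tN) ->
  (forall h, 0 <= h <= d -> `|sine_psum a N h| <= e * h + tN) ->
  `|\sum_(n < N) a n * r ^+ n| <=
    2 * e + 2 * (tN * ((1 - r) ^- 2 + abel_err r M) + 4 * abel_err r M * e +
      2 * abel_err r M * tN +
      ((1 - r) / (1 - cos d) ^+ 2 + abel_err r M) * (t0 + tN)).
Proof.
move=> a0 NM M1 r01 r2 /andP[d0 d1] e0 t00 tN0 hB hBd.
have s0 := abel_err_ge0 M r01.
set s := abel_err r M in s0 *.
set A := (1 - r) ^- 2; set K := (1 - r) / (1 - cos d) ^+ 2.
set c := _ + _ * (t0 + tN).
have K0 : 0 <= K.
  by case/andP: r01 => _ r1; rewrite divr_ge0 ?sqr_ge0 // subr_ge0 ltW.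
have pt h : 0 <= h <= pi ->
    `|abel_psum r M h * sine_psum a N h| <= 2 * e * (abel_psum r M h * sin (1%:R * h)) + c.
  move=> hpi; have k0 := abel_kernel_ge0 r01 hpi.
  have := abel_psum_err h r01 M; rewrite -/s.
  have := abel_kernel_le h r01; rewrite -/A.
  set k := abel_kernel r h in k0 *; set T := abel_psum r M h; set B := sine_psum a N h.
  move=> kA; rewrite ler_norml => /andP[Tk1 Tk2].
  have sh0 := sin_ge0_pi hpi; have sh1 := sin_le1 h; rewrite mul1r.
  have aT : `|T| <= k + s by rewrite ler_norml; apply/andP; split; lra.
  rewrite normrM.
  have y0 : 0 <= 2 * e * sin h + tN by rewrite addr_ge0 // !mulr_ge0.
  have st : 0 <= s * tN by rewrite mulr_ge0.
  have ks : 0 <= (K + s) * (t0 + tN) by rewrite mulr_ge0 ?addr_ge0.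
  have se : 0 <= s * e by rewrite mulr_ge0.
  have fin : (k + s) * (2 * e * sin h + tN) <= 2 * e * (T * sin h) + (tN * (A + s) + 4 * s * e + 2 * s * tN).
    (* At the cost of 2 s the polynomial T replaces the kernel k, because the integral of T sin is
       known exactly. *)
    have h1 : (k + s) * (2 * e * sin h + tN) <= (T + 2 * s) * (2 * e * sin h + tN).
      by rewrite ler_wpM2r //; lra.
    have h2 : T * tN <= (A + s) * tN by rewrite ler_wpM2r //; lra.
    have h3 : (s * e) * sin h <= s * e by rewrite ler_piMr.
    by apply: (le_trans h1); lra.
  have [hd|hd] := leP h d.
    apply: (@le_trans _ _ ((k + s) * (2 * e * sin h + tN))).
      apply: ler_pM => //.
      have h01 : 0 <= h <= d by case/andP: hpi => -> _.
      apply: (le_trans (hBd _ h01)); rewrite lerD2r -mulrA [2 * _]mulrC -mulrA ler_wpM2l //.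
      have : 0 <= h <= 1 by case/andP: hpi => -> _; rewrite (le_trans hd).
      by move/sin_ge_half; lra.
    by apply: (le_trans fin); rewrite /c; lra.
  have kK : k <= K.
    by apply: abel_kernel_le_away => //; case/andP: hpi => _ ->; rewrite ltW.
  apply: (@le_trans _ _ ((K + s) * (t0 + tN))).
    apply: ler_pM => //; last exact: hB.
    by apply: (le_trans aT); rewrite lerD2r.
  have : 0 <= (k + s) * (2 * e * sin h + tN) by rewrite mulr_ge0 // addr_ge0.
  by rewrite /c; move: fin; lra.
have pi0 := pi_gt0 R.
have iU : integ 0 pi (fun h => 2 * e * (abel_psum r M h * sin (1%:R * h)) + c)
    (2 * e * (1%:R * r ^+ 1 * (pi / 2)) + c * (pi - 0)).
  apply: integD; last exact: integ_cst.
  by apply: integZ; apply: integ_abel_psum_sin.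
have iF := integ_abel_psum_sine_psum r a0 NM.
set S := \sum_(n < N) a n * r ^+ n in iF *.
have up : S * (pi / 2) <= 2 * e * (1%:R * r ^+ 1 * (pi / 2)) + c * (pi - 0).
  apply: (integ_le (ltW pi0) _ iF iU) => h /pt; exact: le_trans (ler_norm _).
have dn : -1 * (S * (pi / 2)) <= 2 * e * (1%:R * r ^+ 1 * (pi / 2)) + c * (pi - 0).
  apply: (integ_le (ltW pi0) _ (integZ (-1) iF) iU) => h /pt.
  by apply: le_trans; rewrite mulN1r -normrN ler_norm.
have er : e * r <= e by rewrite ler_piMr //; case/andP: r01 => _ /ltW.
have bnd : 2 * e * (1%:R * r ^+ 1 * (pi / 2)) + c * (pi - 0) <= (2 * e + 2 * c) * (pi / 2).
  have : e * r * pi <= e * pi by rewrite ler_pM2r.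
  by rewrite expr1 mul1r subr0; nra.
have p2 : 0 < pi / 2 :> R by rewrite divr_gt0.
rewrite ler_norml; apply/andP; split; rewrite -(ler_pM2r p2); move: up dn bnd; lra.
Qed.

(** If B(h) = o(h) at 0+, the Abel sums tend to 0. The limits are taken in the order M, N, r, so
    that the factor (1 - r)^-2 stays fixed while tau N tends to 0. *)
Lemma abel_of_sine_series (a tau : nat -> R) (B : R -> R) :
  a 0%N = 0 ->
  (forall N h, `|B h - sine_psum a N h| <= tau N) ->
  tau @ \oo --> (0 : R) ->
  (forall e, 0 < e -> exists2 d, 0 < d & forall h, 0 <= h <= d -> `|B h| <= e * h) ->
  forall e, 0 < e -> exists2 rho, rho < 1 & forall r, rho < r < 1 ->
    forall S, (fun N => \sum_(n < N) a n * r ^+ n) @ \oo --> S -> `|S| <= e.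
Proof.
move=> a0 hB tau0 hBd e e0.
have e8 : 0 < e / 8 by rewrite divr_gt0.
have [d1 d10 hd1] := hBd _ e8.
pose d := Num.min d1 1.
have d0 : 0 < d by rewrite lt_min d10 ltr01.
have dle1 : d <= 1 by rewrite ge_min lexx orbT.
have dd1 : d <= d1 by rewrite ge_min lexx.
have taug N : 0 <= tau N := le_trans (normr_ge0 _) (hB N 0).
(* The empty sum, N = 0, shows that tau 0 bounds B everywhere. *)
have B0 h : `|B h| <= tau 0%N.
  by have := hB 0%N h; rewrite /sine_psum big_ord0 subr0.
have BN N h : `|sine_psum a N h| <= `|B h| + tau N.
  rewrite -[sine_psum a N h](subKr (B h)) (le_trans (ler_normB _ _)) //.
  by rewrite lerD2l.
have c1 : 0 < 1 - cos d.
  rewrite subr_gt0 -(cos0 R) ltr_cos // in_itv /= ?lexx ?pi_ge0 // (ltW d0) /=.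
  by apply: (le_trans dle1); apply: le_trans (pi_ge2 R); lra.
(* 1 - r < q keeps the contribution K tau 0 of the kernel away from 0 below e / 8; the summand 1
   avoids a division by 0. *)
pose q := e / (8 * (1 + tau 0%N)) * (1 - cos d) ^+ 2.
have q0 : 0 < q.
  rewrite mulr_gt0 ?exprn_gt0 // divr_gt0 // mulr_gt0 // ltr_pwDl //.
exists (Num.max 2^-1 (1 - q)); first by rewrite gt_max; apply/andP; split; lra.
move=> r /andP[]; rewrite gt_max => /andP[r2 rq] r1 S hS.
have r0 : 0 < r by lra.
have r01 : 0 < r < 1 by rewrite r0.
have K8 : (1 - r) / (1 - cos d) ^+ 2 * tau 0%N <= e / 8.
  have h1 : (1 - r) / (1 - cos d) ^+ 2 <= e / (8 * (1 + tau 0%N)).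
    by rewrite ler_pdivrMr ?exprn_gt0 //; move: rq; rewrite /q; lra.
  have t1 : 0 < 1 + tau 0%N by rewrite ltr_pwDl.
  apply: (@le_trans _ _ (e / (8 * (1 + tau 0%N)) * (1 + tau 0%N))).
    apply: ler_pM => //; last by rewrite lerDr.
    by rewrite divr_ge0 ?sqr_ge0 // subr_ge0 ltW.
  by rewrite invfM mulrA mulfVK // gt_eqF.
set K := (1 - r) / _ in K8.
have K0 : 0 <= K by rewrite divr_ge0 ?sqr_ge0 // subr_ge0 ltW.
set A := (1 - r) ^- 2.
have A0 : 0 <= A by rewrite invr_ge0 sqr_ge0.
have cs := abel_err_cvg0 r01.
have main N : `|\sum_(n < N) a n * r ^+ n| <= 2 * (e / 8) + 2 * (e / 8) + 2 * (tau N * (A + K)).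
  have lim : (fun M => 2 * (e / 8) + 2 * (tau N * (A + abel_err r M) + 4 * abel_err r M * (e / 8) +
      2 * abel_err r M * tau N + (K + abel_err r M) * (tau 0%N + tau N))) @ \oo -->
      2 * (e / 8) + 2 * (tau N * (A + 0) + 4 * 0 * (e / 8) + 2 * 0 * tau N + (K + 0) * (tau 0%N + tau N)).
    apply: cvgD; first exact: cvg_cst.
    apply: cvgMr; apply: cvgD; last by apply: cvgMl; apply: cvgD => //; apply: cvg_cst.
    apply: cvgD; last by apply: cvgMl; apply: cvgMr.
    apply: cvgD; last by apply: cvgMl; apply: cvgMr.
    by apply: cvgMr; apply: cvgD => //; apply: cvg_cst.
  apply: (@le_trans _ _ (2 * (e / 8) + 2 * (tau N * (A + 0) + 4 * 0 * (e / 8) + 2 * 0 * tau N + (K + 0) * (tau 0%N + tau N)))); last first.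
    by move: K8; lra.
  rewrite -(cvg_lim _ lim) //; apply: limr_ge; first by apply/cvg_ex; eexists; exact: lim.
  (* M >= N pairs all the coefficients, and M >= 2 makes the comparison term sin h available. *)
  exists (maxn N 2) => // M /=; rewrite geq_max => /andP[NM M2].
  apply: abel_finite_bound => //; [exact: ltW|by rewrite d0|exact: ltW|..].
  - by move=> h; apply: (le_trans (BN N h)); rewrite lerD2r.
  - move=> h /andP[h0 hd]; apply: (le_trans (BN N h)); rewrite lerD2r hd1 // h0.
    exact: le_trans hd dd1.
have limN : (fun N => 2 * (e / 8) + 2 * (e / 8) + 2 * (tau N * (A + K))) @ \oo -->
    2 * (e / 8) + 2 * (e / 8) + 2 * (0 * (A + K)).
  apply: cvgD; first exact: cvg_cst.
  by apply: cvgMr; apply: cvgMl.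
apply: (@le_trans _ _ (2 * (e / 8) + 2 * (e / 8) + 2 * (0 * (A + K)))); last by lra.
have nS : (fun N => `|\sum_(n < N) a n * r ^+ n|) @ \oo --> `|S| by apply: cvg_norm.
apply: (ler_cvg_to nS limN); exact: nearW.
Qed.

End AbelSummation.

(** * Trigonometric sums and Parseval's identity *)

Section TrigonometricSums.
Variable R : realType.
Implicit Types (t h A B : R) (m n k N K : nat) (al be : nat -> R).

Lemma cos_nat2pi k : cos (k%:R * (2 * pi) : R) = 1.
Proof.
rewrite mulrA -natrM mulr_natl -[X in cos X]add0r (alternatingn (@cosDpi R)).
by rewrite cos0 mulr1 -signr_odd oddM andbF.
Qed.

Lemma sin_nat2pi k : sin (k%:R * (2 * pi) : R) = 0.
Proof. by rewrite mulrA -natrM sin_natpi. Qed.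

(** The real part of (A + iB) e^{ikt}, whence the sign. *)
Definition trig A B k t : R := A * cos (k%:R * t) - B * sin (k%:R * t).

Lemma integ_trig a b A B k : k != 0%N ->
  integ a b (trig A B k)
    (A * ((sin (k%:R * b) - sin (k%:R * a)) / k%:R) +
     (- B) * ((cos (k%:R * a) - cos (k%:R * b)) / k%:R)).
Proof.
move=> k0; have kR : k%:R != 0 :> R by rewrite pnatr_eq0.
apply: (@integ_ext _ _ _ (fun t => A * cos (k%:R * t) + (- B) * sin (k%:R * t))).
  by move=> t; rewrite mulNr.
apply: integD; apply: integZ; [exact: integ_cosM|exact: integ_sinM].
Qed.

Lemma integ_trig_period A B k :
  integ 0 (2 * pi) (trig A B k) (if k == 0%N then 2 * pi * A else 0).
Proof.
have [->|k0] := eqVneq k 0%N.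
  apply: (@integ_ext _ _ _ (fun=> A)).
    by move=> t; rewrite /trig mul0r cos0 sin0 mulr1 mulr0 subr0.
  by have := @integ_cst R 0 (2 * pi) A; rewrite subr0 [A * _]mulrC.
have := @integ_trig 0 (2 * pi) A B k k0.
by rewrite sin_nat2pi cos_nat2pi !mulr0 sin0 cos0 !subrr !mul0r !mulr0 addr0.
Qed.

Lemma integ_trig_center A B k t h : k != 0%N ->
  integ (t - h) (t + h) (trig A B k) (2 * (trig A B k t / k%:R * sin (k%:R * h))).
Proof.
move=> k0; have := @integ_trig (t - h) (t + h) A B k k0.
rewrite (_ : _ + _ = 2 * (trig A B k t / k%:R * sin (k%:R * h))) //.
by rewrite mulrBr mulrDr sinB sinD cosB cosD /trig; ring.
Qed.

Section Coefficients.
Variables (al be : nat -> R).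
Definition wave n t : R := trig (al n) (be n) n t.
Definition energy n : R := al n ^+ 2 + be n ^+ 2.
(* the integral of (wave n)^2 over a period *)
Definition wave_mass n : R := if n == 0%N then 2 * pi * al 0%N ^+ 2 else pi * energy n.

Lemma wave_sq_le n t : wave n t ^+ 2 <= energy n.
Proof.
rewrite /wave /trig /energy; have := cos2Dsin2 (n%:R * t).
move: (cos _) (sin _) (al n) (be n) => c s a b e.
rewrite -subr_ge0 (_ : _ - _ = (a * s + b * c) ^+ 2) ?sqr_ge0 //.
by rewrite -[a ^+ 2 + b ^+ 2]mulr1 -e; ring.
Qed.

Lemma energy_ge0 n : 0 <= energy n. Proof. by rewrite addr_ge0 ?sqr_ge0. Qed.

Lemma wave_mass_ge0 n : 0 <= wave_mass n.
Proof.
have p0 := pi_ge0 R; rewrite /wave_mass; case: ifP => _; rewrite mulr_ge0 ?sqr_ge0 ?energy_ge0 //.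
by rewrite mulr_ge0.
Qed.

Lemma wave_mass_le n : wave_mass n <= 2 * pi * energy n.
Proof.
have p0 := pi_ge0 R; rewrite /wave_mass; case: eqP => [->|_].
  by rewrite ler_wpM2l ?mulr_ge0 // lerDl sqr_ge0.
by rewrite ler_wpM2r ?energy_ge0 //; lra.
Qed.

Lemma integ_wave_wave n m :
  integ 0 (2 * pi) (fun t => wave n t * wave m t) (if n == m then wave_mass n else 0).
Proof.
wlog mn : n m / (m <= n)%N => [hw|].
  have [|nm] := leqP m n; first exact: hw.
  apply: (@integ_ext _ _ _ (fun t => wave m t * wave n t)).
    by move=> t; rewrite mulrC.
  have := hw m n (ltnW nm); rewrite eq_sym.
  by case: eqP => [->|].
(* With c_n = al n + i be n, A1 + i B1 is c_n conj(c_m) and A2 + i B2 is c_n c_m. *)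
pose A1 := al n * al m + be n * be m; pose B1 := be n * al m - al n * be m.
pose A2 := al n * al m - be n * be m; pose B2 := al n * be m + be n * al m.
apply: (@integ_ext _ _ _ (fun t => 2^-1 * trig A1 B1 (n - m) t + 2^-1 * trig A2 B2 (n + m) t)).
  move=> t; rewrite /trig natrB // natrD [(n%:R - m%:R) * t]mulrBl [(n%:R + m%:R) * t]mulrDl.
  rewrite cosB cosD sinB sinD /wave /trig.
  by rewrite /A1 /B1 /A2 /B2; lra.
rewrite (_ : (if n == m then _ else _) = 2^-1 * (if (n - m == 0)%N then 2 * pi * A1 else 0) +
    2^-1 * (if (n + m == 0)%N then 2 * pi * A2 else 0)).
  by apply: integD; apply: integZ; apply: integ_trig_period.
rewrite subn_eq0 addn_eq0 eqn_leq mn andbT /wave_mass /A1 /A2.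
have [nm|] := leqP n m; last first.
  by move=> lt; rewrite (gtn_eqF (leq_ltn_trans (leq0n m) lt)) /= !mulr0 addr0.
have -> : m = n by apply/eqP; rewrite eqn_leq mn nm.
rewrite andbb; case: eqP => [->|_]; rewrite /energy; lra.
Qed.

(** A window of indices starting at m covers both the partial sums and the blocks of the sparse
    subsequence. *)
Lemma parseval m K :
  integ 0 (2 * pi) (fun t => (\sum_(i < K) wave (m + i) t) ^+ 2)
    (\sum_(i < K) wave_mass (m + i)).
Proof.
apply: (@integ_ext _ _ _ (fun t => \sum_(i < K) \sum_(j < K) wave (m + i) t * wave (m + j) t)).
  by move=> t; rewrite expr2 mulr_suml; apply: eq_bigr => i _; rewrite mulr_sumr.
apply: (@integ_sum _ _ _ (fun i t => \sum_(j < K) wave (m + i) t * wave (m + j) t)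
  (fun i => wave_mass (m + i))) => i iK.
rewrite (_ : wave_mass (m + i) =
  \sum_(j < K) (if (m + i == m + j)%N then wave_mass (m + i) else 0)).
  apply: (@integ_sum _ _ _ (fun j t => wave (m + i) t * wave (m + j) t)
    (fun j => if (m + i == m + j)%N then wave_mass (m + i) else 0)) => j _.
  exact: integ_wave_wave.
rewrite (bigD1 (Ordinal iK)) //= eqxx big1 ?addr0 //.
by move=> j; rewrite -val_eqE /= eqn_add2l eq_sym => /negbTE ->.
Qed.

Lemma continuous_wave n : continuous (wave n).
Proof.
move=> t; have ct : (fun x : R => n%:R * x) @ t --> n%:R * t.
  by apply: cvgMr; exact: cvg_id.
rewrite /wave /trig; apply: cvgB; apply: cvgMr.
  exact: (cvg_comp _ _ ct (@continuous_cos R _)).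
exact: (cvg_comp _ _ ct (@continuous_sin R _)).
Qed.

Lemma continuous_wave_sum m K : continuous (fun t => \sum_(i < K) wave (m + i) t).
Proof.
elim: K => [|K IH] t.
  by under eq_fun do rewrite big_ord0; apply: cvg_cst.
rewrite /continuous_at big_ord_recr /=; under eq_fun do rewrite big_ord_recr /=.
by apply: cvgD; [apply: IH|apply: continuous_wave].
Qed.

Definition wave_psum N t : R := \sum_(n < N) wave n t.

Lemma continuous_wave_psum N : continuous (wave_psum N).
Proof.
have -> : wave_psum N = (fun t => \sum_(i < N) wave (0 + i) t).
  by apply/funext => t; apply: eq_bigr.
exact: continuous_wave_sum.
Qed.

Lemma integ_wave_psum_center t h N : (0 < N)%N ->
  integ (t - h) (t + h) (wave_psum N)
    (2 * (al 0%N * h + sine_psum (fun n => if n == 0%N then 0 else wave n t) N h)).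
Proof.
case: N => // N _.
apply: (@integ_ext _ _ _ (fun x => al 0%N + \sum_(i < N) wave i.+1 x)).
  move=> x; rewrite /wave_psum big_ord_recl; congr (_ + _).
  by rewrite /wave /trig mul0r cos0 sin0 mulr1 mulr0 subr0.
rewrite /sine_psum big_ord_recl /= !mul0r add0r mulrDr mulr_sumr.
apply: integD.
  by have := @integ_cst R (t - h) (t + h) (al 0%N); rewrite (_ : _ * _ = 2 * (al 0%N * h)) //; ring.
apply: (@integ_sum _ _ _ (fun i x => wave i.+1 x)
  (fun i => 2 * (wave i.+1 t / i.+1%:R * sin (i.+1%:R * h)))) => i _.
exact: integ_trig_center.
Qed.

End Coefficients.

(** The bridge from primitives to the Lebesgue integral. *)
Lemma integral_integ (f : R -> R) a b v : a < b -> continuous f -> integ a b f v ->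
  (\int[lebesgue_measure]_(x in `[a, b]) (f x)%:E)%E = v%:E.
Proof.
move=> ab cf [F [dF <-]].
have cF x : {for x, continuous F}.
  apply: differentiable_continuous; apply/derivable1_diffP; by case: (dF x).
rewrite (continuous_FTC2 ab (continuous_subspaceT cf) (F := F)) ?EFinB //.
- split.
  + by move=> x _; case: (dF x).
  + by apply: cvg_at_right_filter; apply: cF.
  + by apply: cvg_at_left_filter; apply: cF.
- by move=> x _; rewrite derive1E; case: (dF x).
Qed.

(* weighted Cauchy-Schwarz with weights 2^-(j+1) *)
Lemma sqr_sum_le (x : nat -> R) J :
  (\sum_(j < J) x j) ^+ 2 <= \sum_(j < J) 2 ^+ j.+1 * x j ^+ 2.
Proof.
elim: J x => [|J IH] x; first by rewrite !big_ord0 expr0n.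
rewrite !big_ord_recl /=.
have := IH (fun j => x j.+1).
set X := \sum_(j < J) _; set Y := \sum_(j < J) 2 ^+ j.+1 * _.
have -> : \sum_(i < J) 2 ^+ (bump 0 i).+1 * x (bump 0 i) ^+ 2 = 2 * Y.
  by rewrite /Y mulr_sumr; apply: eq_bigr => i _; rewrite /bump /= add1n [2 ^+ i.+2]exprS mulrA.
rewrite expr1; have := sqr_ge0 (x 0%N - X); nra.
Qed.

End TrigonometricSums.

(** * Uniform tails and first-order expansions *)

Section AbsolutelyConvergent.
Variable R : realType.

(** A single [tau], the tail of the series of |x n|, serves all multipliers bounded by 1; they will
    be sin(nh), for all h at once. *)
Lemma abs_tail (x : nat -> R) (X : R) : (forall N, \sum_(n < N) `|x n| <= X) ->
  exists2 tau : nat -> R, tau @ \oo --> (0 : R) &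
  forall s : nat -> R, (forall n, `|s n| <= 1) -> exists2 b,
    (fun N => \sum_(n < N) x n * s n) @ \oo --> b &
    forall N, `|b - \sum_(n < N) x n * s n| <= tau N.
Proof.
move=> xX; pose P N := \sum_(n < N) `|x n|.
have Pnd : {homo P : m n / (m <= n)%N >-> m <= n}.
  move=> m n mn; rewrite /P -!(big_mkord xpredT (fun i => `|x i|)) (big_cat_nat _ mn) //= lerDl.
  by rewrite sumr_ge0.
have Pc : cvgn P.
  by apply: nondecreasing_is_cvgn => //; exists X => _ [N _ <-]; apply: xX.
exists (fun N => limn P - P N).
  by rewrite -(subrr (limn P)); apply: cvgB => //; apply: cvg_cst.
move=> s s1; pose S N := \sum_(n < N) x n * s n.
have d N K : `|S (N + K)%N - S N| <= P (N + K)%N - P N.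
  rewrite /S /P !big_split_ord /= addrAC subrr add0r addrAC subrr add0r.
  apply: (le_trans (ler_norm_sum _ _ _)); apply: ler_sum => i _.
  by rewrite normrM ler_piMr.
have dl N K : `|S (N + K)%N - S N| <= limn P - P N.
  by apply: (le_trans (d N K)); rewrite lerD2r nondecreasing_cvgn_le.
have Sc : cvgn S.
  apply: cvgn_cauchy => e e0.
  have /cvgrPdist_le /(_ (e / 2)) [|m _ hm] := Pc; first by rewrite divr_gt0.
  exists m => k l mk ml.
  have := dl m (k - m)%N; have := dl m (l - m)%N; rewrite !subnKC //.
  have := le_trans (ler_norm _) (hm m (leqnn m)).
  move=> h1 h2 h3.
  rewrite (_ : S k - S l = (S k - S m) - (S l - S m)); last by ring.
  by apply: (le_trans (ler_normB _ _)); lra.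
exists (limn S) => // N.
have c : (fun K => `|S (K + N)%N - S N|) @ \oo --> `|limn S - S N|.
  apply: cvg_norm; apply: cvgB; last exact: cvg_cst.
  by rewrite (cvg_shiftn N S).
rewrite -(cvg_lim _ c) //; apply: limr_le; first by apply/cvg_ex; eexists; exact: c.
by apply: nearW => K; rewrite addnC.
Qed.

(** Telescoping against 1 / n; the term n = 0 is 0 because the inverse of 0 is 0. *)
Lemma sum_inv_sqr N : \sum_(n < N) (n%:R : R) ^- 2 <= 2.
Proof.
case: N => [|N]; first by rewrite big_ord0.
case: N => [|N]; first by rewrite big_ord_recl big_ord0 /= expr0n /= invr0 addr0.
suff : \sum_(n < N.+2) (n%:R : R) ^- 2 <= 2 - N.+1%:R^-1.
  by have : 0 <= N.+1%:R^-1 :> R by []; move: (N.+1%:R^-1) => y; lra.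
elim: N => [|N IH].
  by rewrite !big_ord_recl big_ord0 /= expr0n /= invr0 add0r addr0 expr1n invr1; lra.
rewrite big_ord_recr /=; apply: (le_trans (lerD IH (lexx _))).
have p : 0 < N.+1%:R :> R by rewrite ltr0Sn.
rewrite -[N.+2%:R]natr1; move: (N.+1%:R) p => y y0.
have y1 : 0 < y + 1 by rewrite addr_gt0.
rewrite -subr_ge0 (_ : _ - _ = (y * (y + 1) ^+ 2)^-1); last first.
  by field; rewrite !gt_eqF.
by rewrite invr_ge0 mulr_ge0 ?sqr_ge0 // ltW.
Qed.

Lemma derivable_expansion (F : R -> R) (t l : R) : derivable F t 1 -> F^`() t = l ->
  forall e : R, 0 < e -> exists2 d : R, 0 < d & forall k, `|k| < d ->
    `|F (t + k) - F t - k * l| <= e * `|k|.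
Proof.
move=> dF <- e e0.
rewrite derive1E; have /cvgrPdist_le /(_ e e0) := dF.
rewrite near_withinE => /nbhs_ballP [d /= d0 hd].
exists d => // k kd.
have [->|k0] := eqVneq k 0; first by rewrite addr0 subrr mul0r subr0 normr0 mulr0.
have := hd k; rewrite /ball /= sub0r normrN => /(_ kd k0).
rewrite /GRing.scale /= mulr1 distrC => h.
rewrite -ler_pdivrMr ?normr_gt0 // -normfV -normrM.
have -> : (F (t + k) - F t - k * 'D_1 F t) / k = k^-1 * (F (k + t) - F t) - 'D_1 F t.
  by rewrite [k + t]addrC; field.
exact: h.
Qed.

End AbsolutelyConvergent.

(** * The boundary function and Fatou's theorem *)

Section BoundaryFunction.
Variable R : realType.
Local Notation mu := (@lebesgue_measure R).
Implicit Types (t h : R) (m n j k K : nat).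

Lemma small_tails (x : nat -> R) (E : R) : (forall n, 0 <= x n) ->
  (forall N, \sum_(n < N) x n <= E) ->
  forall e : R, 0 < e -> exists m, forall n K, (m <= n)%N ->
    \sum_(i < K) x (n + i)%N <= e.
Proof.
move=> x0 xE e e0.
pose P N := \sum_(n < N) x n.
have Pnd : {homo P : m n / (m <= n)%N >-> m <= n}.
  move=> m n mn; rewrite /P -!(big_mkord xpredT x) (big_cat_nat _ mn) //= lerDl.
  by rewrite sumr_ge0.
have Pc : cvgn P.
  by apply: nondecreasing_is_cvgn => //; exists E => _ [N _ <-]; apply: xE.
have /cvgrPdist_le /(_ e e0) [m _ hm] := Pc.
exists m => n K /hm /=; have := nondecreasing_cvgn_le Pnd Pc (n + K).
have -> : P (n + K)%N = P n + \sum_(i < K) x (n + i)%N by rewrite /P big_split_ord /=.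
by move=> h1 h2; have := le_trans (ler_norm _) h2; lra.
Qed.

(** The ratio 8 leaves a summable 2 / 4^j after weighting by 2^(j+1); E + 1 in place of E keeps the
    tolerance positive. *)
Lemma sparse_subsequence (x : nat -> R) (E : R) : (forall n, 0 <= x n) ->
  (forall N, \sum_(n < N) x n <= E) ->
  exists N : nat -> nat, [/\ N 0%N = 0%N, forall j, (N j < N j.+1)%N &
    forall j K, \sum_(i < K) x (N j + i)%N <= (E + 1) / 8 ^+ j].
Proof.
move=> x0 xE.
have E0 : 0 <= E by have := xE 0%N; rewrite big_ord0.
have /choice [m hm] : forall j, exists m, forall n K, (m <= n)%N ->
    \sum_(i < K) x (n + i)%N <= (E + 1) / 8 ^+ j.
  move=> j; apply: (small_tails x0 xE); rewrite divr_gt0 ?exprn_gt0 //; lra.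
pose N := fix N j := if j is j'.+1 then maxn (N j').+1 (m j) else 0%N.
exists N; split => //; first by move=> j /=; rewrite leq_maxl.
case=> [|j] K; last by apply: hm; rewrite /= leq_maxr.
rewrite expr0 divr1 (le_trans (xE K)) //; lra.
Qed.

Lemma sum_pow4 J : \sum_(j < J) (4^-1 : R) ^+ j <= 2.
Proof.
suff -> : \sum_(j < J) (4^-1 : R) ^+ j = 4 / 3 * (1 - 4^-1 ^+ J).
  have : 0 <= (4^-1 : R) ^+ J by rewrite exprn_ge0 // invr_ge0.
  lra.
elim: J => [|J IH]; first by rewrite big_ord0 expr0 subrr mulr0.
by rewrite big_ord_recr /= IH exprS; lra.
Qed.

Variables (al be : nat -> R) (E : R).
Hypothesis energy_bound : forall N, \sum_(n < N) energy al be n <= E.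
Variable N : nat -> nat.
Hypotheses (N0 : N 0%N = 0%N) (Nlt : forall j, (N j < N j.+1)%N).
Hypothesis Ntail : forall j K,
  \sum_(i < K) energy al be (N j + i)%N <= (E + 1) / 8 ^+ j.
Local Notation D := (`[0, 2 * pi] : set R).

Let E0 : 0 <= E. Proof. by have := energy_bound 0%N; rewrite big_ord0. Qed.

Let pi2 : 0 < 2 * pi :> R. Proof. by rewrite mulr_gt0 ?pi_gt0. Qed.

Lemma subseq_ge j : (j <= N j)%N.
Proof. by elim: j => // j IH; apply: leq_ltn_trans IH (Nlt j). Qed.

Lemma subseq_cvg : N @ \oo --> \oo.
Proof.
move=> P [n _ Pn]; exists n => // j /= nj; apply: Pn.
exact: leq_trans nj (subseq_ge j).
Qed.

Definition block j t : R := \sum_(i < N j.+1 - N j) wave al be (N j + i) t.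

Lemma wave_psum_block J t : wave_psum al be (N J) t = \sum_(j < J) block j t.
Proof.
elim: J => [|J IH]; first by rewrite N0 /wave_psum !big_ord0.
rewrite big_ord_recr /= -IH /block.
have := subnKC (ltnW (Nlt J)); move: (N J.+1 - N J)%N => k <-.
by rewrite /wave_psum big_split_ord.
Qed.

Lemma continuous_sqr (f : R -> R) : continuous f -> continuous (fun t => f t ^+ 2).
Proof.
by move=> cf t; rewrite /continuous_at expr2; under eq_fun do rewrite expr2;
  apply: cvgM; apply: cf.
Qed.

Lemma measurable_cont (f : R -> R) (A : set R) : continuous f ->
  measurable_fun A (EFin \o f).
Proof.
move=> cf; apply/measurable_EFinP; apply: measurable_funTS.
exact: continuous_measurable_fun.
Qed.

(** One integrable function with two uses: where it is finite the blocks are absolutely summable,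
    and it dominates the squares of the partial sums along [N]. *)
Definition block_mass t : \bar R :=
  (\sum_(0 <= j <oo) (2 ^+ j.+1 * block j t ^+ 2)%:E)%E.

Let bterm_ge0 j t : (0 <= (2 ^+ j.+1 * block j t ^+ 2)%:E)%E.
Proof. by rewrite lee_fin mulr_ge0 ?sqr_ge0 // exprn_ge0. Qed.

Let bterm_cont j : continuous (fun t => 2 ^+ j.+1 * block j t ^+ 2).
Proof.
move=> t; apply: cvgMr; apply: continuous_sqr; exact: continuous_wave_sum.
Qed.

Lemma block_mass_ge0 t : (0 <= block_mass t)%E.
Proof. by apply: nneseries_ge0 => j _ _; apply: bterm_ge0. Qed.

Lemma measurable_block_mass (A : set R) : measurable_fun A block_mass.
Proof.
apply: ge0_emeasurable_sum => j.
  by move=> t _ _; apply: bterm_ge0.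
by move=> _; apply: measurable_cont; apply: bterm_cont.
Qed.

Lemma integral_block_mass : (\int[mu]_(t in D) block_mass t < +oo)%E.
Proof.
pose q := 2 * pi * (E + 1).
have mb j : measurable_fun D (fun t => (2 ^+ j.+1 * block j t ^+ 2)%:E).
  by apply: measurable_cont; apply: bterm_cont.
rewrite (integral_nneseries mu (measurable_itv _) mb (fun j t _ => bterm_ge0 j t)).
pose v j := \sum_(i < N j.+1 - N j) wave_mass al be (N j + i)%N.
have iv j : (\int[mu]_(t in D) (2 ^+ j.+1 * block j t ^+ 2)%:E)%E = (2 ^+ j.+1 * v j)%:E.
  have ii := integZ (2 ^+ j.+1) (parseval al be (N j) (N j.+1 - N j)).
  exact: (integral_integ pi2 (@bterm_cont j) ii).
have q0 : 0 <= q by rewrite mulr_ge0 ?ltW //; have := E0; lra.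
have vb j : 2 ^+ j.+1 * v j <= 2 * q * 4^-1 ^+ j.
  have : v j <= q / 8 ^+ j.
    apply: (@le_trans _ _ (\sum_(i < N j.+1 - N j) 2 * pi * energy al be (N j + i)%N)).
      by apply: ler_sum => i _; apply: wave_mass_le.
    by rewrite -mulr_sumr /q -[leRHS]mulrA ler_wpM2l ?(ltW pi2).
  move=> vj; apply: (@le_trans _ _ (2 ^+ j.+1 * (q / 8 ^+ j))).
    by rewrite ler_wpM2l // exprn_ge0.
  have x0 : (2 : R) ^+ j != 0 by rewrite expf_neq0 // pnatr_eq0.
  have y0 : (4 : R) ^+ j != 0 by rewrite expf_neq0 // pnatr_eq0.
  rewrite exprVn exprS (_ : (8 : R) = 2 * 4); last by ring.
  rewrite exprMn; move: (2 ^+ j) (4 ^+ j) x0 y0 => x y x0 y0.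
  by rewrite (_ : 2 * x * _ = 2 * q / y) //; field; rewrite x0 y0.
apply: (@le_lt_trans _ _ (2 * q * 2)%:E); last by rewrite ltry.
under eq_eseriesr do rewrite iv.
apply: lime_le.
  apply: is_cvg_nneseries => j _ _; rewrite -iv; apply: integral_ge0 => t _.
  exact: bterm_ge0.
apply: nearW => J; rewrite sumEFin lee_fin big_mkord.
apply: (@le_trans _ _ (\sum_(j < J) 2 * q * 4^-1 ^+ j)).
  by apply: ler_sum => j _; apply: vb.
rewrite -mulr_sumr; apply: ler_wpM2l; [by rewrite mulr_ge0|exact: sum_pow4].
Qed.

Let mD : measurable D. Proof. exact: measurable_itv. Qed.

Lemma integrable_block_mass : mu.-integrable D block_mass.
Proof.
apply/integrableP; split; first exact: measurable_block_mass.
under eq_integral do rewrite gee0_abs ?block_mass_ge0 //.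
exact: integral_block_mass.
Qed.

Lemma wave_psum_sq_le J t : ((wave_psum al be (N J) t ^+ 2)%:E <= block_mass t)%E.
Proof.
apply: (@le_trans _ _ (\sum_(0 <= j < J) (2 ^+ j.+1 * block j t ^+ 2)%:E)%E).
  by rewrite sumEFin lee_fin wave_psum_block big_mkord; exact: (sqr_sum_le (fun j => block j t)).
by apply: nneseries_lim_ge => j _ _; apply: bterm_ge0.
Qed.

(** The limit superior is measurable without any convergence assumption and agrees with the limit
    where the partial sums converge; [fine] sends infinite values to 0. *)
Definition bdry t : R := fine (limn_esup (fun j => (wave_psum al be (N j) t)%:E)).

Lemma measurable_bdry (A : set R) : measurable A -> measurable_fun A bdry.
Proof.
move=> mA; rewrite /bdry.
apply: (@measurableT_comp _ _ _ _ _ _ fine _ (fun t => limn_esup (fun j => (wave_psum al be (N j) t)%:E))).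
  exact: fine_measurable.
apply: measurable_fun_limn_esup => j; apply: measurable_cont.
exact: continuous_wave_psum.
Qed.

Lemma cvg_bdry t : block_mass t \is a fin_num ->
  (fun j => wave_psum al be (N j) t) @ \oo --> bdry t.
Proof.
move=> Hfin.
pose X := fine (block_mass t).
have HX : block_mass t = X%:E by rewrite fineK.
have pb J : \sum_(j < J) 2 ^+ j.+1 * block j t ^+ 2 <= X.
  rewrite -lee_fin -HX -(big_mkord xpredT (fun j => 2 ^+ j.+1 * block j t ^+ 2)) -sumEFin.
  by apply: nneseries_lim_ge => j _ _; apply: bterm_ge0.
have c : cvgn (fun J => \sum_(j < J) block j t).
  (* |x| <= y x^2 + 1 / y with y = 2^(j+1): both terms on the right are summable in j. *)
  have b j : `|block j t| <= 2 ^+ j.+1 * block j t ^+ 2 + 2^-1 ^+ j.+1.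
    set x := block j t; have p : 0 < 2 ^+ j.+1 :> R by rewrite exprn_gt0.
    rewrite exprVn -real_normK ?num_real //.
    move: (2 ^+ j.+1) p (normr_ge0 x) => y y0 x0; set z := `|x| in x0 *.
    rewrite -(ler_pM2r y0) mulrDl mulVf ?gt_eqF //.
    by have := sqr_ge0 (y * z - 2^-1); nra.
  have geo J : \sum_(j < J) (2^-1 : R) ^+ j.+1 <= 1.
    suff -> : \sum_(j < J) (2^-1 : R) ^+ j.+1 = 1 - 2^-1 ^+ J.
      by rewrite lerBlDr lerDl exprn_ge0 // invr_ge0.
    elim: J => [|J IH]; first by rewrite big_ord0 expr0 subrr.
    by rewrite big_ord_recr /= IH exprS; lra.
  have sb J : \sum_(j < J) `|block j t| <= X + 1.
    apply: (@le_trans _ _ (\sum_(j < J) (2 ^+ j.+1 * block j t ^+ 2 + 2^-1 ^+ j.+1))).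
      by apply: ler_sum => j _; apply: b.
    rewrite big_split; apply: lerD; [exact: pb|exact: geo].
  have <- : series (fun j => block j t) = (fun J => \sum_(j < J) block j t).
    by apply/funext => J; rewrite /series /= big_mkord.
  apply: normed_cvg; apply: nondecreasing_is_cvgn.
    by apply: nondecreasing_series => n _ _; apply: normr_ge0.
  exists (X + 1) => _ [J _ <-]; have := sb J.
  by rewrite -(big_mkord xpredT (fun j => `|block j t|)).
have e : (fun j => wave_psum al be (N j) t) = (fun J => \sum_(j < J) block j t).
  by apply/funext => J; rewrite wave_psum_block.
have cE : (fun j => (wave_psum al be (N j) t)%:E) @ \oo -->
    (limn (fun J => \sum_(j < J) block j t))%:E.
  have c' : (fun j => wave_psum al be (N j) t) @ \oo -->
      limn (fun J => \sum_(j < J) block j t) by rewrite e; exact: c.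
  by apply: cvg_EFin; [exact: nearW|exact: c'].
by rewrite /bdry (cvg_limn_einf_sup cE).2 /= e.
Qed.

Lemma ae_cvg_bdry : {ae mu, forall t, D t ->
  (fun j => wave_psum al be (N j) t) @ \oo --> bdry t}.
Proof.
have := @integrable_ae _ _ _ mu D mD _ integrable_block_mass; apply: filterS => t h Dt.
exact: cvg_bdry (h Dt).
Qed.

(** The constant 1 makes it dominate |x| as well as x^2, since |x| <= 1 + x^2. *)
Let dom t : \bar R := ((cst 1%E) \+ block_mass)%E t.

Let integrable_dom (A : set R) : measurable A -> A `<=` D -> mu.-integrable A dom.
Proof.
move=> mA AD; apply: (@integrableS _ _ _ mu _ _ _ mD mA AD).
apply: integrableD => //; last exact: integrable_block_mass.
have := @continuous_compact_integrable R (cst 1) D (@segment_compact R 0 (2 * pi)).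
apply; apply: continuous_subspaceT => x; exact: cvg_cst.
Qed.

Lemma dct_bdry (A : set R) : measurable A -> A `<=` D ->
  mu.-integrable A (EFin \o bdry) /\
  (fun j => \int[mu]_(t in A) (wave_psum al be (N j) t)%:E)%E @ \oo -->
    (\int[mu]_(t in A) (bdry t)%:E)%E.
Proof.
move=> mA AD.
have [] := @dominated_convergence _ _ _ mu A mA
  (fun j t => (wave_psum al be (N j) t)%:E) (EFin \o bdry) dom.
- by move=> j; apply: measurable_cont; apply: continuous_wave_psum.
- by apply/measurable_EFinP; apply: measurable_bdry.
- have := ae_cvg_bdry; apply: (@filterS _ _ (ae_filter_ringOfSetsType mu)) => t h /AD /h c; apply: cvg_EFin => //.
  exact: nearW.
- exact: integrable_dom.
- apply: aeW => t j _; rewrite /dom /=.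
  apply: (@le_trans _ _ (1 + (wave_psum al be (N j) t ^+ 2)%:E)%E); last first.
    by rewrite leeD2l // wave_psum_sq_le.
  rewrite -EFinD lee_fin; move: (wave_psum _ _ _ _) => x.
  rewrite -[x ^+ 2]real_normK ?num_real //; have := sqr_ge0 (`|x| - 1); have := normr_ge0 x; nra.
by move=> ? _ ?.
Qed.

Lemma dct_bdry_sq :
  mu.-integrable D (fun t => (bdry t ^+ 2)%:E) /\
  (fun j => \int[mu]_(t in D) (wave_psum al be (N j) t ^+ 2)%:E)%E @ \oo -->
    (\int[mu]_(t in D) (bdry t ^+ 2)%:E)%E.
Proof.
have [] := @dominated_convergence _ _ _ mu D mD
  (fun j t => (wave_psum al be (N j) t ^+ 2)%:E) (fun t => (bdry t ^+ 2)%:E) dom.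
- by move=> j; apply: measurable_cont; apply: continuous_sqr; apply: continuous_wave_psum.
- by apply/measurable_EFinP; apply: measurable_funX; apply: measurable_bdry.
- have := ae_cvg_bdry; apply: (@filterS _ _ (ae_filter_ringOfSetsType mu)) => t h /h c; apply: cvg_EFin => //.
    exact: nearW.
  by rewrite expr2; under eq_fun do rewrite /= expr2; apply: cvgM.
- exact: integrable_dom.
- apply: aeW => t j _; rewrite /dom /= ger0_norm ?sqr_ge0 //.
  rewrite (le_trans (wave_psum_sq_le j t)) // leeDr //.
by move=> ? _ ?.
Qed.

Lemma integral_bdry_sq (V : R) :
  (fun n => \sum_(i < n) wave_mass al be i) @ \oo --> V ->
  (\int[mu]_(t in D) (bdry t ^+ 2)%:E)%E = V%:E.
Proof.
move=> hV; have [_ h] := dct_bdry_sq.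
have e j : (\int[mu]_(t in D) (wave_psum al be (N j) t ^+ 2)%:E)%E =
    (\sum_(i < N j) wave_mass al be i)%:E.
  apply: integral_integ => //.
    by apply: continuous_sqr; apply: continuous_wave_psum.
  exact: (parseval al be 0 (N j)).
have h' : (fun j => \int[mu]_(t in D) (wave_psum al be (N j) t ^+ 2)%:E)%E @ \oo --> V%:E.
  rewrite (funext e); apply: cvg_EFin; first exact: nearW.
  exact: (cvg_comp _ _ subseq_cvg hV).
exact: (cvg_unique _ h h').
Qed.

Local Notation g := bdry.

(** The boundary function cut off outside one period, and then its primitive from 0: the form to
    which the differentiation theorem applies. *)
Let G : R -> R := g \_ D.
Let F x : R := (\int[mu]_(s in [set` Interval (BLeft 0) (BRight x)]) (G s))%R.

Lemma integrable_bdry : mu.-integrable D (EFin \o g).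
Proof. by have [] := @dct_bdry D mD. Qed.

Let integrable_G (A : set R) : measurable A -> mu.-integrable A (EFin \o G).
Proof.
move=> mA; apply: (@integrableS _ _ _ mu setT A _ measurableT mA) => //.
have /(@integrable_mkcond _ _ _ mu D (EFin \o g) mD) := integrable_bdry.
by rewrite /G restrict_EFin.
Qed.

Lemma ae_derivable_F : {ae mu, forall t, 0 < t -> derivable F t 1 /\ F^`() t = G t}.
Proof.
have loc : locally_integrable [set: R] G.
  by apply: integrable_locally_restrict => //; apply: integrable_bdry.
have := @FTC1 R G (BLeft 0) (fun y => integrable_G (measurable_itv _)) loc.
apply: (@filterS _ _ (ae_filter_ringOfSetsType mu)) => t h t0; apply: h.
by rewrite lte_fin.
Qed.

(** Dominated convergence on [0, x]. The shift of j by 2 ensures that every partial sum contains the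
    indices 0 and 1, both treated separately below. *)
Lemma cvg_F x (P : nat -> R -> R) : 0 < x <= 2 * pi ->
  (forall j y, is_derive y (1 : R) (P j) (wave_psum al be (N j.+2) y)) ->
  (fun j => P j x - P j 0) @ \oo --> F x.
Proof.
move=> /andP[x0 x2] dP.
pose A := [set` Interval (BLeft 0) (BRight x)].
have AD : A `<=` D.
  by move=> y; rewrite /A /= !in_itv /= => /andP[-> /= yx]; apply: le_trans x2.
have mA : measurable A by exact: measurable_itv.
have [ig] := @dct_bdry A mA AD.
rewrite -(cvg_shiftn 2) => c.
have e j : (\int[mu]_(t in A) (wave_psum al be (N (j + 2)%N) t)%:E)%E = (P j x - P j 0)%:E.
  rewrite addn2; apply: integral_integ => //; first exact: continuous_wave_psum.
  by exists (P j); split.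
have eF : (\int[mu]_(t in A) (g t)%:E)%E = (F x)%:E.
  have -> : (\int[mu]_(t in A) (g t)%:E)%E = (\int[mu]_(t in A) (G t)%:E)%E.
    by apply: eq_integral => y /set_mem Ay; rewrite /G patchE mem_set //; apply: AD.
  by rewrite /F /Rintegral fineK //; apply: integrable_fin_num => //; apply: integrable_G.
move: c; rewrite eF (_ : [sequence _]_n = (fun j => (P j x - P j 0)%:E)); last exact/funext.
by move=> /fine_cvg.
Qed.

Let a t n : R := if n == 0%N then 0 else wave al be n t.

Lemma cvg_center t h : 0 < t - h -> 0 < h -> t + h <= 2 * pi ->
  (fun j => 2 * (al 0%N * h + sine_psum (a t) (N j.+2) h)) @ \oo --> F (t + h) - F (t - h).
Proof.
move=> th h0 ht.
have Npos j : (0 < N j.+2)%N by apply: leq_ltn_trans (Nlt _).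
have /choice [P hP] : forall j, exists P : R -> R,
    (forall x, is_derive x (1 : R) P (wave_psum al be (N j.+2) x)) /\
    P (t + h) - P (t - h) = 2 * (al 0%N * h + sine_psum (a t) (N j.+2) h).
  by move=> j; apply: integ_wave_psum_center.
have dP j y : is_derive y (1 : R) (P j) (wave_psum al be (N j.+2) y).
  by case: (hP j).
have c1 : (fun j => P j (t + h) - P j 0) @ \oo --> F (t + h).
  by apply: cvg_F => //; rewrite ht andbT; lra.
have c2 : (fun j => P j (t - h) - P j 0) @ \oo --> F (t - h).
  by apply: cvg_F => //; rewrite th; lra.
rewrite (_ : (fun j => _) = (fun j => (P j (t + h) - P j 0) - (P j (t - h) - P j 0))).
  exact: cvgB.
by apply/funext => j; case: (hP j) => _ <-; ring.
Qed.

Section Point.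
Variable t : R.
Hypothesis t02 : 0 < t < 2 * pi.
Hypothesis dF : derivable F t 1 /\ F^`() t = G t.
Let L : R := g t - al 0%N.
(* subtracting L from the first coefficient reduces to a series with limit 0,
   because the sine series of the sequence (0, L, 0, ...) is L sin h *)
Let a' n : R := a t n - (if n == 1%N then L else 0).

Let Gt : G t = g t.
Proof.
case/andP: t02 => t0 t2.
by rewrite /G patchE mem_set //= in_itv /= !ltW.
Qed.

Let sine_a' n h : (2 <= n)%N -> sine_psum a' n h = sine_psum (a t) n h - L * sin h.
Proof.
move=> n2; rewrite /sine_psum.
have -> : L * sin h = \sum_(i < n) (if i == 1%N :> nat then L else 0) / i%:R * sin (i%:R * h).
  rewrite (bigD1 (Ordinal n2)) //= big1 ?addr0 ?divr1 ?mul1r //.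
  by move=> i; rewrite -val_eqE /= => /negbTE ->; rewrite !mul0r.
by rewrite -sumrB; apply: eq_bigr => i _; rewrite /a' !mulrBl.
Qed.

(** |a' n / n| <= |a' n|^2 + 1 / n^2, and the energy bound makes the squares summable. *)
Let a'_summable : forall n, \sum_(i < n) `|a' i / i%:R| <= 2 * E + 2 * L ^+ 2 + 2.
Proof.
move=> n.
apply: (@le_trans _ _ (\sum_(i < n) (2 * energy al be i +
    2 * (if i == 1%N :> nat then L ^+ 2 else 0) + i%:R ^- 2))).
  apply: ler_sum => i _; rewrite normrM normfV [`|i%:R|]ger0_norm //.
  have b1 : `|a' i| ^+ 2 <= 2 * energy al be i + 2 * (if i == 1%N :> nat then L ^+ 2 else 0).
    rewrite real_normK ?num_real //.
    apply: (@le_trans _ _ (2 * a t i ^+ 2 + 2 * (if i == 1%N :> nat then L else 0) ^+ 2)).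
      by rewrite /a'; move: (a t i) (if _ then _ else _) => x y; have := sqr_ge0 (x + y); nra.
    apply: lerD; last by case: ifP => _; rewrite ?expr0n.
    rewrite ler_pM2l // /a; case: ifP => _; last exact: wave_sq_le.
    by rewrite expr0n energy_ge0.
  rewrite -exprVn; apply: le_trans (lerD b1 (lexx _)).
  move: (`|a' i|) (i%:R^-1) => x y; have := sqr_ge0 (x - y).
  have := sqr_ge0 x; have := sqr_ge0 y; nra.
rewrite !big_split /= -!mulr_sumr; apply: lerD; last exact: sum_inv_sqr.
apply: lerD; first by rewrite ler_pM2l // energy_bound.
rewrite ler_pM2l //.
case: n => [|[|n]]; rewrite ?big_ord0 ?sqr_ge0 //.
  by rewrite big_ord_recl big_ord0 /= addr0 sqr_ge0.
rewrite (bigD1 (Ordinal (ltn0Sn n : (1 < n.+2)%N))) //= big1 ?addr0 //.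
by move=> i; rewrite -val_eqE /= => /negbTE ->.
Qed.

(** Differentiability of [F] at t gives F(t + h) - F(t - h) = 2 h g(t) + o(h). As sin h = h + o(h),
    the sine series of [a'] is o(h) and [abel_of_sine_series] applies. *)
Lemma fatou_at e : 0 < e -> exists2 rho : R, rho < 1 & forall r, rho < r < 1 ->
  forall S, (fun n => \sum_(i < n) wave al be i t * r ^+ i) @ \oo --> S ->
    `|S - g t| <= e.
Proof.
move=> e0; case/andP: (t02) => t0 t2.
have [tau tau0 htau] := @abs_tail R (fun n => a' n / n%:R) _ a'_summable.
have /choice [B hB] : forall h, exists b,
    (fun n => sine_psum a' n h) @ \oo --> b /\
    forall n, `|b - sine_psum a' n h| <= tau n.
  move=> h; have [|b b1 b2] := htau (fun n => sin (n%:R * h)); last by exists b.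
  by move=> n; rewrite ler_norml sin_geN1 sin_le1.
(* By absolute convergence B is a limit over all n; along the subsequence that limit is an integral
   of the boundary function. *)
have BE h : 0 < t - h -> 0 < h -> t + h <= 2 * pi ->
    B h = 2^-1 * (F (t + h) - F (t - h)) - al 0%N * h - L * sin h.
  move=> th h0 ht.
  have c1 : (fun j => sine_psum a' (N j.+2) h) @ \oo --> B h.
    have [c _] := hB h.
    apply: (cvg_comp (fun j => N j.+2) (fun n => sine_psum a' n h) _ c).
    move=> P [n _ Pn]; exists n => // j /= nj; apply: Pn => /=.
    by apply: leq_trans nj _; apply: leq_trans (subseq_ge j.+2); rewrite -addn2 leq_addr.
  have c2 : (fun j => sine_psum a' (N j.+2) h) @ \oo -->
      2^-1 * (F (t + h) - F (t - h)) - al 0%N * h - L * sin h.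
    rewrite (_ : (fun j => _) = (fun j =>
      2^-1 * (2 * (al 0%N * h + sine_psum (a t) (N j.+2) h)) - al 0%N * h - L * sin h)).
      apply: cvgB; last exact: cvg_cst.
      apply: cvgB; last exact: cvg_cst.
      by apply: cvgMr; apply: cvg_center.
    apply/funext => j; rewrite sine_a'; first by field.
    by apply: leq_trans (subseq_ge j.+2).
  exact: (cvg_unique _ c1 c2).
have small e' : 0 < e' -> exists2 d, 0 < d & forall h, 0 <= h <= d -> `|B h| <= e' * h.
  move=> e'0; have e2 : 0 < e' / 2 by rewrite divr_gt0.
  have [dF1 dF2] := dF.
  have [d1 d10 hd1] := derivable_expansion dF1 dF2 e2.
  have L1 : 0 < `|L| + 1 by rewrite ltr_wpDl.
  (* d1 / 2 serves the expansion of F, t / 2 and 2 pi - t keep t - h and t + h inside the period,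
     and the last two bounds make L (h - sin h) at most (e' / 2) h. *)
  pose d := Num.min (d1 / 2) (Num.min (Num.min (t / 2) (2 * pi - t))
    (Num.min 1 (e' / 2 / (`|L| + 1)))).
  have d0 : 0 < d.
    by rewrite !lt_min ltr01 !divr_gt0 //= andbT subr_gt0.
  exists d => // h /andP[h0 hd]; have := hd; rewrite /d !le_min.
  move=> /andP[hd1' /andP[/andP[ht1 ht2] /andP[h1 hL]]].
  have [h00|hn0] := eqVneq h 0.
    rewrite h00 mulr0; have [c _] := hB 0.
    suff -> : B 0 = 0 by rewrite normr0.
    have s0 : (fun n => sine_psum a' n 0) = (fun=> 0).
      by apply/funext => n; rewrite /sine_psum big1 // => i _; rewrite mulr0 sin0 mulr0.
    rewrite s0 in c; have c0 : (fun=> 0) @ \oo --> (0 : R) by exact: cvg_cst.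
    exact: (cvg_unique _ c c0).
  have hp : 0 < h by rewrite lt_neqAle eq_sym hn0.
  rewrite BE //; [|lra|lra].
  have h1d : `|h| < d1 by rewrite gtr0_norm //; lra.
  have := hd1 h h1d; have := hd1 (- h); rewrite normrN => /(_ h1d).
  rewrite Gt [`|h|]gtr0_norm // => b1 b2.
  have b3 : `|L * (h - sin h)| <= e' / 2 * h.
    rewrite normrM [`|h - sin h|]ger0_norm; last by rewrite subr_ge0 sin_le.
    have s3 := sin_ge h0.
    have s4 : h - sin h <= h * h by nra.
    apply: (@le_trans _ _ ((`|L| + 1) * (h * h))).
      apply: ler_pM => //; first by rewrite subr_ge0 sin_le.
      by rewrite lerDl.
    rewrite mulrA ler_wpM2r //.
    by move: hL; rewrite ler_pdivlMr // mulrC.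
  have -> : 2^-1 * (F (t + h) - F (t - h)) - al 0%N * h - L * sin h =
      2^-1 * (F (t + h) - F t - h * g t) - 2^-1 * (F (t - h) - F t - - h * g t) + L * (h - sin h).
    by rewrite /L; field.
  move: b1 b2 b3; rewrite !ler_norml => /andP[? ?] /andP[? ?] /andP[? ?].
  by apply/andP; split; lra.
have a'0 : a' 0%N = 0 by rewrite /a' /a /= subr0.
have hB2 n h : `|B h - sine_psum a' n h| <= tau n by case: (hB h).
have e2 : 0 < e / 2 by rewrite divr_gt0.
have [rho rho1 hrho] := abel_of_sine_series a'0 hB2 tau0 small e2.
have L1 : 0 < `|L| + 1 by rewrite ltr_wpDl.
(* The second bound makes L (r - 1) at most e / 2, which pays for the subtraction of L at index
   1. *)
exists (Num.max rho (1 - e / 2 / (`|L| + 1))).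
  by rewrite gt_max rho1 /=; have := divr_gt0 e2 L1; lra.
move=> r /andP[]; rewrite gt_max => /andP[r1 r2] r3 S hS.
have c : (fun n => \sum_(i < n) a' i * r ^+ i) @ \oo --> S - al 0%N - L * r.
  rewrite -(cvg_shiftn 2).
  rewrite (_ : [sequence _]_n = (fun n => \sum_(i < n + 2) wave al be i t * r ^+ i - al 0%N - L * r)).
    apply: cvgB; last exact: cvg_cst.
    apply: cvgB; last exact: cvg_cst.
    by rewrite (cvg_shiftn 2 (fun n => \sum_(i < n) wave al be i t * r ^+ i)).
  apply/funext => n; rewrite /= addn2.
  suff : \sum_(i < n.+2) wave al be i t * r ^+ i - \sum_(i < n.+2) a' i * r ^+ i =
    al 0%N + L * r by lra.
  rewrite -sumrB !big_ord_recl big1 ?addr0 => [|i _].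
    by rewrite /a' /a /bump /= /wave /trig mul0r cos0 sin0; ring.
  by rewrite /a' /a /bump /= subr0 subrr.
have r13 : rho < r < 1 by rewrite r1.
have := hrho r r13 _ c => h1.
have h2 : `|L * (r - 1)| <= e / 2.
  rewrite normrM [`|r - 1|]distrC [`|1 - r|]ger0_norm; last by lra.
  apply: (@le_trans _ _ ((`|L| + 1) * (e / 2 / (`|L| + 1)))).
    by apply: ler_pM => //; [lra|rewrite lerDl|lra].
  by rewrite mulrCA divff ?mulr1 // gt_eqF.
have -> : S - g t = (S - al 0%N - L * r) + L * (r - 1) by rewrite /L; ring.
by apply: (le_trans (ler_normD _ _)); lra.
Qed.

End Point.

Theorem fatou : {ae mu, forall t, 0 < t < 2 * pi -> forall e : R, 0 < e ->
  exists2 rho : R, rho < 1 & forall r, rho < r < 1 ->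
  forall S, (fun n => \sum_(i < n) wave al be i t * r ^+ i) @ \oo --> S ->
    `|S - g t| <= e}.
Proof.
have := ae_derivable_F; apply: (@filterS _ _ (ae_filter_ringOfSetsType mu)) => t h t02 e e0.
by apply: fatou_at => //; apply: h; case/andP: t02.
Qed.

End BoundaryFunction.

(** * Unimodularity of the boundary values *)

Section InnerFunction.
Variable R : realType.
Local Notation C := R[i].
Local Notation Re := complex.Re.
Local Notation Im := complex.Im.
Local Notation mu := (@lebesgue_measure R).
Local Notation shift k := (iter k (@Mz R)).
Local Notation D := (`[0, 2 * pi] : set R).
Variable theta : cseq R.
Hypotheses (ht : H2 theta) (nt : nsq theta = 1).
Hypothesis orth : forall k, inner (shift k.+1 theta) theta = 0.

Let al n : R := Re (theta n).
Let be n : R := Im (theta n).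
(** Since -i (al + i be) = be + i nal, the imaginary part of theta is handled as a real part, with
    coefficients [be] and [nal]. *)
Let nal n : R := - Re (theta n).

Let energyE n : energy al be n = cmod (theta n) ^+ 2.
Proof. by rewrite cmod_sq. Qed.
Let energyE' n : energy be nal n = cmod (theta n) ^+ 2.
Proof. by rewrite cmod_sq /energy sqrrN addrC. Qed.

Let Re_term n r t :
  Re (theta n * ((r +i* 0) * expi t) ^+ n) = wave al be n t * r ^+ n.
Proof.
rewrite exprMn expiX -[r +i* 0]/(r%:C) -rmorphXn mulrCA Re_realM ReM /= mulrC.
by [].
Qed.

Let Im_term n r t :
  Im (theta n * ((r +i* 0) * expi t) ^+ n) = wave be nal n t * r ^+ n.
Proof.
rewrite exprMn expiX -[r +i* 0]/(r%:C) -rmorphXn mulrCA Im_realM ImM /= mulrC.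
by rewrite /wave /trig /nal mulNr opprK addrC.
Qed.

Let cmod_point (r t : R) : 0 < r < 1 -> cmod ((r +i* 0) * expi t) < 1.
Proof.
move=> /andP[r0 r1]; rewrite cmodM cmod_expi mulr1 -[r +i* 0]/(r%:C) cmod_real.
by rewrite gtr0_norm.
Qed.

Let cvg_Re r t : 0 < r < 1 ->
  (fun n => \sum_(i < n) wave al be i t * r ^+ i) @ \oo -->
  Re (hval theta ((r +i* 0) * expi t)).
Proof.
move=> r01; have [c _] := cvg_psum ht (cmod_point t r01).
rewrite (_ : (fun n => _) = (fun n => Re (psum theta ((r +i* 0) * expi t) n))) //.
by apply/funext => n; rewrite /psum Re_sum; apply: eq_bigr => i _; rewrite Re_term.
Qed.

Let cvg_Im r t : 0 < r < 1 ->
  (fun n => \sum_(i < n) wave be nal i t * r ^+ i) @ \oo -->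
  Im (hval theta ((r +i* 0) * expi t)).
Proof.
move=> r01; have [_ c] := cvg_psum ht (cmod_point t r01).
rewrite (_ : (fun n => _) = (fun n => Im (psum theta ((r +i* 0) * expi t) n))) //.
by apply/funext => n; rewrite /psum Im_sum; apply: eq_bigr => i _; rewrite Im_term.
Qed.

Let radial (f : R -> R) (l : R) :
  (forall e : R, 0 < e -> exists2 rho : R, rho < 1 & forall r, rho < r < 1 -> 0 < r < 1 ->
    `|f r - l| <= e) -> f x @[x --> 1^'-] --> l.
Proof.
move=> h; apply/cvgrPdist_le => e e0; have [rho rho1 hr] := h e e0.
near=> r; rewrite distrC.
have r1 : r < 1 by near: r; exact: nbhs_left_lt.
apply: hr; rewrite r1 andbT.
  by near: r; exact: nbhs_left_gt.
by near: r; exact: nbhs_left_gt.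
Unshelve. all: by end_near. Qed.

(** The radial limit g satisfies |g| <= 1 almost everywhere by [hval_le1], while 1 - |g|^2 has
    integral 0 over the period. *)
Lemma inner_fun_of_orth : inner_fun theta.
Proof.
split.
  exists 1 => z z1; split; first exact: cvg_psum.
  exact: (hval_le1 ht nt orth z1).
have eb n : \sum_(i < n) energy al be i <= 1.
  by rewrite -nt (eq_bigr _ (fun (i : 'I_n) _ => energyE i)); apply: psq_le_nsq.
have eb' n : \sum_(i < n) energy be nal i <= 1.
  by rewrite -nt (eq_bigr _ (fun (i : 'I_n) _ => energyE' i)); apply: psq_le_nsq.
(* The two coefficient pairs have the same energies, so one subsequence serves both. *)
have [N [N0 Nlt Ntail]] := sparse_subsequence (energy_ge0 al be) eb.
have Ntail' j K : \sum_(i < K) energy be nal (N j + i)%N <= (1 + 1) / 8 ^+ j.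
  apply: le_trans (Ntail j K); rewrite le_eqVlt; apply/orP; left; apply/eqP.
  by apply: eq_bigr => i _; rewrite energyE' energyE.
pose g1 := bdry al be N; pose g2 := bdry be nal N.
pose f r t := hval theta ((r +i* 0) * expi t).
have pi2 : 0 < 2 * pi :> R by rewrite mulr_gt0 ?pi_gt0.
have lims : {ae mu, forall t, 0 < t < 2 * pi ->
    cvg_left1 (f^~ t) (g1 t +i* g2 t)}.
  have := @filterI _ _ (ae_filter_ringOfSetsType mu) _ _
    (fatou eb N0 Nlt Ntail) (fatou eb' N0 Nlt Ntail').
  apply: (@filterS _ _ (ae_filter_ringOfSetsType mu)) => t [h1 h2] t02; split; apply: radial => e e0.
    have [rho rho1 h] := h1 t02 e e0; exists rho => // r rr r01.
    by apply: (h r rr); apply: cvg_Re.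
  have [rho rho1 h] := h2 t02 e e0; exists rho => // r rr r01.
  by apply: (h r rr); apply: cvg_Im.
have bounded t : cvg_left1 (f^~ t) (g1 t +i* g2 t) -> g1 t ^+ 2 + g2 t ^+ 2 <= 1.
  move=> [c1 c2]; rewrite /= in c1 c2.
  have c : (fun r => cmod (f r t) ^+ 2) x @[x --> 1^'-] --> g1 t ^+ 2 + g2 t ^+ 2.
    rewrite (_ : (fun r => _) = (fun r => Re (f r t) * Re (f r t) + Im (f r t) * Im (f r t))).
      by apply: cvgD; rewrite expr2; apply: cvgM.
    by apply/funext => r; rewrite cmod_sq !expr2.
  rewrite -(cvg_lim _ c) //; apply: limr_le; first by apply/cvg_ex; eexists; exact: c.
  near=> r; apply: exprn_ile1; first exact: cmod_ge0.
  apply: (hval_le1 ht nt orth); apply: cmod_point.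
  apply/andP; split; near: r; [exact: nbhs_left_gt|exact: nbhs_left_lt].
have mD : measurable D by exact: measurable_itv.
pose v1 n := \sum_(i < n) wave_mass al be i; pose v2 n := \sum_(i < n) wave_mass be nal i.
have vc (x y : nat -> R) : (forall n, \sum_(i < n) energy x y i <= 1) ->
    cvgn (fun n => \sum_(i < n) wave_mass x y i).
  move=> b; apply: nondecreasing_is_cvgn.
    move=> m n mn; rewrite -!(big_mkord xpredT (wave_mass x y)) (big_cat_nat _ mn) //= lerDl.
    by apply: sumr_ge0 => i _; apply: wave_mass_ge0.
  exists (2 * pi * 1) => _ [n _ <-].
  apply: (@le_trans _ _ (\sum_(i < n) 2 * pi * energy x y i)).
    by apply: ler_sum => i _; apply: wave_mass_le.
  by rewrite -mulr_sumr ler_pM2l.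
(* At each index the two masses add up to 2 pi |theta n|^2, also at 0, where each is 2 pi times a
   single square. *)
have V12 : limn v1 + limn v2 = 2 * pi.
  have c12 : (fun n => v1 n + v2 n) @ \oo --> limn v1 + limn v2.
    by apply: cvgD; [exact: (vc al be eb)|exact: (vc be nal eb')].
  have c : (fun n => v1 n + v2 n) @ \oo --> 2 * pi.
    rewrite (_ : (fun n => _) = (fun n => 2 * pi * psq theta n)).
      by rewrite -[X in _ --> X]mulr1 -nt; apply: cvgMr; apply: cvg_psq.
    apply/funext => n; rewrite /v1 /v2 -big_split mulr_sumr; apply: eq_bigr => i _.
    rewrite /wave_mass energyE energyE'; case: eqP => [->|_] /=; last by ring.
    by rewrite cmod_sq /al /be; ring.
  exact: (cvg_unique _ c12 c).
have [ig1 _] := dct_bdry_sq eb N0 Nlt Ntail; have [ig2 _] := dct_bdry_sq eb' N0 Nlt Ntail'.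
have i1 := integral_bdry_sq eb N0 Nlt Ntail (vc al be eb).
have i2 := integral_bdry_sq eb' N0 Nlt Ntail' (vc be nal eb').
pose u t := 1 - (g1 t ^+ 2 + g2 t ^+ 2).
(* [inner_fun] asks for the closed interval, whose end points form a null set. *)
have ends : {ae mu, forall t, D t -> 0 < t < 2 * pi}.
  have n1 (x : R) : mu.-negligible [set x].
    exists [set x]; split => //; exact: lebesgue_measure_set1.
  apply: negligibleS (negligibleU (n1 0) (n1 (2 * pi))).
  move=> t /= /not_implyP [Dt nt0]; apply: contrapT => /not_orP [t0 t2]; apply: nt0.
  move: Dt; rewrite /= in_itv /= => /andP[a b].
  rewrite !lt_neqAle a b !andbT eq_sym; apply/andP; split; apply/eqP => //.
have u0 : {ae mu, forall t, D t -> u t = 0}.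
  have iu1 : mu.-integrable D (fun t => (g1 t ^+ 2 + g2 t ^+ 2)%:E).
    by apply: (@eq_integrable _ _ _ mu D mD _ _ _ (@integrableD _ _ _ mu D mD _ _ ig1 ig2)).
  have ic : mu.-integrable D (EFin \o (cst 1 : R -> R)).
    have := @continuous_compact_integrable R (cst 1) D (@segment_compact R 0 (2 * pi)).
    apply; apply: continuous_subspaceT => x; exact: cvg_cst.
  have iu : (\int[mu]_(t in D) (u t)%:E = 0)%E.
    rewrite (_ : (fun t => (u t)%:E) = (fun t => ((cst 1 t)%:E - (g1 t ^+ 2 + g2 t ^+ 2)%:E)%E)); last first.
      by apply/funext => t; rewrite /u EFinB.
    rewrite (@integralB_EFin _ _ _ mu D (cst 1) (fun t => g1 t ^+ 2 + g2 t ^+ 2)) //.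
    have -> : (\int[mu]_(t in D) (cst 1 t)%:E)%E = (2 * pi)%:E.
      have c1 : continuous ((fun=> 1) : R -> R) by move=> x; exact: cvg_cst.
      by rewrite (integral_integ pi2 c1 (@integ_cst R 0 (2 * pi) 1)) mul1r subr0.
    have -> : (\int[mu]_(t in D) (g1 t ^+ 2 + g2 t ^+ 2)%:E)%E = (2 * pi)%:E.
      under eq_integral do rewrite EFinD.
      by rewrite (@integralD_EFin _ _ _ mu D mD) // i1 i2 -EFinD V12.
    by rewrite subee.
  have mu_ : measurable_fun D (fun t => (u t)%:E).
    apply/measurable_EFinP; apply: measurable_funB; first exact: measurable_cst.
    by apply: measurable_funD; apply: measurable_funX; apply: measurable_bdry.
  have iabs : (\int[mu]_(t in D) `|(u t)%:E| = 0)%E.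
    rewrite -iu; apply: ae_eq_integral => //.
      exact: measurableT_comp.
    have := @filterI _ _ (ae_filter_ringOfSetsType mu) _ _ lims ends.
    apply: (@filterS _ _ (ae_filter_ringOfSetsType mu)) => t [h1 h2] Dt.
    rewrite gee0_abs // lee_fin subr_ge0; apply: bounded; exact: h1 (h2 Dt).
  have := (@ae_eq_integral_abs _ _ _ mu D mD _ mu_).1 iabs.
  by apply: (@filterS _ _ (ae_filter_ringOfSetsType mu)) => t h Dt; have [] := h Dt.
have := @filterI _ _ (ae_filter_ringOfSetsType mu) _ _ lims
  (@filterI _ _ (ae_filter_ringOfSetsType mu) _ _ ends u0).
apply: (@filterS _ _ (ae_filter_ringOfSetsType mu)) => t [h1 [h2 h3]] /set_mem Dt.
have t02 : 0 < t < 2 * pi by exact: h2.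
exists (g1 t +i* g2 t); split; last by exact: (h1 t02).
have : g1 t ^+ 2 + g2 t ^+ 2 = 1 by have := h3 Dt; rewrite /u; lra.
by rewrite /cmod /= => ->; rewrite sqrtr1.
Unshelve. all: by end_near. Qed.

End InnerFunction.

(** * The similarity of S_1 with the shift, and the subspace M in this model *)

Section Perturbation.
Variable R : realType.
Local Notation C := R[i].
Implicit Types (f g h u v : cseq R) (M N K : set (cseq R)).
Local Notation shift k := (iter k (@Mz R)).
Variables (a0 b0 : C).
Hypothesis a00 : a0 != 0.

(** The function F1 divided by z. *)
Definition F1coef : cseq R :=
  fun n => if n == 0%N then a0 - 1 else if n == 1%N then b0 else 0.

(* Aop intertwines S1 with Mz, hence maps S1-invariant subspaces onto
   Mz-invariant ones. *)
Definition Aop f : cseq R := caddf f (cscalef (f 0%N) F1coef).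
(** The division by a0 comes from (Aop f)(0) = a0 f(0). *)
Definition Ainv g : cseq R := csubf g (cscalef (g 0%N / a0) F1coef).

Lemma AopK f : Ainv (Aop f) = f.
Proof.
apply/funext => n; rewrite /Ainv /Aop /csubf /caddf /cscalef {2}/F1coef /=.
by field.
Qed.

Lemma AinvK g : Aop (Ainv g) = g.
Proof.
apply/funext => n; rewrite /Ainv /Aop /csubf /caddf /cscalef {2}/F1coef /=.
by field.
Qed.

Lemma S1E f : S1 a0 b0 f = Mz (Aop f).
Proof.
apply/funext => -[|[|[|n]]];
  rewrite /S1 /Fop /Aop /caddf /cscalef /F1coef /= ?mulr0 ?addr0 //.
Qed.

Lemma Ainv_Mz g : Ainv (Mz g) = Mz g.
Proof. by apply/funext => n; rewrite /Ainv /csubf /cscalef /= !mul0r subr0. Qed.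

Lemma AinvD f g : Ainv (caddf f g) = caddf (Ainv f) (Ainv g).
Proof. by apply/funext => n; rewrite /Ainv /csubf /caddf /cscalef; ring. Qed.

Lemma AinvZ c f : Ainv (cscalef c f) = cscalef c (Ainv f).
Proof. by apply/funext => n; rewrite /Ainv /csubf /cscalef; ring. Qed.

Lemma AinvB f g : Ainv (csubf f g) = csubf (Ainv f) (Ainv g).
Proof. by apply/funext => n; rewrite /Ainv /csubf /cscalef; ring. Qed.

Lemma F1coef0 n : (2 <= n)%N -> F1coef n = 0. Proof. by case: n => [|[|]]. Qed.

Lemma H2_F1coef : H2 F1coef. Proof. exact: H2_finite F1coef0. Qed.

Lemma H2_Aop f : H2 f -> H2 (Aop f).
Proof. by move=> hf; apply: H2D => //; apply/H2Z/H2_F1coef. Qed.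

Lemma H2_Ainv f : H2 f -> H2 (Ainv f).
Proof. by move=> hf; apply: H2B => //; apply/H2Z/H2_F1coef. Qed.

Lemma nsq_Ainv f : H2 f ->
  nsq (Ainv f) <= (2 + 2 * (cmod a0^-1 ^+ 2 * nsq F1coef)) * nsq f.
Proof.
move=> hf; rewrite /Ainv csubfE.
have hF := H2_F1coef; have hcF := H2Z (f 0%N / a0) hF.
apply: (le_trans (nsqD_le hf (H2Z (-1) hcF))).
rewrite !nsqZ // cmodN cmod1 expr1n mul1r cmodM exprMn.
have := coef_le_nsq 0 hf.
have : 0 <= cmod a0^-1 ^+ 2 * nsq F1coef by rewrite mulr_ge0 ?sqr_ge0 ?nsq_ge0.
rewrite -[X in _ + 2 * X]mulrA; move: (_ * nsq F1coef) => x; nra.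
Qed.

(** The set is the image of [M] under [Aop]; written as a preimage under the bounded map [Ainv], it
    is closed by continuity. *)
Lemma closed_Ainv M : closed_subspace M -> closed_subspace [set g | M (Ainv g)].
Proof.
move=> cM; apply: closed_subspaceI.
- by move=> g /= /(subH2 cM) h; rewrite -(AinvK g); apply: H2_Aop.
- rewrite /= (_ : Ainv _ = fun=> 0); first exact: sub0.
  by apply/funext => n; rewrite /Ainv /csubf /cscalef !mul0r subr0.
- by move=> f g /= Mf Mg; rewrite AinvD; apply: subD.
- by move=> c f /= Mf; rewrite AinvZ; apply: subZ.
- move=> u f /= hu hf h; apply: (closed_nsq cM hu (H2_Ainv hf)).
  have uH k : H2 (u k) by rewrite -(AinvK (u k)); apply/H2_Aop/(subH2 cM (hu k)).
  set c := 2 + 2 * (cmod a0^-1 ^+ 2 * nsq F1coef).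
  apply: (@squeeze_cvgr _ _ _ _ (fun=> 0) (fun k => c * nsq (csubf (u k) f))).
  + apply: nearW => k; rewrite -AinvB nsq_Ainv ?andbT; last exact: H2B.
    by apply/nsq_ge0/H2_Ainv/H2B.
  + exact: cvg_cst.
  + by rewrite -[X in _ --> X](mulr0 c); apply: cvgMr.
Qed.

(** [Ainv] fixes functions vanishing at 0, so Ainv (z g) = z g = S1 (Ainv g). *)
Lemma invariant_Ainv M : T_invariant (S1 a0 b0) M ->
  T_invariant (@Mz R) [set g | M (Ainv g)].
Proof.
by move=> iM g /= Mg; rewrite Ainv_Mz -{1}(AinvK g) -S1E; apply: iM.
Qed.

Hypothesis b0a0 : cmod b0 <= cmod a0.

Section Model.
Variables (M : set (cseq R)) (theta : cseq R).
Hypotheses (cM : closed_subspace M) (iM : T_invariant (S1 a0 b0) M).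
Let N := [set g | M (Ainv g)].
Hypotheses (Nt : N theta) (nt : nsq theta = 1).
Hypothesis ot : forall g, N g -> inner theta (Mz g) = 0.
Hypothesis dec : forall f, N f -> exists c, exists2 g, N g &
       f = caddf (cscalef c theta) (Mz g).

Let cN : closed_subspace N := closed_Ainv cM.
Let iN : T_invariant (@Mz R) N := invariant_Ainv iM.
Let ht : H2 theta := subH2 cN Nt.

Lemma model_orth k : inner (shift k.+1 theta) theta = 0.
Proof.
have hs := H2_shift k.+1 ht.
by rewrite inner_conj // ot ?conj0 //; apply: shift_in.
Qed.

Definition kappa : C := b0 / a0 * (cmod (theta 0%N) ^+ 2)%:C.
Definition outer_factor : {poly C} := 1 + kappa *: 'X.
Definition phi : cseq R := Ainv (pmulf outer_factor theta).

Lemma kappa_le1 : cmod kappa <= 1.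
Proof.
rewrite /kappa !cmodM cmodV cmod_real ger0_norm ?sqr_ge0 //.
have ha : 0 < cmod a0.
  by rewrite lt_neqAle cmod_ge0 andbT eq_sym; apply: contra a00 => /eqP /cmod_eq0 ->.
apply: mulr_ile1; rewrite ?divr_ge0 ?cmod_ge0 ?sqr_ge0 //.
  by rewrite ler_pdivrMr // mul1r.
by rewrite -nt coef_le_nsq.
Qed.

Lemma pmulf_outer_factor :
  pmulf outer_factor theta = caddf theta (cscalef kappa (Mz theta)).
Proof.
rewrite /outer_factor pmulfD pmulf1 -mul_polyC pmulfC -[X in pmulf X]mulr1.
by rewrite pmulfX pmulf1.
Qed.

Lemma phi_in : M phi.
Proof.
suff : N (pmulf outer_factor theta) by [].
rewrite pmulf_outer_factor; apply: (subD cN) => //; apply: (subZ cN).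
exact: iN.
Qed.

Lemma S1_phi : S1 a0 b0 phi = pmulf ('X * outer_factor) theta.
Proof. by rewrite S1E AinvK pmulfX. Qed.

(* kappa is the value for which the component along z theta cancels. *)
Lemma phi_orth g : N g -> inner (Mz g) phi = 0.
Proof.
have hp : H2 phi := subH2 cM phi_in.
pose K : set (cseq R) := [set g | H2 g /\ inner (Mz g) phi = 0].
suff h : N `<=` K by move=> /h [].
apply: (@shift_span _ N theta K cN iN Nt nt ot dec); last first.
  move=> k; split; first exact: H2_shift.
  change (inner (shift k.+1 theta) phi = 0).
  have hs := H2_shift k.+1 ht; have hz := H2_Mz ht; have hF := H2_F1coef.
  rewrite /phi pmulf_outer_factor /Ainv innerBr //; first last.
  - exact: H2Z.
  - by apply: H2D => //; apply: H2Z.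
  rewrite innerDr ?innerZr //; last exact: H2Z.
  rewrite model_orth add0r (inner_finite _ F1coef0) /pin !big_ord_recl big_ord0.
  rewrite /caddf /cscalef /= mulr0 mul0r addr0 add0r addr0.
  rewrite inner_Mz //; last exact: H2_shift.
  (* For k >= 1, z^(k+1) theta has no coefficients at 0 and 1 and is not seen by [F1coef]. *)
  case: k {hs} => [|k] /=; last first.
    by rewrite model_orth mul0r !mulr0 subr0.
  (* For k = 0, kappa z theta contributes conj(kappa), and the correction in [Ainv] contributes
     theta(0) conj(b0 theta(0) / a0); they cancel. *)
  rewrite (inner_nsq ht) nt mulr1 /kappa /F1coef /= !conjM conj_real -mul_conj.
  ring.
apply: closed_subspaceI.
- by move=> f [].
- split; first exact: H2_0.
  rewrite (_ : Mz _ = fun=> 0); last by apply/funext => -[].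
  by rewrite inner_conj ?inner0r ?conj0 //; apply: H2_0.
- move=> f h [hf of_] [hh oh]; split; first exact: H2D.
  by rewrite MzD innerDl ?of_ ?oh ?addr0 //; apply: H2_Mz.
- move=> c f [hf of_]; split; first exact: H2Z.
  by rewrite MzZ innerZl ?of_ ?mulr0 //; apply: H2_Mz.
- move=> u f hu hf h; split => //.
  have uH k : H2 (u k) by case: (hu k).
  apply: (@cvg_unique0 _ (fun k => inner (Mz (u k)) phi)); last by move=> k; case: (hu k).
  apply: inner_cvg => //; [by move=> k; apply: H2_Mz|exact: H2_Mz|].
  rewrite (_ : (fun k => _) = (fun k => nsq (csubf (u k) f))) //.
  by apply/funext => k; rewrite -MzB nsq_Mz //; apply: H2B.
Qed.

Lemma S1_in g : M g -> exists2 n, N n & S1 a0 b0 g = Mz n.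
Proof. by move=> Mg; exists (Aop g); rewrite ?S1E // /N /= AopK. Qed.

Lemma wandering_phi : wandering (S1 a0 b0) M phi.
Proof.
split; first exact: phi_in.
move=> g /S1_in [n Nn ->]; have hn := H2_Mz (subH2 cN Nn).
by rewrite inner_conj ?phi_orth ?conj0 //; apply: (subH2 cM phi_in).
Qed.

(** For psi wandering, with c the coefficient of theta in A psi, e = psi - c phi is orthogonal to S1
    M. The constant part c theta cancels, so that e lies in zN, which is S1 M; hence e = 0. *)
Lemma wandering_line : wandering (S1 a0 b0) M = cline phi.
Proof.
have [Mp op] := wandering_phi; have hp := subH2 cM Mp.
rewrite eqEsubset; split; last first.
  move=> _ [c _ <-]; split; first exact: (subZ cM).
  move=> g Mg; have [n Nn e] := S1_in Mg.
  have hn : H2 (S1 a0 b0 g) by rewrite e; apply: H2_Mz (subH2 cN Nn).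
  by rewrite innerZl // op // mulr0.
move=> psi [Mpsi opsi]; have hpsi := subH2 cM Mpsi.
have [c [n Nn En]] : exists c, exists2 g, N g &
    Aop psi = caddf (cscalef c theta) (Mz g).
  by apply: dec; rewrite /N /= AopK.
pose e := csubf psi (cscalef c phi).
have Ee : e = Mz (csubf n (cscalef (c * kappa) theta)).
  rewrite /e -(AopK psi) En /phi pmulf_outer_factor -AinvZ -AinvB.
  rewrite -[RHS]Ainv_Mz; congr Ainv; rewrite MzB MzZ.
  by apply/funext => k; rewrite /csubf /caddf /cscalef; ring.
have Nk : N (csubf n (cscalef (c * kappa) theta)).
  by apply: (subB cN) => //; apply: (subZ cN).
have Me : M e by apply: (subB cM) => //; apply: (subZ cM).
have he := subH2 cM Me.
have e0 : e = fun=> 0.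
  apply: nsq_eq0 => //.
  have : inner e e = 0.
    rewrite {2}Ee -(AinvK (csubf n _)) -S1E.
    have hz : H2 (S1 a0 b0 (Ainv (csubf n (cscalef (c * kappa) theta)))).
      by rewrite S1E AinvK -Ee.
    have hcp := H2Z c hp.
    by rewrite innerBl // innerZl // opsi // op // mulr0 subr0.
  by rewrite inner_nsq // => /(congr1 (@complex.Re R)) /= ->.
exists c => //; apply/funext => k; have := congr1 (fun w => w k) e0.
by rewrite /e /csubf => /eqP; rewrite subr_eq0 => /eqP ->.
Qed.

(** The outer factor h admits polynomials q with q h close to 1; since multiplication by [theta] is
    isometric, q h theta is close to [theta]. Thus [theta], and with it all of N, lies in the image
    of [K] under [Aop]. *)
Lemma gen_phi K : closed_subspace K -> T_invariant (S1 a0 b0) K -> K phi ->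
  M `<=` K.
Proof.
move=> cK iK Kphi.
pose N' := [set g | K (Ainv g)].
have cN' : closed_subspace N' := closed_Ainv cK.
have iN' : T_invariant (@Mz R) N' := invariant_Ainv iK.
have N'q q : N' (pmulf (q * outer_factor) theta).
  elim/poly_ind: q => [|q c IH].
    rewrite mul0r (_ : pmulf 0 theta = fun=> 0); first exact: sub0 cN'.
    by apply/funext => n; rewrite /pmulf big1 // => i _; rewrite coef0 mul0r.
  rewrite mulrDl pmulfD pmulfC; apply: (subD cN'); last exact: (subZ cN').
  by rewrite [q * 'X]mulrC -mulrA pmulfX; apply: iN'.
have h1 := @H2_pcoef R 1.
have /choice [q hq] : forall k : nat, exists q : {poly C},
    nsq (csubf (pcoef (q * outer_factor)) (pcoef 1)) <= k.+1%:R^-1.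
  move=> k; have k0 : 0 < k.+1%:R^-1 :> R by rewrite invr_gt0.
  have [|q hq] := outer_linear kappa_le1 h1 (eps := Num.sqrt (k.+1%:R^-1)).
    by rewrite sqrtr_gt0.
  exists q; rewrite nsq_of_norm2; last by apply: H2B => //; apply: H2_pcoef.
  rewrite -[leRHS](sqr_sqrtr (ltW k0)) ler_pXn2r ?nnegrE ?sqrtr_ge0 //.
  exact: ltW.
have N't : N' theta.
  apply: (closed_nsq cN' (fun k => N'q (q k)) ht).
  have hd k : H2 (csubf (pcoef (q k * outer_factor)) (pcoef 1)).
    by apply: H2B => //; apply: H2_pcoef.
  have E k : csubf (pmulf (q k * outer_factor) theta) theta =
      cprod (csubf (pcoef (q k * outer_factor)) (pcoef 1)) theta.
    rewrite -{2}(pmulf1 theta); apply/funext => n.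
    rewrite /csubf /pmulf /cprod -sumrB; apply: eq_bigr => i _.
    by rewrite /pcoef mulrBl.
  apply: (@squeeze_cvgr _ _ _ _ (fun=> 0) (fun k => k.+1%:R^-1)).
  - apply: nearW => k; have hc := H2_cprod ht (@model_orth) (hd k).
    rewrite E nsq_ge0 //=.
    apply: (le_trans (nsq_cprod ht (@model_orth) (hd k))).
    by rewrite nt mul1r.
  - exact: cvg_cst.
  - exact: cvg_harmonic.
have sub : N `<=` N'.
  apply: (@shift_span _ N theta N' cN iN Nt nt ot dec) => // k.
  exact: shift_in.
move=> f Mf; rewrite -(AopK f); apply: sub.
by rewrite /N /= AopK.
Qed.

End Model.

End Perturbation.

(** * The equivalence, from Beurling's theorem applied to the image of M under [Aop] *)

Theorem theorem6p2 (R : realType) (a0 b0 : R[i])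
  (hb0 : 0 < cmod b0) (hab : cmod b0 <= cmod a0)
  (M : set (cseq R))
  (hM : closed_subspace M) (hMinv : T_invariant (S1 a0 b0) M)
  (hM0 : exists f, M f /\ f <> (fun _ => 0)) :
  M = gen_inv (S1 a0 b0) (wandering (S1 a0 b0) M) <->
  exists (theta : cseq R) (p : {poly R[i]}) (phi : cseq R),
    inner_fun theta /\ outer_poly p /\
    wandering (S1 a0 b0) M = cline phi /\
    S1 a0 b0 phi = pmulf ('X * p) theta.
Proof.
have a00 : a0 != 0.
  apply/eqP => a00; move: (lt_le_trans hb0 hab).
  by rewrite a00 cmod0 ltxx.
have cN := closed_Ainv b0 a00 hM; have iN := invariant_Ainv a00 hMinv.
have [|theta [Nt nt ot dec]] := Beurling cN iN.
  have [f [Mf f0]] := hM0; exists (Aop a0 b0 f); split; first by rewrite /= AopK.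
  move=> Af; apply: f0; rewrite -(AopK b0 a00 f) Af; apply/funext => n.
  by rewrite /Ainv /csubf /cscalef !mul0r subr0.
have ht : H2 theta := subH2 cN Nt.
split => _.
  exists theta, (outer_factor a0 b0 theta), (phi a0 b0 theta); split.
    exact: inner_fun_of_orth ht nt (model_orth a00 hM hMinv Nt ot).
  split; first exact: outer_linear (kappa_le1 a00 hab hM Nt nt).
  split; first exact: (wandering_line a00 hM hMinv Nt nt ot dec).
  exact: S1_phi.
rewrite eqEsubset; split.
  move=> f Mf K cK iK wK.
  apply: (gen_phi a00 hab hM hMinv Nt nt ot dec cK iK) => //; apply: wK.
  exact: (wandering_phi a00 hM hMinv Nt nt ot dec).
(* M is itself one of the subspaces intersected in [gen_inv]. *)
by move=> f /(_ M hM hMinv); apply => g [].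
Qed.
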